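(* Consider the adaptive data-collection setting, scores, chronological split, pilot direction $w_n$, variance estimators and statistic $T_n(w_n)$ defined in the context. Assume: (1) (Ignorability, positivity) For each $b\in\{a,a'\}$ and $t\ge 1$: $Y_t=Y_t(b)$ on $\{A_t=b\}$; $Y_t(b)\perp A_t\mid (X_t,\mathcal F_{t-1})$; and $\pi_t(b\mid X_t)>0$ almost surely. (2) (Kernel) $k_{\mathcal Y}$ is characteristic and $\sup_{y\in\mathcal Y}k_{\mathcal Y}(y,y)\le\kappa<\infty$. (3) (Nuisance envelope) There is $B_\mu<\infty$ with $\sup_{r\in\{1,2\}}\sup_{t\ge 1}\sup_{b\in\mathcal A,x\in\mathcal X}\|\widehat\mu^{(r)}_{t-1}(b,x)\|_{\mathcal H_{\mathcal Y}}\le B_\mu$ a.s. (4) (Nuisance stabilization) There exist $\mu_\infty:\mathcal A\times\mathcal X\to\mathcal H_{\mathcal Y}$ and $\beta>0$ with $\|\widehat\mu^{(2)}_{t-1}-\mu_\infty\|_{L_2(P_X\times\mu_{\mathcal A};\mathcal H_{\mathcal Y})}=O(t^{-\beta})$ a.s. (5) (Policy class) There exist a reference policy $\pi_{\mathrm{ref}}$ and constants $G<\infty$, $p>0$ such that, with $\mathcal G_{\mathrm{ref}}=\{\pi/\pi_{\mathrm{ref}}:\pi\in\Pi\}$, $\sup_{g\in\mathcal G_{\mathrm{ref}}}\|g\|_\infty\le G$ and $\log N_{[]}(\varepsilon,\mathcal G_{\mathrm{ref}},\|\cdot\|_{2,\mathrm{ref}})\lesssim\varepsilon^{-p}$. (6)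 (Exploration floor) There exist $c_\pi>0$ and $\alpha\in[0,1)$ with $\alpha<\min\{\frac1{3+p},\frac1{1+2p},\beta\}$ such that $\pi_t(b\mid x)\ge c_\pi t^{-\alpha}$ for every $t\ge1$, every $b\in\mathcal A$ and $P_X$-almost every $x$. (7) (Negligible clipping) $\frac1n\sum_{t\in\mathcal I_2}\mathbf 1\{\sigma_{0,t}(w_n)\le 2\epsilon_n\}\to 0$ in probability. Let $\nu(\alpha,\beta,p)>0$ be the rate constant described in the context, and let the clip sequence be $\epsilon_n=n^{-\rho}$ with $$0<\rho<\min\Big\{\frac{1-3\alpha}{4},\frac{\nu(\alpha,\beta,p)}{2}\Big\}.$$ Then, under $H_0:\eta(a)=\eta(a')$, $T_n(w_n)$ converges in distribution to $\mathcal N(0,1)$ as $n\to\infty$.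
   Context: **Adaptive data.** $P_X$ is a distribution on $\mathcal X$; $\mathcal A$ is a discrete action set with base measure $\mu_{\mathcal A}$ (counting measure, so policy densities are action probabilities); $P_{Y\mid X,A}$ is a fixed conditional distribution on $\mathcal Y$; $\Pi$ is a class of policies (conditional densities on $\mathcal A$ given $x\in\mathcal X$). With $\mathcal F_{t-1}=\sigma(X_1,A_1,Y_1,\dots,X_{t-1},A_{t-1},Y_{t-1})$, at each round $t$: $X_t\sim P_X$ independently of the past; $A_t\sim\pi_t(\cdot\mid X_t)$ given $(\mathcal F_{t-1},X_t)$, where $\pi_t\in\Pi$ may depend on $\mathcal F_{t-1}$; then $Y_t\sim P_{Y\mid X,A}(\cdot\mid X_t,A_t)$, depending only on the current context and action. Potential outcomes $Y_t(b)$, $b\in\mathcal A$, satisfy $Y_t=Y_t(A_t)$. Target actions $a,a'\in\mathcal A$ are fixed. **Embeddings.** $k_{\mathcal Y}$ is a kernel on $\mathcal Y$ with RKHS $\mathcal H_{\mathcal Y}$ and feature map $\phi_{\mathcal Y}(y)=k_{\mathcal Y}(\cdot,y)$; characteristic means that the mean embedding of probability measures is injective. $\mu_{Y\mid A,X}(b,x)=\mathbb E[\phi_{\mathcal Y}(Y)\mid A=b,X=x]$. The interventional mean embedding is $\eta(b)=\mathbb E[\phi_{\mathcal Y}(Y(b))]$, with expectation over $X\sim P_X$ and the outcome law $P_{Y\mid X,A}(\cdot\mid X,b)$, so $\eta(b)=\mathbb E_{P_X}[\mu_{Y\mid A,X}(b,X)]$; $\Psi(a,a')=\eta(a)-\eta(a')$.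 **Scores.** For a policy $\pi$ and $\bar\mu:\mathcal A\times\mathcal X\to\mathcal H_{\mathcal Y}$, $$D'(\pi,\bar\mu,b)(X,A,Y)=\frac{\mathbf 1\{A=b\}}{\pi(b\mid X)}(\phi_{\mathcal Y}(Y)-\bar\mu(b,X))+\bar\mu(b,X).$$ $T=2n$, $\mathcal I_1=\{1,\dots,n\}$, $\mathcal I_2=\{n+1,\dots,2n\}$. For $r\in\{1,2\}$, $t\in\mathcal I_r$, $\widehat\mu^{(r)}_{t-1}$ is an $\mathcal F_{t-1}$-measurable estimator of $\mu_{Y\mid A,X}$, and $$\hat\phi^{(r)}_t=D'(\pi_t,\widehat\mu^{(r)}_{t-1},a)(X_t,A_t,Y_t)-D'(\pi_t,\widehat\mu^{(r)}_{t-1},a')(X_t,A_t,Y_t).$$ Pilot witness $v_n=\frac1n\sum_{t\in\mathcal I_1}\hat\phi^{(1)}_t$; pilot direction $w_n=v_n/\|v_n\|_{\mathcal H_{\mathcal Y}}$ if $v_n\ne0$ and $w_n=u_0$ otherwise, where $u_0$ is a fixed unit vector. For $t\in\mathcal I_2$: $\xi_t(w_n)=\langle w_n,\hat\phi^{(2)}_t\rangle_{\mathcal H_{\mathcal Y}}$ and $\sigma_{0,t}(w_n)=\mathrm{Var}(\xi_t(w_n)\mid\mathcal F_{t-1})^{1/2}$. **Variance estimator.** For $t\in\mathcal I_2$ let $S_t=\{s\in\mathcal I_2:s<t\}$, $m_t=|S_t|$, and for $s\in S_t$ $$\check\xi_{s,t}(w_n)=\big\langle w_n,\,D'(\pi_t,\widehat\mu^{(2)}_{s-1},a)(X_s,A_s,Y_s)-D'(\pi_t,\widehat\mu^{(2)}_{s-1},a')(X_s,A_s,Y_s)\big\rangle_{\mathcal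 H_{\mathcal Y}},\quad w_{s,t}=\frac{\pi_t(A_s\mid X_s)}{\pi_s(A_s\mid X_s)}.$$ For $t\ge n+2$: $\widehat M_{1,t}(w_n)=\frac1{m_t}\sum_{s\in S_t}w_{s,t}\check\xi_{s,t}(w_n)$, $\widehat M_{2,t}(w_n)=\frac1{m_t}\sum_{s\in S_t}w_{s,t}\check\xi_{s,t}(w_n)^2$, $\widehat\sigma_t^2(w_n)=(\widehat M_{2,t}(w_n)-\widehat M_{1,t}(w_n)^2)_+$. For $t=n+1$: $\widehat M_{1,n+1}=0$, $\widehat M_{2,n+1}=1$, $\widehat\sigma^2_{n+1}=1$. Oracle moments: $M_{j,t}(w_n)=\mathbb E[\xi_t(w_n)^j\mid\mathcal F_{t-1}]$, $j=1,2$. With a deterministic clip sequence $\epsilon_n\downarrow0$, $\widetilde\sigma_t(w_n)=\max(\widehat\sigma_t(w_n),\epsilon_n)$. **Statistic.** $T_n(w_n)=\frac1{\sqrt n}\sum_{t\in\mathcal I_2}\widetilde\sigma_t(w_n)^{-1}\xi_t(w_n)$. **Norms.** $\|m\|^2_{L_2(P_X\times\mu_{\mathcal A};\mathcal H_{\mathcal Y})}=\int\!\int\|m(b,x)\|^2_{\mathcal H_{\mathcal Y}}d\mu_{\mathcal A}(b)dP_X(x)$; $\|h\|^2_{2,\mathrm{ref}}=\mathbb E_{X\sim P_X}[\int h(b,X)^2\pi_{\mathrm{ref}}(b\mid X)d\mu_{\mathcal A}(b)]$; $N_{[]}$ is the bracketing number. The reference policy $\pi_{\mathrm{ref}}$ is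 a fixed strictly positive conditional density. **Rate constant.** $\nu(\alpha,\beta,p)>0$ denotes a constant such that, under assumptions (1)-(6) of the claim, each of $\frac1n\sum_{t\in\mathcal I_2}|\widehat M_{1,t}(w_n)-M_{1,t}(w_n)|$, $\frac1n\sum_{t\in\mathcal I_2}|\widehat M_{2,t}(w_n)-M_{2,t}(w_n)|$ and $\frac1n\sum_{t\in\mathcal I_2}|\widehat\sigma_t^2(w_n)-\sigma_{0,t}^2(w_n)|$ is $O_{\mathrm{a.s.}}(n^{-\nu(\alpha,\beta,p)})$ (the paper proves that such a constant exists). $Z_n=O_{\mathrm{a.s.}}(r_n)$ means $\limsup_n|Z_n|/r_n<\infty$ almost surely. *)

(* Defs.v *)
From HB Require Import structures.
From mathcomp Require Import all_boot all_order all_algebra.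
From mathcomp Require Import all_classical all_reals all_analysis.
From mathcomp Require Import measurable_realfun.

Set Implicit Arguments.
Unset Strict Implicit.
Unset Printing Implicit Defensive.

Import Order.TTheory GRing.Theory Num.Theory.
Import numFieldNormedType.Exports.

Local Open Scope classical_set_scope.
Local Open Scope ring_scope.

HB.mixin Record CompleteNormedModule_isHilbert (R : realType) H
    & CompleteNormedModule R H := {
  inner : H -> H -> R ;
  innerC : forall x y, inner x y = inner y x ;
  innerDl : forall x y z, inner (x + y) z = inner x z + inner y z ;
  innerZl : forall (c : R) x y, inner (c *: x) y = c * inner x y ;
  inner_norm : forall x, inner x x = `|x| ^+ 2
}.

#[short(type="hilbertType")]
HB.structure Definition Hilbert (R : realType) :=
  {H of CompleteNormedModule R H & CompleteNormedModule_isHilbert R H}.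

Section HilbertValued.
Context {R : realType} {H : hilbertType R}.

(* Bochner (strong) measurability: pointwise limit of simple functions. *)
Definition strongly_measurable d (T : measurableType d) (f : T -> H) : Prop :=
  exists g : nat -> T -> H,
    (forall n, finite_set (range (g n)) /\
               forall h, measurable (g n @^-1` [set h])) /\
    (forall x, g ^~ x @ \oo --> f x).

(* The integral is characterised by testing against all vectors; for strongly
   measurable, norm-integrable integrands it is the Bochner integral. *)
Definition is_hintegral d (T : measurableType d) (m : {measure set T -> \bar R})
    (f : T -> H) (v : H) : Prop :=
  forall h, m.-integrable setT (fun x => (inner h (f x))%:E) /\
            inner h v = Rintegral m setT (fun x => inner h (f x)).

Definition hintegral d (T : measurableType d) (m : {measure set T -> \bar R})
    (f : T -> H) : H :=
  xget 0 (is_hintegral m f).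

(* H is the reproducing kernel Hilbert space of k on Y: ev realises H as a space
   of functions on Y (its linearity follows from the reproducing property) and
   phi y is the function k(., y). *)
Record is_rkhs (Y : Type) (k : Y -> Y -> R) (ev : H -> Y -> R) (phi : Y -> H) :
    Prop := IsRKHS {
  rkhs_inj : injective ev ;
  rkhs_feature : forall y, ev (phi y) = k ^~ y ;
  rkhs_reproducing : forall h y, ev h y = inner h (phi y)
}.

Definition characteristic d (Y : measurableType d) (phi : Y -> H) : Prop :=
  forall Q1 Q2 : probability Y R,
    hintegral Q1 phi = hintegral Q2 phi ->
    forall C, measurable C -> Q1 C = Q2 C.

End HilbertValued.

Section Probability.
Context {R : realType} {d} {Om : measurableType d} (P : probability Om R).

(* Sub-sigma-algebras are given by a generating family G of measurable sets. *)
Definition is_cond_exp (G : set (set Om)) (f g : Om -> R) : Prop :=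
  [/\ measurable_fun [set: g_sigma_algebraType G]
        (g : g_sigma_algebraType G -> R),
      P.-integrable setT (EFin \o g) &
      forall D, <<s G >> D ->
        (\int[P]_(w in D) (g w)%:E = \int[P]_(w in D) (f w)%:E)%E].

(* A chosen version; unique up to P-null sets. *)
Definition cond_exp (G : set (set Om)) (f : Om -> R) : Om -> R :=
  xget (cst 0) (is_cond_exp G f).

Definition cond_prob (G : set (set Om)) (E : set Om) : Om -> R :=
  cond_exp G \1_E.

Definition cond_var (G : set (set Om)) (f : Om -> R) : Om -> R :=
  cond_exp G (fun w => (f w - cond_exp G f w) ^+ 2).

Definition cond_indep (G : set (set Om))
    d1 (T1 : measurableType d1) (U : Om -> T1)
    d2 (T2 : measurableType d2) (V : Om -> T2) : Prop :=
  forall B C, measurable B -> measurable C ->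
    {ae P, forall w, cond_prob G (U @^-1` B `&` V @^-1` C) w =
                     cond_prob G (U @^-1` B) w * cond_prob G (V @^-1` C) w}.

Definition bigO_as (Z : nat -> Om -> \bar R) (r : nat -> R) : Prop :=
  {ae P, forall w,
    (limn_esup (fun n => `|Z n w| * ((r n)^-1)%:E) < +oo)%E}.

Definition cvg_in_probability0 (Z : nat -> Om -> R) : Prop :=
  forall e : R, 0 < e -> P [set w | e < `|Z n w|] @[n --> \oo] --> 0%E.

(* Convergence of distribution functions at the continuity points of the limit
   law. *)
Definition cvg_in_distribution (Z : nat -> Om -> R)
    (Q : set R -> \bar R) : Prop :=
  forall x : R, Q [set x] = 0%E ->
    P [set w | Z n w <= x] @[n --> \oo] --> Q [set y | y <= x].

End Probability.

Section Policies.
Context {R : realType} {dX dA} {X : measurableType dX} {A : measurableType dA}.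

(* Discrete: countable, with every subset measurable; the base measure is
   [counting]. *)
Definition discrete_actions : Prop :=
  countable [set: A] /\ forall B : set A, measurable B.

Definition cond_density (pi : A -> X -> R) : Prop :=
  [/\ forall b, measurable_fun setT (pi b),
      forall b x, 0 <= pi b x &
      forall x, (\int[counting]_b (pi b x)%:E = 1)%E].

Context (PX : probability X R).

Definition L2norm (H : hilbertType R) (m : A -> X -> H) : \bar R :=
  ((\int[PX]_x \int[counting]_b (`|m b x| ^+ 2)%:E) `^ 2^-1)%E.

Definition refnorm (piref : A -> X -> R) (h : A -> X -> R) : \bar R :=
  ((\int[PX]_x \int[counting]_b (h b x ^+ 2 * piref b x)%:E) `^ 2^-1)%E.

Definition is_bracket (nrm : (A -> X -> R) -> \bar R) (e : R)
    (l u : A -> X -> R) : Prop :=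
  [/\ forall b, measurable_fun setT (l b) /\ measurable_fun setT (u b),
      (nrm l < +oo)%E, (nrm u < +oo)%E &
      (nrm (fun b x => (u b x - l b x)%R) < e%:E)%E].

Definition bracketing_number (F : set (A -> X -> R))
    (nrm : (A -> X -> R) -> \bar R) (e : R) : \bar R :=
  ereal_inf [set N%:R%:E | N in [set N : nat |
    exists l u : 'I_N -> A -> X -> R,
      (forall i, is_bracket nrm e (l i) (u i)) /\
      (forall g, F g -> exists i, forall b x, l i b x <= g b x <= u i b x)]].

End Policies.

Section Interventional.
Context {R : realType} {dX dA dY}
  {X : measurableType dX} {A : measurableType dA} {Y : measurableType dY}.
Context (PX : probability X R) (Q : R.-pker (X * A)%type ~> Y).

(* Law of the outcome under the intervention A = b. *)
Definition outcome_law (b : A) (C : set Y) : \bar R :=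
  (\int[PX]_x Q (x, b) C)%E.

Section OutcomeLawMeasure.
Variable b : A.

Let outcome_law0 : outcome_law b set0 = 0%E.
Proof.
rewrite /outcome_law.
by under eq_integral do rewrite measure0; rewrite integral0.
Qed.

Let outcome_law_ge0 C : (0 <= outcome_law b C)%E.
Proof. exact: integral_ge0. Qed.

Let outcome_law_additive : semi_sigma_additive (outcome_law b).
Proof.
move=> F mF tF mUF; rewrite /outcome_law.
have mQ n : measurable_fun [set: X] (fun x : X => Q (x, b) (F n) : \bar R).
  exact: (measurableT_comp (measurable_kernel Q _ (mF n)) (pair2_measurable b)).
rewrite [X in _ --> X](_ : _ = (\sum_(n <oo) \int[PX]_x Q (x, b) (F n))%E).
  by apply: is_cvg_nneseries => n _ _; exact: integral_ge0.
rewrite -integral_nneseries//.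
by apply: eq_integral => x _; apply/esym/cvg_lim => //; exact: measure_semi_sigma_additive.
Qed.

HB.instance Definition _ := isMeasure.Build _ _ _ (outcome_law b)
  outcome_law0 outcome_law_ge0 outcome_law_additive.

End OutcomeLawMeasure.

Definition eta {H : hilbertType R} (phi : Y -> H) (b : A) : H :=
  hintegral (outcome_law b) phi.

End Interventional.

Section Adaptive.
Context {R : realType} {dO dX dA dY} {Om : measurableType dO}
  {X : measurableType dX} {A : measurableType dA} {Y : measurableType dY}
  {H : hilbertType R}.

(* Rounds are numbered from 1; the values at round 0 are never used.
   [pol D t w b x] is pi_t(b | x) and [muhat_r D s w] is the stage-r nuisance
   estimator built from the history up to round s, used at round s + 1. *)
Record experiment := Experiment {
  ctx : nat -> {mfun Om >-> X} ;
  act : nat -> {mfun Om >-> A} ;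
  out : nat -> {mfun Om >-> Y} ;
  pot : nat -> A -> {mfun Om >-> Y} ;
  pol : nat -> Om -> A -> X -> R ;
  muhat1 : nat -> Om -> A -> X -> H ;
  muhat2 : nat -> Om -> A -> X -> H
}.

Implicit Types D : experiment.

Definition sigma_of d (T : measurableType d) (f : Om -> T) : set (set Om) :=
  preimage_set_system setT f measurable.

(* Generators of F_t, of sigma(F_{t-1}, X_t) and of sigma(F_{t-1}, X_t, A_t). *)
Definition hist D (t : nat) : set (set Om) :=
  \bigcup_(s in [set s | (1 <= s <= t)%N])
    (sigma_of (ctx D s) `|` sigma_of (act D s) `|` sigma_of (out D s)).

Definition histX D (t : nat) : set (set Om) :=
  hist D t.-1 `|` sigma_of (ctx D t).

Definition histXA D (t : nat) : set (set Om) :=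
  histX D t `|` sigma_of (act D t).

Record adaptive_data (P : probability Om R) (PX : probability X R)
    (Q : R.-pker (X * A)%type ~> Y) (Pi : set (A -> X -> R)) D : Prop :=
    AdaptiveData {
  policies_density : forall pi, Pi pi -> cond_density pi ;
  policy_in_class : forall t w, (1 <= t)%N -> Pi (pol D t w) ;
  policy_predictable : forall t b, (1 <= t)%N ->
    measurable_fun [set: g_sigma_algebraType (hist D t.-1) * X]
      (fun z => pol D t z.1 b z.2) ;
  nuisance_predictable : forall t b, (1 <= t)%N ->
    strongly_measurable (fun z : g_sigma_algebraType (hist D t.-1) * X =>
      muhat1 D t.-1 z.1 b z.2) /\
    strongly_measurable (fun z : g_sigma_algebraType (hist D t.-1) * X =>
      muhat2 D t.-1 z.1 b z.2) ;
  context_law : forall t, (1 <= t)%N -> forall B E,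
    measurable B -> <<s hist D t.-1 >> E ->
    P (ctx D t @^-1` B `&` E) = (PX B * P E)%E ;
  action_law : forall t b, (1 <= t)%N ->
    {ae P, forall w, cond_prob P (histX D t) (act D t @^-1` [set b]) w =
                     pol D t w b (ctx D t w)} ;
  outcome_cond_law : forall t, (1 <= t)%N -> forall C, measurable C ->
    {ae P, forall w, (cond_prob P (histXA D t) (out D t @^-1` C) w)%:E =
                     Q (ctx D t w, act D t w) C} ;
  consistency : forall t w, (1 <= t)%N -> out D t w = pot D t (act D t w) w
}.

Context (P : probability Om R) (PX : probability X R) (phi : Y -> H).

Section Statistics.
Context D (a a' : A) (u0 : H) (eps : nat -> R).

Definition score (pi : A -> X -> R) (mbar : A -> X -> H) (b : A)
    (x : X) (c : A) (y : Y) : H :=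
  ((c == b)%:R / pi b x) *: (phi y - mbar b x) + mbar b x.

Definition contrast (pi : A -> X -> R) (mbar : A -> X -> H)
    (x : X) (c : A) (y : Y) : H :=
  score pi mbar a x c y - score pi mbar a' x c y.

Definition phihat (muhat : nat -> Om -> A -> X -> H) (t : nat) (w : Om) : H :=
  contrast (pol D t w) (muhat t.-1 w) (ctx D t w) (act D t w) (out D t w).

Definition pilot_witness (n : nat) (w : Om) : H :=
  n%:R^-1 *: \sum_(1 <= t < n.+1) phihat (muhat1 D) t w.

Definition pilot_direction (n : nat) (w : Om) : H :=
  let v := pilot_witness n w in if v == 0 then u0 else `|v|^-1 *: v.

Definition xi (n t : nat) (w : Om) : R :=
  inner (pilot_direction n w) (phihat (muhat2 D) t w).

Definition sigma0 (n t : nat) (w : Om) : R :=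
  Num.sqrt (cond_var P (hist D t.-1) (xi n t) w).

Definition oracle_moment (j n t : nat) : Om -> R :=
  cond_exp P (hist D t.-1) (fun w => xi n t w ^+ j).

Definition xicheck (n s t : nat) (w : Om) : R :=
  inner (pilot_direction n w)
    (contrast (pol D t w) (muhat2 D s.-1 w) (ctx D s w) (act D s w) (out D s w)).

Definition ipw (s t : nat) (w : Om) : R :=
  pol D t w (act D s w) (ctx D s w) / pol D s w (act D s w) (ctx D s w).

(* S_t = {n+1, ..., t-1}, of cardinality t - (n+1). *)
Definition Mhat (j n t : nat) (w : Om) : R :=
  (t - n.+1)%:R^-1 * \sum_(n.+1 <= s < t) ipw s t w * xicheck n s t w ^+ j.

Definition Mhat1 (n t : nat) (w : Om) : R :=
  if t == n.+1 then 0 else Mhat 1 n t w.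

Definition Mhat2 (n t : nat) (w : Om) : R :=
  if t == n.+1 then 1 else Mhat 2 n t w.

Definition sigmahat2 (n t : nat) (w : Om) : R :=
  if t == n.+1 then 1 else Num.max (Mhat2 n t w - Mhat1 n t w ^+ 2) 0.

Definition sigmatilde (n t : nat) (w : Om) : R :=
  Num.max (Num.sqrt (sigmahat2 n t w)) (eps n).

Definition avg2 (n : nat) (f : nat -> R) : R :=
  n%:R^-1 * \sum_(n.+1 <= t < n.*2.+1) f t.

Definition Tstat (n : nat) (w : Om) : R :=
  (Num.sqrt n%:R)^-1 *
  \sum_(n.+1 <= t < n.*2.+1) (sigmatilde n t w)^-1 * xi n t w.

Definition ignorability_positivity : Prop :=
  forall b, b = a \/ b = a' -> forall t, (1 <= t)%N ->
    [/\ forall w, act D t w = b -> out D t w = pot D t b w,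
        cond_indep P (histX D t) (pot D t b) (act D t) &
        {ae P, forall w, 0 < pol D t w b (ctx D t w)}].

Definition kernel_assumption (k : Y -> Y -> R) : Prop :=
  characteristic phi /\ exists kappa, forall y, k y y <= kappa.

Definition nuisance_envelope : Prop :=
  exists Bmu : R, {ae P, forall w, forall t b x, (1 <= t)%N ->
    `|muhat1 D t.-1 w b x| <= Bmu /\ `|muhat2 D t.-1 w b x| <= Bmu}.

Definition nuisance_stabilization (beta : R) : Prop :=
  0 < beta /\
  exists muinf : A -> X -> H,
    (forall b, strongly_measurable (muinf b)) /\
    bigO_as P
      (fun t w => L2norm PX (fun b x => muhat2 D t.-1 w b x - muinf b x))
      (fun t => t%:R `^ (- beta)).

Definition policy_class (Pi : set (A -> X -> R)) (p : R) : Prop :=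
  0 < p /\
  exists piref : A -> X -> R,
    let Gref := [set (fun b x => pi b x / piref b x) | pi in Pi] in
    [/\ cond_density piref, forall b x, 0 < piref b x,
        exists G : R, forall g, Gref g -> forall b,
          {ae PX, forall x, `|g b x| <= G} &
        exists C : R, forall e, 0 < e <= 1 ->
          (lne (bracketing_number Gref (refnorm PX piref) e) <=
           (C * e `^ (- p))%:E)%E].

Definition exploration_floor (alpha beta p : R) : Prop :=
  [/\ 0 <= alpha < 1,
      alpha < Num.min (3 + p)^-1 (Num.min (1 + 2 * p)^-1 beta) &
      exists2 c : R, 0 < c & {ae P, forall w, forall t b, (1 <= t)%N ->
        {ae PX, forall x, c * t%:R `^ (- alpha) <= pol D t w b x}}].

Definition negligible_clipping : Prop :=
  cvg_in_probability0 P (fun n w =>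
    avg2 n (fun t => (sigma0 n t w <= 2 * eps n)%R%:R)).

Definition moment_rates (nu : R) : Prop :=
  let rate n := n%:R `^ (- nu) in
  [/\ bigO_as P (fun n w =>
        (avg2 n (fun t => `|Mhat1 n t w - oracle_moment 1 n t w|))%:E) rate,
      bigO_as P (fun n w =>
        (avg2 n (fun t => `|Mhat2 n t w - oracle_moment 2 n t w|))%:E) rate &
      bigO_as P (fun n w =>
        (avg2 n (fun t => `|sigmahat2 n t w - sigma0 n t w ^+ 2|))%:E) rate].

End Statistics.
End Adaptive.

Arguments experiment {R dO dX dA dY} Om X A Y H.
Arguments discrete_actions {dA} A.

(* Main.v *)
From HB Require Import structures.
Require Import Defs.
From mathcomp Require Import all_boot all_order all_algebra.
From mathcomp Require Import all_classical all_reals all_analysis.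
From mathcomp Require Import measurable_realfun.
From mathcomp Require Import ring lra.

Set Implicit Arguments.
Unset Strict Implicit.
Unset Printing Implicit Defensive.

Import Order.TTheory GRing.Theory Num.Theory.
Import numFieldNormedType.Exports.

Local Open Scope classical_set_scope.
Local Open Scope ring_scope.

(** The pilot direction is known at the end of the first half, so in the second half
    the inverse-propensity scores, tested against it, have conditional mean
    [<w_n, eta a - eta a'> = 0]: the statistic is a sum of martingale differences
    weighted by the predictable factors [1 / (sqrt n * sigmatilde)].  By the
    exploration floor and the clip, each weighted difference is of order
    [n ^ (alpha + rho - 1/2)], which tends to 0.  The accumulated conditional variance
    is the average of [sigma0^2 / sigmatilde^2]; its distance to 1 is at most
    [eps_n^-2] times the averaged variance estimation error, which vanishes because
    [2 * rho < nu], plus 4 times the proportion of clipped rounds.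

    The martingale central limit theorem used here follows Lindeberg: with [S_k] the
    partial sums and [V_k] the accumulated conditional variances, the probability that
    [S_k + N(0, c - V_k) <= K] is almost constant in expectation along [k], because the
    Gaussian smoothing solves the backward heat equation; at the end the smoothing
    variance [c - V_n] is close to [c - 1], which is taken small. *)

(** The smoothing variance [c - V_k] is usable only while it stays away from 0, whereas [V_k] is
    controlled only in probability. The martingale is therefore thinned so that its accumulated
    variance is surely bounded, and the thinned process is compared with the original one on the
    event where nothing is skipped. The propensities are known, so the nuisance estimates cancel
    exactly from the conditional means: centring holds at every sample size, and the quality of the
    nuisance is felt through the rate for [sigmahat2]. Conditional expectations are chosen versions
    and most bounds hold almost surely. Hence martingale differences are described by identities
    against bounded predictable test functions, and variables are truncated at levels which they
    exceed with probability 0. The vector [eta] is specified only through inner products; simple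
    approximations of [phi] connect it with the scalar laws of the outcomes. *)

Section MeasurableArith.
Context {R : realType} d (T : measurableType d).
Implicit Types f : T -> R.

(** Real powers are measurable, so the reciprocal is the power [-1] on nonnegative values and is
    extended by oddness; at 0 both sides are 0. *)
Lemma measurable_funV f : measurable_fun setT f -> measurable_fun setT (fun x => (f x)^-1).
Proof.
move=> mf.
have -> : (fun x => (f x)^-1) =
    (fun x => if 0 <= f x then f x `^ (-1) else - ((- f x) `^ (-1))).
  apply/funext => x; case: leP => [f0|/ltW f0]; first by rewrite powR_inv1.
  by rewrite powR_inv1 ?oppr_ge0// invrN opprK.
apply: measurable_fun_ifT; first exact: measurable_fun_ler.
- exact: measurableT_comp (measurable_powR _) mf.
- apply: measurableT_comp => //; apply: measurableT_comp (measurable_powR _) _.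
  exact: measurableT_comp.
Qed.

Lemma measurable_funsqrt f : measurable_fun setT f ->
  measurable_fun setT (fun x => Num.sqrt (f x)).
Proof.
by move=> mf; apply: measurableT_comp mf; apply: continuous_measurable_fun; exact: sqrt_continuous.
Qed.

End MeasurableArith.

(** * Gaussian smoothing of half-line indicators *)

Section NormalCdf.
Context {R : realType}.
Implicit Types (a b c x y z t : R).

Notation gpdf := (normal_pdf (0 : R) 1).

Lemma gpdfE x : gpdf x = normal_peak 1 * expR (- (x ^+ 2 / 2)).
Proof. by rewrite normal_pdfE ?oner_eq0 // /normal_fun subr0 expr1n mulNr. Qed.

(** The endpoints are unordered because martingale increments have either sign. *)
Lemma MVT_between (f df : R -> R) a b :
  (forall x, Num.min a b <= x <= Num.max a b -> is_derive x 1 f (df x)) ->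
  exists2 c, Num.min a b <= c <= Num.max a b & f b - f a = df c * (b - a).
Proof.
move=> fdf.
wlog ab : a b fdf / a <= b => [H|].
  have /orP[ab|ba] := le_total a b; first exact: H.
  have [|c cab fE] := H b a _ ba; first by move=> x xab; apply: fdf; rewrite minC maxC.
  by exists c; [rewrite minC maxC|rewrite -opprB fE -mulrN opprB].
have [||c cab fE] := @MVT_segment R f df a b ab.
- move=> x; rewrite in_itv/= => /andP[ax xb].
  by apply: fdf; rewrite (min_idPl ab) (max_idPr ab) !ltW.
- apply: derivable_within_continuous => x; rewrite in_itv/= => xab.
  by apply: ex_derive; apply: fdf; rewrite (min_idPl ab) (max_idPr ab).
- by exists c => //; move: cab; rewrite in_itv/= (min_idPl ab) (max_idPr ab).
Qed.

Lemma ler_dist_between a b c :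
  Num.min a b <= c <= Num.max a b -> `|c - a| <= `|b - a|.
Proof.
have [ab|/ltW ab] := leP a b => /andP[h1 h2].
  by rewrite !ger0_norm ?subr_ge0// lerB.
by rewrite distrC [leRHS]distrC !ger0_norm ?subr_ge0// lerB.
Qed.

Lemma between_sub a b c x :
  Num.min a b <= c <= Num.max a b -> Num.min a c <= x <= Num.max a c ->
  Num.min a b <= x <= Num.max a b.
Proof. by rewrite !ge_min !le_max; lra. Qed.

(** Two uses of the mean value theorem give [C] instead of [C / 2]; only the order of the remainder
    matters. Derivatives are required between the endpoints only, because in the time variable they
    are available at positive times. *)
Lemma taylor2_le (f df ddf : R -> R) (C a b : R) :
  (forall x, Num.min a b <= x <= Num.max a b -> is_derive x 1 f (df x)) ->
  (forall x, Num.min a b <= x <= Num.max a b -> is_derive x 1 df (ddf x)) ->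
  (forall x, Num.min a b <= x <= Num.max a b -> `|ddf x| <= C) ->
  `|f b - f a - df a * (b - a)| <= C * `|b - a| ^+ 2.
Proof.
move=> fdf dfddf C_ub.
have [c cab ->] := MVT_between fdf.
rewrite -mulrBl normrM expr2 mulrA ler_wpM2r//.
have [|c' c'ac ->] := @MVT_between df ddf a c.
  by move=> x xac; apply: dfddf; exact: between_sub xac.
rewrite normrM ler_pM//; first by apply: C_ub; exact: between_sub c'ac.
exact: ler_dist_between.
Qed.

(** The second-order remainder [r] has as derivative the first-order remainder of [df], which
    [taylor2_le] controls. *)
Lemma taylor3_le (f df ddf dddf : R -> R) (C a b : R) :
  (forall x, is_derive x 1 f (df x)) -> (forall x, is_derive x 1 df (ddf x)) ->
  (forall x, is_derive x 1 ddf (dddf x)) -> (forall x, `|dddf x| <= C) ->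
  `|f b - f a - df a * (b - a) - ddf a / 2 * (b - a) ^+ 2| <= C * `|b - a| ^+ 3.
Proof.
move=> fdf dfddf ddfdddf C_ub.
pose r x := f x - df a * (x - a) - ddf a / 2 * (x - a) ^+ 2.
pose dr x := df x - df a - ddf a * (x - a).
have rE x : is_derive x 1 r (dr x).
  rewrite /r; apply: is_derive_eq; rewrite /dr /GRing.scale/=; lra.
have [c cab] := @MVT_between r dr a b (fun x _ => rE x).
rewrite /r !subrr expr0n/= !mulr0 !subr0 => H.
have -> : f b - f a - df a * (b - a) - ddf a / 2 * (b - a) ^+ 2 = dr c * (b - a).
  by rewrite -H; lra.
rewrite normrM exprSr mulrA ler_wpM2r//.
apply: le_trans (@taylor2_le df ddf dddf C a c _ _ _) _ => //.
rewrite ler_wpM2l ?(le_trans _ (C_ub 0))//.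
rewrite ler_sqr ?nnegrE//.
exact: ler_dist_between.
Qed.

Lemma gpdf_ge0 x : 0 <= gpdf x. Proof. exact: normal_pdf_ge0. Qed.

(** From [1 + u <= expR u] with [u = x ^+ 2 / 2] for the first two bounds. For the fourth power,
    [expR (x ^+ 2 / 2)] is the square of [expR (x ^+ 2 / 4)], hence dominates [x ^+ 4 / 16]. *)
Lemma gpdf_moment x : [/\ gpdf x <= normal_peak 1, x ^+ 2 * gpdf x <= 2 * normal_peak 1 &
  x ^+ 4 * gpdf x <= 16 * normal_peak 1].
Proof.
have p0 := normal_peak_ge0 (1 : R).
rewrite gpdfE expRN.
have h2 := expR_ge1Dx (x ^+ 2 / 2).
have h4 := expR_ge1Dx (x ^+ 2 / 4).
have e2 : expR (x ^+ 2 / 2) = expR (x ^+ 2 / 4) ^+ 2.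
  by rewrite (expr2 (expR _)) -expRD; congr expR; lra.
have e0 := expR_gt0 (x ^+ 2 / 2).
split; rewrite ?mulrA ler_pdivrMr//.
- by rewrite ler_peMr//; have := sqr_ge0 x; lra.
- by rewrite [leRHS]mulrAC ler_wpM2r//; lra.
- rewrite [leRHS]mulrAC ler_wpM2r// e2.
  have : (x ^+ 2 / 4) ^+ 2 <= expR (x ^+ 2 / 4) ^+ 2.
    by rewrite ler_sqr ?nnegrE ?expR_ge0 ?divr_ge0 ?sqr_ge0//; lra.
  have -> : (x ^+ 2 / 4) ^+ 2 = x ^+ 4 / 16 by field.
  lra.
Qed.

Lemma is_derive_gpdf x : is_derive x 1 gpdf (- x * gpdf x).
Proof.
have -> : gpdf = (fun y => normal_peak 1 * expR (- (y ^+ 2 / 2))).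
  by apply/funext => y; rewrite gpdfE.
apply: is_derive_eq.
rewrite /GRing.scale/=; lra.
Qed.

Lemma is_derive_xgpdf x :
  is_derive x 1 (fun y => - y * gpdf y) ((x ^+ 2 - 1) * gpdf x).
Proof.
have := is_derive_gpdf x => H.
apply: is_derive_eq; rewrite /GRing.scale/=; lra.
Qed.

Definition gcdf x : R := \int[lebesgue_measure]_(t in `]-oo, x]) gpdf t.

Lemma normal_prob_ray x : normal_prob 0 1 `]-oo, x] = (gcdf x)%:E.
Proof. by rewrite /gcdf /Rintegral fineK// -/(normal_prob 0 1 _) fin_num_measure. Qed.

Lemma is_derive_gcdf x : is_derive x 1 gcdf (gpdf x).
Proof.
have [||//||dF F'] := @continuous_FTC1 R gpdf -oo%O x (x + 1).
- by rewrite ltrDl.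
- by apply: integrableS (integrable_normal_pdf 0 1).
- by rewrite ltNyr.
- by apply: continuous_normal_pdf; rewrite oner_eq0.
- by split; [exact: dF|rewrite -derive1E; exact: F'].
Qed.

Lemma gcdf_ge0 x : 0 <= gcdf x.
Proof. by rewrite -lee_fin -normal_prob_ray. Qed.

Lemma gcdf_le1 x : gcdf x <= 1.
Proof. by rewrite -lee_fin -normal_prob_ray probability_le1. Qed.

Lemma gcdf_nondecreasing : {homo gcdf : x y / x <= y}.
Proof.
move=> x y xy; rewrite -lee_fin -!normal_prob_ray le_measure ?inE//.
exact: subitvP.
Qed.

Lemma gcdf_continuous : continuous gcdf.
Proof.
move=> x; apply: differentiable_continuous.
by apply/derivable1_diffP; have := is_derive_gcdf x => H; exact: ex_derive.
Qed.

(** The identity, as a random variable under the normal law, has [gcdf] as its distribution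
    function; the limits at infinity then come from the general theory of [cdf]. *)
Let real_id : measurableTypeR R -> R := idfun.

#[local] HB.instance Definition _ :=
  @isMeasurableFun.Build _ _ _ _ real_id (@measurable_id _ _ setT).

Let gcdf_cdf : gcdf = fine \o cdf (real_id : {RV (normal_prob 0 1) >-> R}).
Proof. by apply/funext => x /=; rewrite preimage_id normal_prob_ray. Qed.

Lemma gcdf_cvgy : gcdf x @[x --> +oo] --> (1 : R).
Proof. by rewrite gcdf_cdf; apply: fine_cvg; exact: cvg_cdfy1. Qed.

Lemma gcdf_cvgNy : gcdf x @[x --> -oo] --> (0 : R).
Proof. by rewrite gcdf_cdf; apply: fine_cvg; exact: cvg_cdfNy0. Qed.

(** The inverse standard deviation, written as a real power so that it can be differentiated in [t];
    [isq_sqrt] returns to square roots. *)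
Let isq t := t `^ (- 2^-1).

Let isq_sq t : 0 < t -> isq t ^+ 2 = t^-1.
Proof. by move=> t0; rewrite /isq -powR_mulrn ?powR_ge0// -powRrM mulNr mulVf// powR_inv1// ltW. Qed.

Let isq_gt0 t : 0 < t -> 0 < isq t. Proof. exact: powR_gt0. Qed.

Let is_derive_isq t : 0 < t -> is_derive t 1 isq (- (isq t / (2 * t))).
Proof.
move=> t0; have H := is_derive1_powR (- 2^-1) t0.
apply: is_derive_eq; rewrite /isq powRD ?(gt_eqF t0) ?implybT// (powRN _ 1) powRr1 ?ltW//.
by field; rewrite gt_eqF.
Qed.

(* [smooth_ind t (K - s)] is the probability that [s + N(0, t) <= K]. *)
Definition smooth_ind t y := gcdf (y * isq t).
(** First and second derivatives at [z = 0] of [smooth_ind t (y - z)]: the minus sign of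
    [dsmooth_ind] comes from the shift, that of [ddsmooth_ind] from the derivative of the Gaussian
    density. *)
Definition dsmooth_ind t y := - (isq t * gpdf (y * isq t)).
Definition ddsmooth_ind t y := - (y * isq t * gpdf (y * isq t) / t).

(** The time derivative equals [ddsmooth_ind t y / 2], which is the heat equation. *)
Let is_derive_smooth_ind t y : 0 < t ->
  is_derive t 1 (fun s => smooth_ind s y) (- (y * isq t * gpdf (y * isq t)) / (2 * t)).
Proof.
move=> t0.
have H1 := is_derive_isq t0.
have H2 : is_derive t 1 (fun s => y * isq s) (- (y * isq t) / (2 * t)).
  by apply: is_derive_eq; rewrite /GRing.scale/=; field; rewrite gt_eqF.
have := @is_derive1_comp R gcdf (fun s => y * isq s) t _ _ (is_derive_gcdf _) H2.
move/is_derive_eq; apply.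
by rewrite /=; field; rewrite gt_eqF.
Qed.

Let ddt_smooth_ind t y := ((3 * (y * isq t) - (y * isq t) ^+ 3) * gpdf (y * isq t)) / (4 * t ^+ 2).

Let is_derive_dt_smooth_ind t y : 0 < t ->
  is_derive t 1 (fun s => - (y * isq s * gpdf (y * isq s)) / (2 * s)) (ddt_smooth_ind t y).
Proof.
move=> t0.
have H1 := is_derive_isq t0.
have H2 : is_derive t 1 (fun s => y * isq s) (- (y * isq t) / (2 * t)).
  by apply: is_derive_eq; rewrite /GRing.scale/=; field; rewrite gt_eqF.
have H3 : is_derive t 1 (fun s => - (y * isq s) * gpdf (y * isq s))
   (((y * isq t) ^+ 2 - 1) * gpdf (y * isq t) * (- (y * isq t) / (2 * t))).
  exact: (@is_derive1_comp R _ (fun s => y * isq s) t _ _ (is_derive_xgpdf _) H2).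
have H4 : is_derive t 1 (fun s => (2 * s)^-1) (- (2 * t ^+ 2)^-1).
  have H5 : is_derive t 1 (fun s : R => 2 * s) 2.
    by apply: is_derive_eq; rewrite /GRing.scale/= ?mulr1 ?mulr0 ?addr0.
  have := @is_deriveV R (fun s : R => 2 * s) t 2 1.
  rewrite mulf_neq0 ?gt_eqF// => /(_ isT H5) H6.
  apply: is_derive_eq; rewrite /GRing.scale/= -exprVn invfM; field; rewrite gt_eqF//.
have -> : (fun s => - (y * isq s * gpdf (y * isq s)) / (2 * s)) =
    (fun s => - (y * isq s) * gpdf (y * isq s)) * (fun s => (2 * s)^-1).
  by apply/funext => s; rewrite -[in LHS]mulNr.
apply: is_derive_eq; rewrite /GRing.scale/= /ddt_smooth_ind.
by field; rewrite gt_eqF.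
Qed.

Let poly_bound x : [/\ `|x| <= 1 + x ^+ 2 & `|x ^+ 3| <= 1 + x ^+ 4].
Proof.
have h1 : `|x| <= 1 + x ^+ 2.
  rewrite -real_normK ?num_real//; have := sqr_ge0 (`|x| - 1); have := normr_ge0 x; nra.
split=> //; rewrite normrX.
have -> : x ^+ 4 = `|x| ^+ 4 by rewrite -normrX ger0_norm// exprn_even_ge0.
have n0 := normr_ge0 x.
have [l|l] := leP `|x| 1.
  apply: (@le_trans _ _ 1); last by rewrite lerDl exprn_ge0.
  by rewrite exprn_ile1.
have : `|x| ^+ 3 <= `|x| ^+ 4 by rewrite ler_weXn2l// ltW.
lra.
Qed.

(** Odd powers are dominated by 1 plus the next even power, which reduces everything to
    [gpdf_moment]. The constant 26 is 3 + 6 + 1 + 16, from [3 * (1 + x ^+ 2) + (1 + x ^+ 4)]. *)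
Let gpdf_poly x : [/\ `|(x ^+ 2 - 1) * gpdf x| <= 3 * normal_peak 1,
  `|x * gpdf x| <= 3 * normal_peak 1 &
  `|(3 * x - x ^+ 3) * gpdf x| <= 26 * normal_peak 1].
Proof.
have [b0 b2 b4] := gpdf_moment x; have g0 := gpdf_ge0 x.
have p0 := normal_peak_ge0 (1 : R).
have [p1 p3] := poly_bound x.
split; rewrite normrM (ger0_norm g0).
- have : `|x ^+ 2 - 1| <= x ^+ 2 + 1.
    by have := sqr_ge0 x; rewrite ler_norml; lra.
  by move=> /(ler_wpM2r g0); lra.
- by move: p1 => /(ler_wpM2r g0); lra.
- have : `|3 * x - x ^+ 3| <= 3 * (1 + x ^+ 2) + (1 + x ^+ 4).
    apply: (le_trans (ler_normB _ _)).
    by rewrite normrM (ger0_norm (ler0n _ 3)) lerD// ler_pM2l.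
  by move=> /(ler_wpM2r g0); lra.
Qed.

(* [smooth_ind] solves the backward heat equation, so that the variance increment
   [v] cancels the mean of [z ^+ 2]. *)
Lemma smooth_ind_expand (e : R) : 0 < e -> exists2 C : R, 0 <= C &
  forall t y z v : R, e <= t -> 0 <= v ->
  [/\ `|smooth_ind t (y - z) - smooth_ind (t + v) y -
       (z * dsmooth_ind t y + (z ^+ 2 - v) / 2 * ddsmooth_ind t y)| <=
      C * (`|z| ^+ 3 + v ^+ 2),
      `|dsmooth_ind t y| <= C & `|ddsmooth_ind t y| <= C].
Proof.
move=> e0; pose p : R := normal_peak (1 : R).
have p0 : 0 <= p by exact: normal_peak_ge0.
pose s := isq e; have s0 : 0 < s by exact: isq_gt0.
(* One summand for each of the four estimates: the third-order remainder in space, the second-order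
   remainder in time, and the bounds on [dsmooth_ind] and [ddsmooth_ind]. *)
pose C : R := 3 * p * s ^+ 3 + 26 * p / (4 * e ^+ 2) + s * p + 3 * p / e.
have C1 : 0 <= 3 * p * s ^+ 3 by rewrite !mulr_ge0 ?exprn_ge0 ?(ltW s0).
have C2 : 0 <= 26 * p / (4 * e ^+ 2).
  by rewrite divr_ge0 ?mulr_ge0 ?exprn_ge0 ?(ltW e0).
have C3 : 0 <= s * p by rewrite mulr_ge0 ?(ltW s0).
have C4 : 0 <= 3 * p / e by rewrite divr_ge0 ?mulr_ge0 ?(ltW e0).
exists C; first by rewrite /C; lra.
move=> t y z v et v0; have t0 := lt_le_trans e0 et.
have st : isq t <= s.
  by rewrite /isq/s/isq !powRN lef_pV2 ?posrE ?powR_gt0// ge0_ler_powR ?nnegrE// ltW.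
have it0 := isq_gt0 t0.
split.
(* Expansion in space at the fixed time [t]; [T2] then expands in time at the fixed point [y], and
   the two are subtracted. *)
- have T3 : `|smooth_ind t (y - z) - smooth_ind t y -
      (z * dsmooth_ind t y + z ^+ 2 / 2 * ddsmooth_ind t y)| <= 3 * p * s ^+ 3 * `|z| ^+ 3.
    have := @taylor3_le gcdf gpdf (fun y => - y * gpdf y) (fun x => (x ^+ 2 - 1) * gpdf x)
      (3 * p) (y * isq t) ((y - z) * isq t) is_derive_gcdf is_derive_gpdf is_derive_xgpdf.
    have H x : `|(x ^+ 2 - 1) * gpdf x| <= 3 * p by case: (gpdf_poly x).
    move=> /(_ H).
    have -> : (y - z) * isq t - y * isq t = - (z * isq t) by ring.
    rewrite normrN normrM (gtr0_norm it0) => T.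
    rewrite /smooth_ind; apply: le_trans (le_trans T _); last first.
      rewrite exprMn mulrCA [leRHS]mulrC ler_wpM2l ?exprn_ge0// ler_wpM2l ?mulr_ge0//.
      by rewrite ler_pXn2r// nnegrE ltW.
    rewrite le_eqVlt; apply/orP; left; apply/eqP; congr (`| _ |).
    rewrite /dsmooth_ind /ddsmooth_ind -(isq_sq t0); by field.
  have T2 : `|smooth_ind (t + v) y - smooth_ind t y + v / 2 * ddsmooth_ind t y * -1| <=
      26 * p / (4 * e ^+ 2) * v ^+ 2.
    have tb x : Num.min t (t + v) <= x <= Num.max t (t + v) -> e <= x.
      have tv : t <= t + v by rewrite lerDl.
      by rewrite (min_idPl tv) => /andP[+ _]; exact: le_trans.
    have a1 x : Num.min t (t + v) <= x <= Num.max t (t + v) ->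
      is_derive x 1 (fun s => smooth_ind s y) (- (y * isq x * gpdf (y * isq x)) / (2 * x)).
      by move=> /tb ex; apply: is_derive_smooth_ind; exact: lt_le_trans ex.
    have a2 x : Num.min t (t + v) <= x <= Num.max t (t + v) ->
      is_derive x 1 (fun s => - (y * isq s * gpdf (y * isq s)) / (2 * s)) (ddt_smooth_ind x y).
      by move=> /tb ex; apply: is_derive_dt_smooth_ind; exact: lt_le_trans ex.
    have a3 x : Num.min t (t + v) <= x <= Num.max t (t + v) ->
       `|ddt_smooth_ind x y| <= 26 * p / (4 * e ^+ 2).
      move=> /tb ex; have x0 := lt_le_trans e0 ex.
      rewrite /ddt_smooth_ind normrM normfV.
      have [_ _ b] := gpdf_poly (y * isq x).
      rewrite ler_pM// ger0_norm ?mulr_ge0 ?exprn_ge0 ?(ltW x0)//.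
      rewrite lef_pV2 ?posrE ?mulr_gt0 ?exprn_gt0// ler_pM2l// ler_pXn2r ?nnegrE ?(ltW e0) ?(ltW x0)//.
    have := @taylor2_le (fun s => smooth_ind s y)
       (fun s => - (y * isq s * gpdf (y * isq s)) / (2 * s)) (fun t => ddt_smooth_ind t y)
       (26 * p / (4 * e ^+ 2)) t (t + v) a1 a2 a3.
    have -> : t + v - t = v by ring.
    rewrite (ger0_norm v0).
    apply: le_trans; rewrite le_eqVlt; apply/orP; left; apply/eqP; congr (`| _ |).
    rewrite /ddsmooth_ind; move: (y * isq t * _) (smooth_ind (t + v) y) (smooth_ind t y).
    by move=> q A B; field; rewrite gt_eqF.
  set A := smooth_ind t (y - z); set B := smooth_ind t y; set B' := smooth_ind (t + v) y.
  set d := dsmooth_ind t y; set dd := ddsmooth_ind t y.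
  have -> : A - B' - (z * d + (z ^+ 2 - v) / 2 * dd) =
    (A - B - (z * d + z ^+ 2 / 2 * dd)) - (B' - B + v / 2 * dd * -1) by field.
  apply: (le_trans (ler_normB _ _)); apply: (le_trans (lerD T3 T2)).
  rewrite mulrDr; apply: lerD; apply: ler_wpM2r; rewrite ?exprn_ge0//; rewrite /C; lra.
- rewrite normrN normrM (gtr0_norm it0) (ger0_norm (gpdf_ge0 _)).
  have [b _ _] := gpdf_moment (y * isq t).
  by apply: (@le_trans _ _ (s * p)); [rewrite ler_pM ?gpdf_ge0// ltW|rewrite /C; lra].
- rewrite normrN normrM normfV (gtr0_norm t0).
  have [_ b _] := gpdf_poly (y * isq t).
  apply: (@le_trans _ _ (3 * p / e)); last by rewrite /C; lra.
  by rewrite ler_pM ?invr_ge0 ?(ltW t0)// lef_pV2 ?posrE.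
Qed.

Lemma smooth_ind_ge0 t y : 0 <= smooth_ind t y. Proof. exact: gcdf_ge0. Qed.

Lemma smooth_ind_le1 t y : smooth_ind t y <= 1. Proof. exact: gcdf_le1. Qed.

Let isq_sqrt t : 0 < t -> isq t = (Num.sqrt t)^-1.
Proof. by move=> t0; rewrite /isq powRN powR12_sqrt// ltW. Qed.

(** More than [M] standard deviations above the threshold, the smoothed indicator is almost 1; below
    it, by [smooth_ind_le], it is almost 0. Only an upper bound [t1] on the variance is used, since
    the variance will be random. *)
Lemma smooth_ind_ge (t t1 M y : R) : 0 < t -> t <= t1 -> 0 <= M ->
  M * Num.sqrt t1 <= y -> gcdf M <= smooth_ind t y.
Proof.
move=> t0 tt1 M0 y0; apply: gcdf_nondecreasing.
rewrite isq_sqrt// ler_pdivlMr ?sqrtr_gt0//; apply: le_trans y0.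
by rewrite ler_wpM2l// ler_wsqrtr.
Qed.

Lemma smooth_ind_le (t t1 M y : R) : 0 < t -> t <= t1 -> 0 <= M ->
  y <= - (M * Num.sqrt t1) -> smooth_ind t y <= gcdf (- M).
Proof.
move=> t0 tt1 M0 y0; apply: gcdf_nondecreasing.
rewrite isq_sqrt// ler_pdivrMr ?sqrtr_gt0//; apply: le_trans y0 _.
by rewrite mulNr lerN2 ler_wpM2l// ler_wsqrtr.
Qed.

Lemma measurable_gpdf : measurable_fun setT gpdf.
Proof. exact: measurable_normal_pdf. Qed.

Lemma measurable_gcdf : measurable_fun setT gcdf.
Proof. exact: continuous_measurable_fun gcdf_continuous. Qed.

Section Measurability.
Context d (T : measurableType d) (f g : T -> R).
Hypotheses (mf : measurable_fun setT f) (mg : measurable_fun setT g).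

Let misq : measurable_fun setT (isq \o f).
Proof. by apply: measurableT_comp mf; exact: measurable_powR. Qed.

Let mgisq : measurable_fun setT (fun w => g w * isq (f w)).
Proof. exact: measurable_funM. Qed.

Lemma measurable_smooth_ind : measurable_fun setT (fun w => smooth_ind (f w) (g w)).
Proof. exact: measurableT_comp measurable_gcdf mgisq. Qed.

Lemma measurable_dsmooth_ind : measurable_fun setT (fun w => dsmooth_ind (f w) (g w)).
Proof.
apply: measurableT_comp => //; apply: measurable_funM => //.
exact: measurableT_comp measurable_gpdf mgisq.
Qed.

Lemma measurable_ddsmooth_ind : measurable_fun setT (fun w => ddsmooth_ind (f w) (g w)).
Proof.
apply: measurableT_comp => //; apply: measurable_funM; last first.
  exact: measurable_funV.
apply: measurable_funM => //.
exact: measurableT_comp measurable_gpdf mgisq.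
Qed.

End Measurability.

End NormalCdf.

(** * Martingale central limit theorem *)

Section BoundedExpectation.
Context {R : realType} {d} {Om : measurableType d} (P : probability Om R).
Implicit Types (f g : Om -> R) (M : R).

(** Boundedness everywhere, not almost everywhere: the class is closed under ring operations and
    linearity of the integral needs no further integrability argument. *)
Definition bounded_rv f := measurable_fun setT f /\ exists M, forall w, `|f w| <= M.

Lemma bounded_rv_integrable f : bounded_rv f -> P.-integrable setT (EFin \o f).
Proof.
move=> [mf [M fM]]; apply: measurable_bounded_integrable => //.
  by rewrite (le_lt_trans (probability_le1 P measurableT))// ltry.
exists M; split; first exact: num_real.
by move=> x Mx w _; apply: le_trans (ltW Mx).
Qed.

Lemma bounded_rvD f g : bounded_rv f -> bounded_rv g -> bounded_rv (fun w => f w + g w).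
Proof.
move=> [mf [M fM]] [mg [N gN]]; split; first exact: measurable_funD.
by exists (M + N) => w; apply: le_trans (ler_normD _ _) _; exact: lerD.
Qed.

Lemma bounded_rvM f g : bounded_rv f -> bounded_rv g -> bounded_rv (fun w => f w * g w).
Proof.
move=> [mf [M fM]] [mg [N gN]]; split; first exact: measurable_funM.
by exists (M * N) => w; rewrite normrM ler_pM.
Qed.

Lemma bounded_rv_cst c : bounded_rv (fun=> c).
Proof. by split=> //; exists `|c|. Qed.

Lemma bounded_rvN f : bounded_rv f -> bounded_rv (fun w => - f w).
Proof.
by move=> [mf [M fM]]; split; [exact: measurableT_comp|exists M => w; rewrite normrN].
Qed.

Lemma bounded_rvB f g : bounded_rv f -> bounded_rv g -> bounded_rv (fun w => f w - g w).
Proof. by move=> bf bg; apply: bounded_rvD => //; exact: bounded_rvN. Qed.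

Lemma bounded_rvX f n : bounded_rv f -> bounded_rv (fun w => f w ^+ n).
Proof.
move=> bf; elim: n => [|n IH].
  by under eq_fun do rewrite expr0; exact: bounded_rv_cst.
by under eq_fun do rewrite exprS; exact: bounded_rvM.
Qed.

Lemma bounded_rv_indic (A : set Om) : measurable A -> bounded_rv \1_A.
Proof.
move=> mA; split; first exact: measurable_indic.
by exists 1 => w; rewrite ger0_norm indicE ?ler0n// lern1 leq_b1.
Qed.

Lemma expectation_indic (A : set Om) : measurable A ->
  \int[P]_w (\1_A w) = fine (P A).
Proof. by move=> mA; rewrite /Rintegral integral_indic// setIT. Qed.

Lemma expectation_cst c : \int[P]_w c = c.
Proof. by rewrite Rintegral_cst// -[RHS]mulr1; congr (_ * _); rewrite [X in fine X]probability_setT. Qed.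

Lemma expectationD f g : bounded_rv f -> bounded_rv g ->
  \int[P]_w (f w + g w) = \int[P]_w f w + \int[P]_w g w.
Proof. by move=> bf bg; rewrite RintegralD//; exact: bounded_rv_integrable. Qed.

Lemma expectationB f g : bounded_rv f -> bounded_rv g ->
  \int[P]_w (f w - g w) = \int[P]_w f w - \int[P]_w g w.
Proof. by move=> bf bg; rewrite RintegralB//; exact: bounded_rv_integrable. Qed.

Lemma expectationZl c f : bounded_rv f -> \int[P]_w (c * f w) = c * \int[P]_w f w.
Proof. by move=> bf; rewrite RintegralZl//; exact: bounded_rv_integrable. Qed.

Lemma expectation_le f g : bounded_rv f -> bounded_rv g -> (forall w, f w <= g w) ->
  \int[P]_w f w <= \int[P]_w g w.
Proof. by move=> bf bg fg; apply: le_Rintegral => //; exact: bounded_rv_integrable. Qed.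

Lemma expectation_abs_le f g : bounded_rv f -> bounded_rv g -> (forall w, `|f w| <= g w) ->
  `|\int[P]_w f w| <= \int[P]_w g w.
Proof.
move=> bf bg fg; rewrite ler_norml -mulN1r -expectationZl// !expectation_le//.
- by move=> w; have := fg w; rewrite ler_norml => /andP[].
- by apply: bounded_rvM => //; exact: bounded_rv_cst.
- by move=> w; have := fg w; rewrite ler_norml mulN1r => /andP[].
Qed.

End BoundedExpectation.

Section MartingaleStep.
Context {R : realType} {d} {Om : measurableType d} (P : probability Om R).

Definition adapted (G : set (set Om)) (f : Om -> R) :=
  measurable_fun [set: g_sigma_algebraType G] (f : g_sigma_algebraType G -> R).

Definition sub_sigma (G : set (set Om)) := forall A, <<s G >> A -> measurable A.

Lemma adapted_measurable G f : sub_sigma G -> adapted G f -> measurable_fun setT f.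
Proof.
move=> sG mf _ B mB; rewrite setTI; apply: sG.
by have := mf measurableT B mB; rewrite setTI.
Qed.

Lemma adapted_mono G G' f : <<s G >> `<=` <<s G' >> -> adapted G f -> adapted G' f.
Proof. by move=> GG' mf _ B mB; apply: GG'; exact: mf. Qed.

(* [v] is a predictable version of the conditional second moment of the
   martingale difference [Z] given [G]. *)
Record mart_diff (G G' : set (set Om)) (delta : R) (Z v : Om -> R) : Prop := MartDiff {
  mart_diff_sub : sub_sigma G' ;
  mart_diff_mono : <<s G >> `<=` <<s G' >> ;
  mart_diff_Z : adapted G' Z ;
  mart_diff_v : adapted G v ;
  mart_diff_Zle : forall w, `|Z w| <= delta ;
  mart_diff_vle : forall w, 0 <= v w <= delta ^+ 2 ;
  mart_diff_mean : forall h, adapted G h -> (exists M : R, forall w, `|h w| <= M) ->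
    \int[P]_w (h w * Z w) = 0 ;
  mart_diff_var : forall h, adapted G h -> (exists M : R, forall w, `|h w| <= M) ->
    \int[P]_w (h w * Z w ^+ 2) = \int[P]_w (h w * v w)
}.

(** A predictable factor can be absorbed into the test function [h]. Being 0 or 1, it equals its
    square, so [chi * v] is again the conditional second moment. *)
Lemma mart_diff_thin G G' delta Z v (chi : Om -> R) : mart_diff G G' delta Z v ->
  adapted G chi -> (forall w, chi w = 0 \/ chi w = 1) ->
  mart_diff G G' delta (fun w => chi w * Z w) (fun w => chi w * v w).
Proof.
move=> [sG' GG' mZ mv Zd vd EZ EZ2] mchi chi01.
have chi1 w : 0 <= chi w <= 1 by case: (chi01 w) => ->; rewrite lexx ler01.
have d0 : 0 <= delta by apply: le_trans (Zd point).
have hchi h : adapted G h -> (exists M : R, forall w, `|h w| <= M) ->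
    adapted G (fun w => h w * chi w) /\ (exists M : R, forall w, `|h w * chi w| <= M).
  move=> mh [M hM]; split; first exact: measurable_funM.
  exists M => w; rewrite normrM (ger0_norm (proj1 (andP (chi1 w)))).
  by apply: le_trans (hM w); rewrite ler_piMr//; case/andP: (chi1 w).
split=> //.
- by apply: measurable_funM => //; exact: adapted_mono mchi.
- exact: measurable_funM.
- by move=> w; case: (chi01 w) => ->; rewrite ?mul0r ?normr0// mul1r.
- by move=> w; case: (chi01 w) => ->; rewrite ?mul0r ?lexx ?exprn_ge0// mul1r.
- move=> h mh bh; have [mh' bh'] := hchi h mh bh.
  by rewrite -(EZ _ mh' bh'); under eq_Rintegral do rewrite mulrA.
- move=> h mh bh; have [mh' bh'] := hchi h mh bh.
  under [RHS]eq_Rintegral do rewrite mulrA.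
  rewrite -(EZ2 _ mh' bh'); apply: eq_Rintegral => w _.
  by case: (chi01 w) => ->; rewrite ?(mul0r, mulr0, expr0n, mul1r, mulr1).
Qed.

End MartingaleStep.

Section MartingaleCore.
Context {R : realType} {d} {Om : measurableType d} (P : probability Om R).
Variables (N : nat) (G : nat -> set (set Om)) (delta : R) (Z v : nat -> Om -> R).
Hypothesis md : forall k, (k < N)%N -> mart_diff P (G k) (G k.+1) delta (Z k) (v k).
Hypothesis G0 : sub_sigma (G 0%N).

Let S k w := \sum_(i < k) Z i w.
Let V k w := \sum_(i < k) v i w.

Let GS k : (k <= N)%N -> sub_sigma (G k).
Proof. by case: k => // k kN; case: (md kN). Qed.

Let SE k w : S k.+1 w = S k w + Z k w. Proof. by rewrite /S big_ord_recr. Qed.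
Let VE k w : V k.+1 w = V k w + v k w. Proof. by rewrite /V big_ord_recr. Qed.
Let SF k : S k.+1 = fun w => S k w + Z k w. Proof. by apply/funext => w; rewrite SE. Qed.
Let VF k : V k.+1 = fun w => V k w + v k w. Proof. by apply/funext => w; rewrite VE. Qed.

Let mS k : (k <= N)%N -> adapted (G k) (S k).
Proof.
elim: k => [_|k IH kN].
  by rewrite /S; under eq_fun do rewrite big_ord0; exact: measurable_cst.
case: (md kN) => _ GG mZ _ _ _ _ _.
rewrite SF; apply: measurable_funD => //.
by apply: adapted_mono (IH (ltnW kN)).
Qed.

(** The variance after step [k] is already known before step [k], so the smoothing time [c - V k.+1]
    may serve as a frozen coefficient during that step. *)
Let mV1 k : (k < N)%N -> adapted (G k) (V k) -> adapted (G k) (V k.+1).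
Proof.
move=> kN mV; case: (md kN) => _ _ _ mv _ _ _ _.
by rewrite VF; exact: measurable_funD.
Qed.

Let mV k : (k <= N)%N -> adapted (G k) (V k).
Proof.
elim: k => [_|k IH kN].
  by rewrite /V; under eq_fun do rewrite big_ord0; exact: measurable_cst.
case: (md kN) => _ GG _ _ _ _ _ _.
by apply: (adapted_mono GG); apply: mV1 => //; apply: IH; exact: ltnW.
Qed.

Let bZ k : (k < N)%N -> bounded_rv (Z k).
Proof.
move=> kN; case: (md kN) => sG _ mZ _ Zd _ _ _.
by split; [exact: adapted_measurable mZ|exists delta].
Qed.

Let bv k : (k < N)%N -> bounded_rv (v k).
Proof.
move=> kN; case: (md kN) => _ _ _ mv _ vd _ _; split.
  by apply: adapted_measurable mv; apply: GS; exact: ltnW.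
by exists (delta ^+ 2) => w; case/andP: (vd w) => v0 vle; rewrite ger0_norm.
Qed.

Let bV k : (k <= N)%N -> bounded_rv (V k).
Proof.
elim: k => [_|k IH kN].
  by rewrite /V; under eq_fun do rewrite big_ord0; exact: bounded_rv_cst.
by rewrite VF; apply: bounded_rvD; [exact/IH/ltnW|exact: bv].
Qed.

Variables (B e c : R).
Hypotheses (VB : forall w, V N w <= B) (Bec : B + e <= c).
Hypothesis d0 : 0 <= delta.

Let V_le k : (k <= N)%N -> forall w, V k w <= B.
Proof.
move=> kN w; apply: le_trans (VB w); rewrite /V -(subnK kN) addnC.
rewrite big_split_ord/= lerDl; apply: sumr_ge0 => i _.
have iN : (k + i < N)%N by rewrite -ltn_subRL.
by case: (md iN) => _ _ _ _ _ /(_ w)/andP[].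
Qed.

(** Each step changes the expected smoothing by at most [C * (delta + delta ^+ 2)] times the
    expected variance increment. The induction therefore carries the expectation of [V k] on the
    right, and the errors add up to at most [B] times the factor, however many steps there are. *)
Lemma smooth_ind_martingale (C K : R) : (0 <= C) ->
  (forall t y z v : R, e <= t -> 0 <= v ->
    [/\ `|smooth_ind t (y - z) - smooth_ind (t + v) y -
         (z * dsmooth_ind t y + (z ^+ 2 - v) / 2 * ddsmooth_ind t y)| <=
        C * (`|z| ^+ 3 + v ^+ 2),
        `|dsmooth_ind t y| <= C & `|ddsmooth_ind t y| <= C]) ->
  `|\int[P]_w smooth_ind (c - V N w) (K - S N w) - smooth_ind c K| <=
    C * (delta + delta ^+ 2) * B.
Proof.
move=> C0 HC; pose U k w := smooth_ind (c - V k w) (K - S k w).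
have mtk k : (k <= N)%N -> adapted (G k) (fun w => c - V k w).
  by move=> kN; apply: measurable_funB => //; exact: mV.
have myk k : (k <= N)%N -> adapted (G k) (fun w => K - S k w).
  by move=> kN; apply: measurable_funB => //; exact: mS.
have bU k : (k <= N)%N -> bounded_rv (U k).
  move=> kN; split.
    apply: (adapted_measurable (GS kN)).
    exact: measurable_smooth_ind (mtk _ kN) (myk _ kN).
  by exists 1 => w; rewrite ger0_norm ?smooth_ind_ge0 ?smooth_ind_le1.
suff H k : (k <= N)%N -> `|\int[P]_w U k w - smooth_ind c K| <=
    C * (delta + delta ^+ 2) * \int[P]_w V k w.
  apply: (le_trans (H N (leqnn _))); rewrite ler_wpM2l ?mulr_ge0 ?addr_ge0 ?exprn_ge0//.
  rewrite -[leRHS](expectation_cst P); apply: expectation_le => //; first exact: bV.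
  exact: bounded_rv_cst.
elim: k => [_|k IH kN].
  rewrite /U /V /S; under eq_Rintegral do rewrite !big_ord0 !subr0.
  under [in leRHS]eq_Rintegral do rewrite big_ord0.
  by rewrite !expectation_cst subrr normr0 mulr0.
have {}IH := IH (ltnW kN).
have [sG GG mZ mv Zd vd EZ EZ2] := md kN.
have GSk := GS (ltnW kN).
(* The expansion is centred at the later time and the earlier position: both are known in [G k], and
   the earlier time is [t + v k]. *)
pose t w := c - V k.+1 w; pose y w := K - S k w.
have mt : adapted (G k) t by apply: measurable_funB => //; exact: (mV1 kN (mV (ltnW kN))).
have my : adapted (G k) y by apply: myk; exact: ltnW.
have te w : e <= t w.
  by rewrite /t lerBrDr; apply: le_trans Bec; rewrite addrC lerD2r; exact: V_le.
pose D w := dsmooth_ind (t w) (y w); pose DD w := ddsmooth_ind (t w) (y w).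
have mD : adapted (G k) D by exact: measurable_dsmooth_ind.
have mDD : adapted (G k) DD by exact: measurable_ddsmooth_ind.
have v0 w : 0 <= v k w by case/andP: (vd w).
have DC w : `|D w| <= C by case: (HC (t w) (y w) 0 0 (te w)).
have DDC w : `|DD w| <= C by case: (HC (t w) (y w) 0 0 (te w)).
have bD : bounded_rv D by split; [exact: adapted_measurable mD|exists C].
have bDD : bounded_rv DD by split; [exact: adapted_measurable mDD|exists C].
pose r w := U k.+1 w - U k w - (Z k w * D w + (Z k w ^+ 2 - v k w) / 2 * DD w).
(* One factor of [Z] and one of [v] are bounded by [delta] and [delta ^+ 2]; what remains has the
   mean of [v k] as expectation. *)
have rle w : `|r w| <= C * (delta * Z k w ^+ 2 + delta ^+ 2 * v k w).
  have [h _ _] := HC (t w) (y w) (Z k w) (v k w) (te w) (v0 w).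
  rewrite /r /U SE; have -> : K - (S k w + Z k w) = y w - Z k w by rewrite /y; ring.
  have -> : c - V k w = t w + v k w by rewrite /t VE; ring.
  apply: (le_trans h); rewrite ler_wpM2l// lerD//.
    rewrite exprSr -normrX ger0_norm ?sqr_ge0// mulrC ler_wpM2r ?sqr_ge0//.
  by rewrite expr2 ler_wpM2r//; case/andP: (vd w).
have bZk := bZ kN; have bvk := bv kN.
have bZ2 : bounded_rv (fun w => Z k w ^+ 2) by exact: bounded_rvX.
have bUS := bU k.+1 kN; have bUk := bU k (ltnW kN).
have bZD : bounded_rv (fun w => D w * Z k w) by exact: bounded_rvM.
have bZDD : bounded_rv (fun w => DD w * Z k w ^+ 2) by exact: bounded_rvM.
have bvDD : bounded_rv (fun w => DD w * v k w) by exact: bounded_rvM.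
have bq : bounded_rv (fun w => (DD w * Z k w ^+ 2 - DD w * v k w)) by exact: bounded_rvB.
have bhq : bounded_rv (fun w => 2^-1 * (DD w * Z k w ^+ 2 - DD w * v k w)).
  by apply: bounded_rvM => //; exact: bounded_rv_cst.
have bL : bounded_rv (fun w => D w * Z k w + 2^-1 * (DD w * Z k w ^+ 2 - DD w * v k w)).
  exact: bounded_rvD.
have rE : r = (fun w => U k.+1 w - U k w -
    (D w * Z k w + 2^-1 * (DD w * Z k w ^+ 2 - DD w * v k w))).
  by apply/funext => w; rewrite /r; congr (_ - _); field.
have br : bounded_rv r by rewrite rE; apply: bounded_rvB => //; exact: bounded_rvB.
(* The linear term has mean 0, and the quadratic term cancels because [Z k ^+ 2] and [v k] have
   equal means against the predictable [DD]. *)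
have Er : \int[P]_w r w = \int[P]_w U k.+1 w - \int[P]_w U k w.
  rewrite rE expectationB//; last exact: bounded_rvB.
  rewrite expectationB// expectationD// expectationZl// expectationB//.
  have cancel (x1 x2 z x3 x4 : R) : z = 0 -> x3 = x4 -> x1 - x2 - (z + 2^-1 * (x3 - x4)) = x1 - x2.
    by move=> -> ->; rewrite subrr mulr0 addr0 subr0.
  exact: (cancel _ _ _ _ _ (EZ D mD (ex_intro _ C DC)) (EZ2 DD mDD (ex_intro _ C DDC))).
have bdZ : bounded_rv (fun w => delta * Z k w ^+ 2).
  by apply: bounded_rvM => //; exact: bounded_rv_cst.
have bdv : bounded_rv (fun w => delta ^+ 2 * v k w).
  by apply: bounded_rvM => //; exact: bounded_rv_cst.
have bdd : bounded_rv (fun w => delta * Z k w ^+ 2 + delta ^+ 2 * v k w).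
  exact: bounded_rvD.
have EZv : \int[P]_w (Z k w ^+ 2) = \int[P]_w v k w.
  have := EZ2 (fun=> 1).
  under eq_Rintegral do rewrite mul1r; under [in X in _ = X]eq_Rintegral do rewrite mul1r.
  by apply; [exact: measurable_cst|exists 1 => _; rewrite normr1].
have : `|\int[P]_w r w| <= C * (delta + delta ^+ 2) * \int[P]_w v k w.
  have bCdd : bounded_rv (fun w => C * (delta * Z k w ^+ 2 + delta ^+ 2 * v k w)).
    by apply: bounded_rvM => //; exact: bounded_rv_cst.
  apply: (le_trans (expectation_abs_le P br bCdd rle)).
  by rewrite expectationZl// expectationD// !expectationZl// EZv -mulrDl mulrA.
rewrite Er VF => h; rewrite (expectationD P (bV (ltnW kN)) bvk) mulrDr.
apply: (le_trans (ler_distD (\int[P]_w U k w) _ _)).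
by rewrite addrC; exact: lerD IH h.
Qed.

End MartingaleCore.

Section Thinning.
Context {R : realType} {d} {Om : measurableType d} (P : probability Om R).
Variables (N : nat) (G : nat -> set (set Om)) (delta : R) (Z v : nat -> Om -> R).
Hypothesis md : forall k, (k < N)%N -> mart_diff P (G k) (G k.+1) delta (Z k) (v k).
Hypothesis G0 : sub_sigma (G 0%N).
Variable B : R.
Hypotheses (B0 : 0 <= B) (d0 : 0 <= delta).

(* Accumulated variance of the process that skips every increment which would push
   it above [B]: smoothing by variance [c - V] needs a sure bound on [V]. *)
Fixpoint thinV k w : R :=
  if k is j.+1 then thinV j w + (if thinV j w + v j w <= B then 1 else 0) * v j w else 0.

Let chi k w : R := if thinV k w + v k w <= B then 1 else 0.

Let thinV_le k w : thinV k w <= B.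
Proof.
elim: k => //= k IH.
by case: ifPn => h; rewrite ?mul1r ?mul0r ?addr0.
Qed.

Let thinV_sum k w : thinV k w = \sum_(i < k) chi i w * v i w.
Proof. by elim: k => [|k IH] /=; rewrite ?big_ord0// big_ord_recr/= -IH. Qed.

Let chi01 k w : chi k w = 0 \/ chi k w = 1.
Proof. by rewrite /chi; case: ifP; [right|left]. Qed.

Let adapted_thinV k : (k <= N)%N -> adapted (G k) (thinV k).
Proof.
elim: k => [_|k IH kN]; first exact: measurable_cst.
have [_ GG _ mv _ _ _ _] := md kN; have mV := IH (ltnW kN).
apply: (adapted_mono GG); apply: measurable_funD => //; apply: measurable_funM => //.
apply: measurable_fun_ifT => //; apply: measurable_fun_ler => //.
exact: measurable_funD.
Qed.

Let adapted_chi k : (k < N)%N -> adapted (G k) (chi k).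
Proof.
move=> kN; have [_ GG _ mv _ _ _ _] := md kN.
apply: measurable_fun_ifT => //; apply: measurable_fun_ler => //.
by apply: measurable_funD => //; apply: adapted_thinV; exact: ltnW.
Qed.

(** Partial sums of the nonnegative [v] stay below the total, so a total below [B] means that no
    increment is ever skipped. *)
Let thinV_eq w : \sum_(i < N) v i w <= B -> forall k, (k <= N)%N ->
  thinV k w = \sum_(i < k) v i w.
Proof.
move=> VB; elim=> [|k IH] kN /=; first by rewrite big_ord0.
rewrite IH ?(ltnW kN)// -(big_ord_recr k (fun i => v i w))/=.
suff -> : \sum_(i < k.+1) v i w <= B by rewrite mul1r big_ord_recr.
apply: le_trans VB; rewrite -(subnK kN) addnC big_split_ord/= lerDl.
apply: sumr_ge0 => i _.
have iN : (k.+1 + i < N)%N by rewrite -ltn_subRL.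
by case: (md iN) => _ _ _ _ _ /(_ w)/andP[].
Qed.

Let chi_eq w : \sum_(i < N) v i w <= B -> forall k, (k < N)%N -> chi k w = 1.
Proof.
move=> VB k kN; rewrite /chi (thinV_eq VB (ltnW kN)) -(big_ord_recr k (fun i => v i w))/=.
by rewrite -(thinV_eq VB kN) thinV_le.
Qed.

(** The thinned sums remain anonymous: the limit theorem needs only the smoothing estimate and their
    agreement with the true sums when the total variance is at most [B]. *)
Lemma stopped_martingale_bound (e c C K : R) : B + e <= c -> 0 <= C ->
  (forall t y z v : R, e <= t -> 0 <= v ->
    [/\ `|smooth_ind t (y - z) - smooth_ind (t + v) y -
         (z * dsmooth_ind t y + (z ^+ 2 - v) / 2 * ddsmooth_ind t y)| <=
        C * (`|z| ^+ 3 + v ^+ 2),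
        `|dsmooth_ind t y| <= C & `|ddsmooth_ind t y| <= C]) ->
  exists S V : Om -> R,
    [/\ measurable_fun setT S, measurable_fun setT V, forall w, V w <= B,
        forall w, \sum_(i < N) v i w <= B ->
          S w = \sum_(i < N) Z i w /\ V w = \sum_(i < N) v i w &
        `|\int[P]_w smooth_ind (c - V w) (K - S w) - smooth_ind c K| <=
          C * (delta + delta ^+ 2) * B].
Proof.
move=> Bec C0 HC.
exists (fun w => \sum_(i < N) chi i w * Z i w), (fun w => \sum_(i < N) chi i w * v i w).
have md' k : (k < N)%N -> mart_diff P (G k) (G k.+1) delta
    (fun w => chi k w * Z k w) (fun w => chi k w * v k w).
  by move=> kN; apply: mart_diff_thin; [exact: md|exact: adapted_chi|exact: chi01].
have GS k : (k <= N)%N -> sub_sigma (G k) by case: k => // k kN; case: (md kN).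
split.
- apply: (measurable_sum _ (h := fun (i : 'I_N) w => chi i w * Z i w)) => i.
  have [sG _ mZ _ _ _ _ _] := md' i (ltn_ord i); exact: adapted_measurable mZ.
- apply: (measurable_sum _ (h := fun (i : 'I_N) w => chi i w * v i w)) => i.
  have [_ _ _ mv _ _ _ _] := md' i (ltn_ord i).
  by apply: adapted_measurable mv; apply: GS; exact: ltnW.
- by move=> w; rewrite -thinV_sum.
- move=> w VB; split; apply: eq_bigr => i _; by rewrite (chi_eq VB)// mul1r.
- have VB w : \sum_(i < N) chi i w * v i w <= B by rewrite -thinV_sum.
  exact: (@smooth_ind_martingale _ _ _ P N G delta (fun k w => chi k w * Z k w)
    (fun k w => chi k w * v k w) md' G0 B e c VB Bec d0 C K C0 HC).
Qed.

End Thinning.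

(** * From smoothed indicators to distribution functions *)

Section MartingaleCLT.
Context {R : realType} {d} {Om : measurableType d} (P : probability Om R).

(** Here [E] is the half-line event, [A] the exceptional event for the variance, and [U] the
    smoothed indicator. This comparison bounds [P E] from below, the next one from above. *)
Lemma expectation_le_indic (U : Om -> R) (E A : set Om) (q : R) :
  measurable E -> measurable A -> bounded_rv U -> (forall w, U w <= 1) -> 0 <= q ->
  (forall w, ~ A w -> ~ E w -> U w <= q) ->
  \int[P]_w U w <= fine (P E) + fine (P A) + q.
Proof.
move=> mE mA bU U1 q0 UAE.
have bE := @bounded_rv_indic R _ _ E mE; have bA := @bounded_rv_indic R _ _ A mA.
have bEA := bounded_rvD bE bA; have bq := @bounded_rv_cst R _ Om q.
rewrite -(expectation_indic P mE) -(expectation_indic P mA) -(expectationD P bE bA).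
rewrite -[X in _ + X](expectation_cst P) -(expectationD P bEA bq).
apply: expectation_le => //; first exact: bounded_rvD.
move=> w; rewrite !indicE; have := UAE w; have := U1 w.
have [wA|nwA] := pselect (A w); have [wE|nwE] := pselect (E w);
  rewrite ?(mem_set wA) ?(memNset nwA) ?(mem_set wE) ?(memNset nwE)/=; try lra.
by move=> _ /(_ nwA nwE); lra.
Qed.

Lemma indic_le_expectation (U : Om -> R) (E A : set Om) (q : R) :
  measurable E -> measurable A -> bounded_rv U -> (forall w, 0 <= U w) -> 0 <= q ->
  (forall w, ~ A w -> E w -> 1 - q <= U w) ->
  fine (P E) <= \int[P]_w U w + fine (P A) + q.
Proof.
move=> mE mA bU U0 q0 UAE.
have bE := @bounded_rv_indic R _ _ E mE; have bA := @bounded_rv_indic R _ _ A mA.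
have bUA := bounded_rvD bU bA; have bq := @bounded_rv_cst R _ Om q.
rewrite -(expectation_indic P mE) -(expectation_indic P mA) -(expectationD P bU bA).
rewrite -[X in _ + X](expectation_cst P) -(expectationD P bUA bq).
apply: expectation_le => //; first exact: bounded_rvD.
move=> w; rewrite !indicE; have := UAE w; have := U0 w.
have [wA|nwA] := pselect (A w); have [wE|nwE] := pselect (E w);
  rewrite ?(mem_set wA) ?(memNset nwA) ?(mem_set wE) ?(memNset nwE)/=; try lra.
by move=> _ /(_ nwA wE); lra.
Qed.

(** The threshold is moved by [M] standard deviations of the residual noise, whose variance is at
    most [3 * h]; the shift and the excess variance [2 * h] vanish together. *)
Lemma smooth_ind_cvg (x M : R) :
  smooth_ind (1 + 2 * h) (x + M * Num.sqrt (3 * h)) @[h --> 0^'+] --> gcdf x.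
Proof.
apply: (cvg_comp (fun h => (x + M * Num.sqrt (3 * h)) * (1 + 2 * h) `^ (- 2^-1)) gcdf);
  last exact: gcdf_continuous.
have c1 : (1 + 2 * h) @[h --> (0:R)^'+] --> (1:R).
  apply: cvg_at_right_filter; rewrite -[X in _ --> X]addr0 -[X in _ --> _ + X](mulr0 2).
  by apply: cvgD; [exact: cvg_cst|apply: cvgM; [exact: cvg_cst|exact: cvg_id]].
have c2 : (1 + 2 * h) `^ (- 2^-1) @[h --> (0:R)^'+] --> (1:R).
  suff : (1 + 2 * h) `^ (- 2^-1) @[h --> (0:R)^'+] --> (1 : R) `^ (- 2^-1) by rewrite powR1.
  apply: (cvg_comp _ (fun t => t `^ (- 2^-1)) c1).
  have D : differentiable (fun t : R => t `^ (- 2^-1)) (1 : R).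
    apply/derivable1_diffP.
    by have H := is_derive1_powR (- 2^-1) (@ltr01 R); exact: ex_derive.
  exact: (differentiable_continuous D).
have c3 : Num.sqrt (3 * h) @[h --> (0:R)^'+] --> (0:R).
  rewrite -[X in _ --> X](@sqrtr0 R).
  apply: (cvg_comp _ (fun t => Num.sqrt t) _ (@sqrt_continuous R 0)).
  apply: cvg_at_right_filter; rewrite -[X in _ --> X](mulr0 3).
  by apply: cvgM; [exact: cvg_cst|exact: cvg_id].
have c4 : (x + M * Num.sqrt (3 * h)) @[h --> (0:R)^'+] --> x.
  rewrite -[X in _ --> X]addr0 -[X in _ --> _ + X](mulr0 M).
  by apply: cvgD; [exact: cvg_cst|apply: cvgM c3; exact: cvg_cst].
by have := cvgM c4 c2; rewrite mulr1; exact.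
Qed.

Lemma martingale_clt (N : nat -> nat) (G : nat -> nat -> set (set Om))
    (delta : nat -> R) (Z v : nat -> nat -> Om -> R) :
  (\forall n \near \oo, [/\ sub_sigma (G n 0%N), 0 <= delta n &
    forall k, (k < N n)%N -> mart_diff P (G n k) (G n k.+1) (delta n) (Z n k) (v n k)]) ->
  delta n @[n --> \oo] --> (0 : R) ->
  cvg_in_probability0 P (fun n w => \sum_(i < N n) v n i w - 1) ->
  forall x, P [set w | \sum_(i < N n) Z n i w <= x] @[n --> \oo] --> (gcdf x)%:E.
Proof.
move=> md delta0 Vcvg x.
have mSV : \forall n \near \oo, measurable_fun setT (fun w => \sum_(i < N n) Z n i w) /\
    measurable_fun setT (fun w => \sum_(i < N n) v n i w).
  near=> n.
  have [G0 _ mdn] : [/\ sub_sigma (G n 0%N), 0 <= delta n & forall k, (k < N n)%N ->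
    mart_diff P (G n k) (G n k.+1) (delta n) (Z n k) (v n k)] by near: n.
  split.
    apply: (measurable_sum _ (h := fun (i : 'I_(N n)) w => Z n i w)) => i.
    have [sG _ mZ _ _ _ _ _] := mdn i (ltn_ord i); exact: adapted_measurable mZ.
  apply: (measurable_sum _ (h := fun (i : 'I_(N n)) w => v n i w)) => -[i iN].
  have [_ _ _ mv _ _ _ _] := mdn i iN; apply: adapted_measurable mv.
  by case: i iN => // i iN; have [] := mdn i (ltnW iN).
have measurable_le (f : Om -> R) y : measurable_fun setT f -> measurable [set w | f w <= y].
  by move=> mf; have := mf measurableT _ (measurable_itv `]-oo, y]); rewrite setTI set_itvE.
have measurable_gt (f : Om -> R) y : measurable_fun setT f -> measurable [set w | y < f w].
  by move=> mf; have := mf measurableT _ (measurable_itv `]y, +oo[); rewrite setTI set_itvE.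
suff H (e : R) : 0 < e -> \forall n \near \oo,
    `|fine (P [set w | \sum_(i < N n) Z n i w <= x]) - gcdf x| <= e.
  apply/fine_cvgP; split.
    near=> n; rewrite fin_num_measure//; apply: measurable_le.
    by have [] : measurable_fun setT (fun w => \sum_(i < N n) Z n i w) /\
      measurable_fun setT (fun w => \sum_(i < N n) v n i w) by near: n.
  by apply/cvgrPdist_le => e e0; near=> n; rewrite distrC; near: n; exact: H.
move=> e0.
(* Four errors of size [q] occur: the Gaussian tail, the moved threshold, the martingale estimate
   and the exceptional event. Dividing by 6 leaves slack. *)
pose q := e / 6.
have q0 : 0 < q by rewrite divr_gt0.
have [M [M0 Mp Mn]] : exists M : R, [/\ 0 <= M, 1 - q <= gcdf M & gcdf (- M) <= q].
  have : \forall M \near +oo, [/\ 0 <= M, 1 - q <= gcdf M & gcdf (- M) <= q].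
    near=> M; split.
    - near: M; exact: nbhs_pinfty_ge.
    - near: M.
      have /cvgrPdist_le/(_ _ q0) := @gcdf_cvgy R.
      by apply: filterS => M; rewrite ler_norml => /andP[]; lra.
    - near: M.
      have : gcdf (- t) @[t --> +oo] --> (0 : R).
        exact: (cvgNy_compNP _ _).1 gcdf_cvgNy.
      move=> /cvgrPdist_le/(_ _ q0).
      by apply: filterS => M; rewrite sub0r normrN; apply: le_trans; exact: ler_norm.
  by move=> /filter_ex.
(* The order of choice matters: [h] depends on [M], so that [M * Num.sqrt (3 * h)] is small, and the
   constant [C] depends on [h]; only then does [n] grow. *)
have [h [h0 hp hm]] : exists h : R, [/\ 0 < h,
    `|gcdf x - smooth_ind (1 + 2 * h) (x + M * Num.sqrt (3 * h))| <= q &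
    `|gcdf x - smooth_ind (1 + 2 * h) (x + - M * Num.sqrt (3 * h))| <= q].
  have : \forall h \near (0:R)^'+, [/\ 0 < h,
    `|gcdf x - smooth_ind (1 + 2 * h) (x + M * Num.sqrt (3 * h))| <= q &
    `|gcdf x - smooth_ind (1 + 2 * h) (x + - M * Num.sqrt (3 * h))| <= q].
    near=> h; split.
    - by near: h; exact: nbhs_right_gt.
    - by near: h; have /cvgrPdist_le/(_ _ q0) := @smooth_ind_cvg x M; exact.
    - by near: h; have /cvgrPdist_le/(_ _ q0) := @smooth_ind_cvg x (- M); exact.
  by move=> /filter_ex.
have [C C0 HC] := smooth_ind_expand h0.
(* With total smoothing [1 + 2 * h], the residual variance is at least [h] as long as the
   accumulated variance is at most [B], and lies between [h] and [3 * h] off the event [A]. *)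
pose B := 1 + h.
have B0 : 0 <= B by rewrite /B; lra.
have Bc : B + h <= 1 + 2 * h by rewrite /B; lra.
near=> n.
have [G0 d0 mdn] : [/\ sub_sigma (G n 0%N), 0 <= delta n &
    forall k, (k < N n)%N -> mart_diff P (G n k) (G n k.+1) (delta n) (Z n k) (v n k)].
  by near: n.
have dq : C * (delta n + delta n ^+ 2) * B <= q.
  near: n.
  have : (C * (delta n + delta n ^+ 2) * B) @[n --> \oo] --> (0 : R).
    have : (C * (delta n + delta n * delta n) * B) @[n --> \oo] --> C * (0 + 0 * 0) * B.
      apply: cvgM; last exact: cvg_cst.
      apply: cvgM; first exact: cvg_cst.
      by apply: cvgD => //; exact: cvgM.
    by rewrite mul0r addr0 mulr0 mul0r.
  move=> /cvgrPdist_le/(_ _ q0); apply: filterS => n.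
  by rewrite sub0r normrN; apply: le_trans; exact: ler_norm.
have [mS0 mV0] : measurable_fun setT (fun w => \sum_(i < N n) Z n i w) /\
    measurable_fun setT (fun w => \sum_(i < N n) v n i w) by near: n.
pose S w := \sum_(i < N n) Z n i w; pose V w := \sum_(i < N n) v n i w.
pose A := [set w | h < `|V w - 1|].
have mS : measurable_fun setT S := mS0.
have mV : measurable_fun setT V := mV0.
have mA : measurable A.
  apply: measurable_gt; apply: measurableT_comp => //; exact: measurable_funB.
have PA : fine (P A) <= q.
  rewrite /A /V; near: n; have /fine_cvgP[_ /cvgrPdist_le/(_ _ q0)] := Vcvg _ h0.
  by apply: filterS => n; rewrite sub0r normrN; apply: le_trans; exact: ler_norm.
pose E := [set w | S w <= x].
have mE : measurable E by exact: measurable_le.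
rewrite -/E.
have key K : exists2 U : Om -> R, bounded_rv U &
   (forall w, 0 <= U w <= 1) /\
   (forall w, ~ A w -> exists2 t, 0 < t <= 3 * h & U w = smooth_ind t (K - S w)) /\
   `|\int[P]_w U w - smooth_ind (1 + 2 * h) K| <= q.
  have [S' [V' [mS' mV' V'B SV' bnd]]] := stopped_martingale_bound mdn G0 B0 d0 K Bc C0 HC.
  exists (fun w => smooth_ind (1 + 2 * h - V' w) (K - S' w)).
    split; last by exists 1 => w; rewrite ger0_norm ?smooth_ind_ge0 ?smooth_ind_le1.
    by apply: measurable_smooth_ind; apply: measurable_funB.
  split; first by move=> w; rewrite smooth_ind_ge0 smooth_ind_le1.
  split; last exact: le_trans dq.
  move=> w /negP; rewrite -leNgt ler_norml => /andP[Vl Vu].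
  have [|-> ->] := SV' w; first by rewrite -/(V w) /B; clear - Vu; lra.
  exists (1 + 2 * h - V w) => //; apply/andP; clear - h0 Vl Vu; split; lra.
have q6 : q * 6 = e by rewrite /q divfK.
have q0' := ltW q0.
apply/ler_normlP; split.
(* Lower bound: with the threshold moved down, a sum beyond [x] is at least [M] standard deviations
   too large, so [U] is nearly 0 off [E]. The upper bound moves the threshold up. *)
- have [U bU [U01 [UA EU]]] := key (x + - M * Num.sqrt (3 * h)).
  have UE w : ~ A w -> ~ E w -> U w <= q.
    move=> nwA /negP; rewrite /E/= -ltNge => nwE.
    have [t /andP[t0 th] ->] := UA w nwA; apply: le_trans Mn.
    by apply: smooth_ind_le t0 th M0 _; clear - nwE; lra.
  have U1 w : U w <= 1 by case/andP: (U01 w).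
  have := expectation_le_indic mE mA bU U1 q0' UE.
  move: EU hm; rewrite !ler_norml => /andP[E1 E2] /andP[h1 h2] E3.
  clear - PA q0 q6 E1 E2 h1 h2 E3; lra.
- have [U bU [U01 [UA EU]]] := key (x + M * Num.sqrt (3 * h)).
  have UE w : ~ A w -> E w -> 1 - q <= U w.
    move=> nwA; rewrite /E/= => wE.
    have [t /andP[t0 th] ->] := UA w nwA; apply: (le_trans Mp).
    by apply: smooth_ind_ge t0 th M0 _; clear - wE; lra.
  have U0 w : 0 <= U w by case/andP: (U01 w).
  have := indic_le_expectation mE mA bU U0 q0' UE.
  move: EU hp; rewrite !ler_norml => /andP[E1 E2] /andP[h1 h2] E3.
  clear - PA q0 q6 E1 E2 h1 h2 E3; lra.
Unshelve. all: by end_near. Qed.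

End MartingaleCLT.

(** * Conditional expectation *)

Section CondExp.
Context {R : realType} {d} {Om : measurableType d} (P : probability Om R).
Implicit Types (f g h u : Om -> R) (G : set (set Om)) (M : R).

Notation integrable_rv f := (P.-integrable setT (EFin \o f)).

Lemma integrable_measurable f : integrable_rv f -> measurable_fun setT f.
Proof. by move=> /measurable_int/measurable_EFinP. Qed.

Lemma integrable_ae_eq f g : measurable_fun setT f -> integrable_rv g ->
  {ae P, forall w, f w = g w} -> integrable_rv f.
Proof.
move=> mf intg fg; have mg := integrable_measurable intg.
have /integrableP[_ gfin] := intg.
apply/integrableP; split; first exact/measurable_EFinP.
rewrite (ae_eq_integral (fun w => `|(EFin \o g) w|%E)) //.
- by apply: measurableT_comp => //; exact/measurable_EFinP.
- by apply: measurableT_comp => //; exact/measurable_EFinP.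
- by apply: filterS fg => w fw _ /=; rewrite fw.
Qed.

Lemma integrable_rvD f g : integrable_rv f -> integrable_rv g -> integrable_rv (fun w => f w + g w).
Proof. by move=> intf intg; have := integrableD measurableT intf intg. Qed.

Lemma integrable_rvB f g : integrable_rv f -> integrable_rv g -> integrable_rv (fun w => f w - g w).
Proof. by move=> intf intg; have := integrableB measurableT intf intg. Qed.

Lemma integrable_rvZ (c : R) f : integrable_rv f -> integrable_rv (fun w => c * f w).
Proof. by move=> intf; have := integrableZl measurableT c intf. Qed.

Lemma integrable_rv_cst (c : R) : integrable_rv (fun=> c).
Proof. exact: (bounded_rv_integrable P (bounded_rv_cst c)). Qed.

Lemma integrable_rv_sum I (s : seq I) (F : I -> Om -> R) :
  (forall i, integrable_rv (F i)) -> integrable_rv (fun w => \sum_(i <- s) F i w).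
Proof.
move=> intF; elim: s => [|i s IH].
  have -> : (fun w => \sum_(i <- [::]) F i w) = fun=> 0 :> R.
    by apply/funext => w; rewrite big_nil.
  exact: integrable_rv_cst.
have -> : (fun w => \sum_(i <- i :: s) F i w) = fun w => F i w + \sum_(i <- s) F i w.
  by apply/funext => w; rewrite big_cons.
exact: integrable_rvD.
Qed.

Lemma expectation_sum I (s : seq I) (F : I -> Om -> R) :
  (forall i, integrable_rv (F i)) ->
  \int[P]_w (\sum_(i <- s) F i w) = \sum_(i <- s) \int[P]_w F i w.
Proof.
move=> intF; elim: s => [|i s IH].
  by rewrite big_nil; under eq_Rintegral do rewrite big_nil; rewrite expectation_cst.
rewrite big_cons -IH -RintegralD//; last exact: integrable_rv_sum.
by apply: eq_Rintegral => w _; rewrite big_cons.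
Qed.

(** Truncation to [[-M, M]]: it turns an almost sure bound into an everywhere bound without changing
    integrals. *)
Definition clamp M (x : R) := Num.max (- M) (Num.min x M).

Lemma clamp_bound M x : 0 <= M -> `|clamp M x| <= M.
Proof.
move=> M0; rewrite ler_norml /clamp le_max lexx/= ge_max ge_min lexx orbT andbT.
by apply: (@le_trans _ _ 0); rewrite ?oppr_le0.
Qed.

Lemma clamp_id M x : `|x| <= M -> clamp M x = x.
Proof. by rewrite ler_norml /clamp => /andP[f1 f2]; rewrite (min_idPl f2) (max_idPr f1). Qed.

Lemma measurable_clamp M d' (T : measurableType d') (f : T -> R) :
  measurable_fun setT f -> measurable_fun setT (fun w => clamp M (f w)).
Proof. by move=> mf; apply: measurable_maxr => //; exact: measurable_minr. Qed.

Lemma ae_bounded_integrable f M : measurable_fun setT f ->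
  {ae P, forall w, `|f w| <= M} -> integrable_rv f.
Proof.
move=> mf fM; apply: (@integrable_ae_eq _ (fun w => clamp `|M| (f w))) => //.
  apply: bounded_rv_integrable; split; first exact: measurable_clamp.
  by exists `|M| => w; exact: clamp_bound.
by apply: filterS fM => w fM; rewrite clamp_id// (le_trans fM)// ler_norm.
Qed.

Lemma integrable_rvM h f M : measurable_fun setT h -> integrable_rv f ->
  {ae P, forall w, `|h w| <= M} -> integrable_rv (fun w => h w * f w).
Proof.
move=> mh intf hM; have mf := integrable_measurable intf.
apply: (@integrable_ae_eq _ (fun w => clamp `|M| (h w) * f w)).
- exact: measurable_funM.
- have inttf : integrable_rv (fun w => `|M| * f w).
    by have := integrableZl measurableT `|M| intf.
  apply: (le_integrable measurableT _ _ inttf).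
    by apply/measurable_EFinP; apply: measurable_funM => //; exact: measurable_clamp.
  by move=> w _; rewrite /= lee_fin !normrM normr_id ler_wpM2r// clamp_bound.
- by apply: filterS hM => w hM; rewrite clamp_id// (le_trans hM)// ler_norm.
Qed.

Lemma expectation_ae_eq f g : measurable_fun setT f -> measurable_fun setT g ->
  {ae P, forall w, f w = g w} -> \int[P]_w f w = \int[P]_w g w.
Proof.
move=> mf mg fg; congr fine; apply: ae_eq_integral => //; try exact/measurable_EFinP.
by apply: filterS fg => w -> .
Qed.

(** For [y <= m] the sum is the integer part of [y], written as a sum of threshold indicators. The
    third clause, where the count saturates, drives the induction. *)
Lemma floor_count (y : R) (m : nat) : 0 <= y ->
  [/\ y <= m%:R -> y - 1 <= \sum_(j < m) (if j.+1%:R <= y then 1 else 0),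
      \sum_(j < m) (if j.+1%:R <= y then 1 else 0) <= y &
      m%:R <= y -> \sum_(j < m) (if j.+1%:R <= y then 1 else 0) = m%:R :> R].
Proof.
move=> y0; elim: m => [|m [IH1 IH2 IH3]].
  by rewrite !big_ord0; split=> //; lra.
have mS : m.+1%:R = m%:R + 1 :> R by rewrite natr1.
rewrite !big_ord_recr/= mS; split.
- move=> ym; case: ifPn => h; first by rewrite IH3; lra.
  by rewrite addr0; have [/IH1//|/ltW ym'] := leP y m%:R; rewrite IH3//; lra.
- by case: ifPn => h; rewrite ?addr0//; rewrite IH3; lra.
- by move=> h; rewrite h IH3//; lra.
Qed.

Lemma adapted_superlevel G h c : adapted G h -> <<s G >> [set w | c <= h w].
Proof.
by move=> mh; have := mh measurableT _ (measurable_itv `[c, +oo[); rewrite setTI set_itvE.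
Qed.

(** The average [hm] of indicators of superlevel sets of [h] is uniformly within [1 / (m + 1)] of
    [h]. Those sets lie in the sigma-algebra, so each average integrates to 0 against [u], and the
    error is at most the mean of [|u|] divided by [m + 1]. *)
Lemma expectation_pull0_unit G u h : sub_sigma G -> integrable_rv u ->
  (forall D, <<s G >> D -> \int[P]_(w in D) u w = 0) ->
  adapted G h -> (forall w, 0 <= h w <= 1) -> \int[P]_w (h w * u w) = 0.
Proof.
move=> sG intu u0 mh h01.
have mh' := adapted_measurable sG mh.
have mu := integrable_measurable intu.
pose hm (m : nat) w : R := m.+1%:R^-1 * \sum_(j < m.+1) (if j.+1%:R <= m.+1%:R * h w then 1 else 0).
have hmE m w : `|h w - hm m w| <= m.+1%:R^-1.
  have /andP[h0 h1] := h01 w; have m0 : (0 : R) < m.+1%:R by [].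
  have [|b1 b2 _] := @floor_count (m.+1%:R * h w) m.+1; first by rewrite mulr_ge0.
  have {}b1 := b1 (ler_piMr (ler0n _ _) h1).
  rewrite -(ler_pM2l m0) divff ?gt_eqF// -[X in X * _]ger0_norm// -normrM mulrBr.
  rewrite /hm mulVKf ?gt_eqF// ler_norml; apply/andP; split; lra.
have indE m j : (fun w => if j.+1%:R <= m.+1%:R * h w then 1 else 0) =
    \1_[set w | j.+1%:R / m.+1%:R <= h w] :> (Om -> R).
  apply/funext => w; rewrite indicE.
  have e : (j.+1%:R / m.+1%:R <= h w) = (j.+1%:R <= m.+1%:R * h w).
    by rewrite ler_pdivrMr// mulrC.
  case: ifPn; rewrite -e => hj; first by rewrite mem_set.
  by rewrite memNset//; exact/negP.
have hmI m : hm m = fun w => m.+1%:R^-1 * \sum_(j < m.+1) \1_[set w | j.+1%:R / m.+1%:R <= h w] w.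
  by apply/funext => w; rewrite /hm; congr (_ * _); apply: eq_bigr => j _; rewrite -indE.
have mD (c : R) : measurable [set w | c <= h w] by apply: sG; exact: adapted_superlevel.
have intD (c : R) : integrable_rv (fun w => \1_[set w | c <= h w] w * u w).
  apply: (@integrable_rvM _ _ 1) => //.
  by apply: aeW => w; rewrite ger0_norm indicE// lern1 leq_b1.
have ED (c : R) : \int[P]_w (\1_[set w | c <= h w] w * u w) = 0.
  rewrite -[RHS](u0 _ (adapted_superlevel c mh)) [RHS]Rintegral_mkcond.
  apply: eq_Rintegral => w _; rewrite patchE indicE.
  by case: (w \in _); rewrite ?mul1r ?mul0r.
have Ehm m : integrable_rv (fun w => hm m w * u w) /\ \int[P]_w (hm m w * u w) = 0.
  have E : (fun w => hm m w * u w) = (fun w => m.+1%:R^-1 *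
      \sum_(j < m.+1) (\1_[set w | j.+1%:R / m.+1%:R <= h w] w * u w)).
    by apply/funext => w; rewrite hmI -mulrA mulr_suml.
  rewrite E; split; first by apply: integrable_rvZ; apply: integrable_rv_sum => j; exact: intD.
  rewrite RintegralZl//; last by apply: integrable_rv_sum => j; exact: intD.
  by rewrite expectation_sum// big1 ?mulr0.
have inthu : integrable_rv (fun w => h w * u w).
  apply: (@integrable_rvM _ _ 1) => //.
  by apply: aeW => w; have /andP[h0 h1] := h01 w; rewrite ger0_norm.
have intau : integrable_rv (fun w => `|u w|) by have := integrable_abse intu.
have bnd m : `|\int[P]_w (h w * u w)| <= m.+1%:R^-1 * \int[P]_w `|u w|.
  have [H1 H2] := Ehm m.
  rewrite -[X in `|X|]subr0 -H2 -RintegralB//.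
  have intd : integrable_rv (fun w => h w * u w - hm m w * u w).
    by have := integrableB measurableT inthu H1.
  apply: (le_trans (le_normr_Rintegral measurableT intd)).
  rewrite -RintegralZl//; apply: le_Rintegral => //.
  - by have := integrable_abse intd.
  - by have := integrableZl measurableT m.+1%:R^-1 intau.
  - by move=> w _; rewrite -mulrBl normrM ler_wpM2r.
apply/eqP; rewrite -normr_le0; apply/ler_addgt0Pr => e e0; rewrite add0r.
have cv : (fun m => m.+1%:R^-1 * \int[P]_w `|u w|) @ \oo --> (0 : R).
  by rewrite -[X in _ --> X](mul0r (\int[P]_w `|u w|)); apply: cvgMr_tmp; exact: cvg_harmonic.
move/cvgrPdist_le : cv => /(_ e e0) [m _ /(_ m (leqnn m))].
by rewrite sub0r normrN => h1; apply: (le_trans (bnd m)); apply: (le_trans (ler_norm _)).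
Qed.

Lemma integral_indicM (D : set Om) u : \int[P]_(w in D) u w = \int[P]_w (\1_D w * u w).
Proof.
rewrite Rintegral_mkcond; apply: eq_Rintegral => w _; rewrite patchE indicE.
by case: (w \in _); rewrite ?mul1r ?mul0r.
Qed.

(** An affine change of the clamped [h] brings it into [[0, 1]]; [K] is [|M| + 1] rather than [|M|]
    so that it can be divided by. *)
Lemma expectation_pull0 G u h M : sub_sigma G -> integrable_rv u ->
  (forall D, <<s G >> D -> \int[P]_(w in D) u w = 0) ->
  adapted G h -> {ae P, forall w, `|h w| <= M} -> \int[P]_w (h w * u w) = 0.
Proof.
move=> sG intu u0 mh hM.
have mu := integrable_measurable intu; have mh' := adapted_measurable sG mh.
pose K := `|M| + 1; have K0 : 0 < K by rewrite ltr_pwDr.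
pose h1 w := clamp `|M| (h w); pose h2 w := (h1 w + K) / (2 * K).
have mh1 : adapted G h1 by exact: measurable_clamp.
have mh2 : adapted G h2 by apply: measurable_funM => //; exact: measurable_funD.
have h1M w : `|h1 w| <= `|M| by exact: clamp_bound.
have h201 w : 0 <= h2 w <= 1.
  have := h1M w; rewrite ler_norml => /andP[l1 l2].
  apply/andP; split.
    by apply: divr_ge0; [rewrite /K; clear - l1; lra|rewrite mulr_ge0// ltW].
  by rewrite /h2 ler_pdivrMr ?mulr_gt0// /K; clear - l2; lra.
have E : \int[P]_w (h w * u w) = \int[P]_w (h1 w * u w).
  apply: expectation_ae_eq; try by apply: measurable_funM => //; exact: measurable_clamp.
  by apply: filterS hM => w hM; rewrite /h1 clamp_id// (le_trans hM)// ler_norm.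
have inth2 : integrable_rv (fun w => h2 w * u w).
  apply: (@integrable_rvM _ _ 1) => //; first exact: adapted_measurable mh2.
  by apply: aeW => w; have /andP[? ?] := h201 w; rewrite ger0_norm.
rewrite E.
have -> : (fun w => h1 w * u w) = (fun w => 2 * K * (h2 w * u w) - K * u w).
  by apply/funext => w; rewrite /h2; field; rewrite gt_eqF.
have sT : <<s G >> [set: Om].
  by have := @measurableT _ (g_sigma_algebraType G).
rewrite RintegralB// ?RintegralZl//; try exact: integrable_rvZ.
by rewrite (expectation_pull0_unit sG intu u0 mh2 h201) (u0 _ sT) !mulr0 subrr.
Qed.

(** The definition tests conditional expectations on sets only; this extends it to bounded
    measurable test functions, by applying [expectation_pull0] to [f - g]. *)
Lemma cond_exp_pull G f g h M : sub_sigma G -> integrable_rv f -> is_cond_exp P G f g ->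
  adapted G h -> {ae P, forall w, `|h w| <= M} ->
  \int[P]_w (h w * f w) = \int[P]_w (h w * g w).
Proof.
move=> sG intf [mg intg fg] mh hM; have mh' := adapted_measurable sG mh.
have H : \int[P]_w (h w * (f w - g w)) = 0.
  apply: (expectation_pull0 sG _ _ mh hM); first exact: integrable_rvB.
  move=> D GD; have mD := sG _ GD.
  rewrite RintegralB//; try by apply: integrableS intf || apply: integrableS intg.
  by apply/eqP; rewrite subr_eq0; apply/eqP; congr fine; rewrite fg.
apply/eqP; rewrite -subr_eq0 -RintegralB//; try exact: integrable_rvM hM.
by rewrite -[X in _ == X]H; apply/eqP; apply: eq_Rintegral => w _; rewrite mulrBr.
Qed.

(** Test against the indicator of [g < 0]: the product is nonpositive with nonnegative integral,
    hence almost surely 0. *)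
Lemma adapted_ge0 G g : sub_sigma G -> adapted G g -> integrable_rv g ->
  (forall h, adapted G h -> (forall w, 0 <= h w <= 1) -> 0 <= \int[P]_w (h w * g w)) ->
  {ae P, forall w, 0 <= g w}.
Proof.
move=> sG mg intg hg.
pose h w : R := if g w < 0 then 1 else 0.
have mh : adapted G h by apply: measurable_fun_ifT => //; exact: measurable_fun_ltr.
have h01 w : 0 <= h w <= 1 by rewrite /h; case: ifP; rewrite lexx ler01.
have inth : integrable_rv (fun w => h w * g w).
  apply: (@integrable_rvM _ _ 1) => //; first exact: adapted_measurable mh.
  by apply: aeW => w; have /andP[? ?] := h01 w; rewrite ger0_norm.
have mhg := integrable_measurable inth.
have hg0 w : h w * g w <= 0 by rewrite /h; case: ltP; rewrite ?mul1r ?mul0r// => /ltW.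
have : (\int[P]_w `|(EFin \o (fun w => (h w * g w)%R)) w| = 0)%E.
  have I : \int[P]_w `|h w * g w| = 0.
    apply/eqP; rewrite eq_le Rintegral_ge0// andbT.
    have -> : \int[P]_w `|h w * g w| = - \int[P]_w (h w * g w).
      rewrite -mulN1r -RintegralZl//; apply: eq_Rintegral => w _.
      by rewrite ler0_norm// mulN1r.
    by rewrite oppr_le0 hg.
  rewrite -(@fineK _ (\int[P]_w _)%E); last first.
    by apply: integrable_fin_num => //; exact: integrable_abse.
  by congr _%:E; rewrite -[RHS]I.
move=> /(ae_eq_integral_abs P measurableT) H.
have /H : measurable_fun setT (EFin \o (fun w => h w * g w)) by exact/measurable_EFinP.
apply: filterS => w /(_ I)/= [].
rewrite /h; case: ltP => // g0; rewrite mul1r => gw.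
by move: g0; rewrite gw ltxx.
Qed.

Lemma cond_exp_ge0 G f g : sub_sigma G -> integrable_rv f -> is_cond_exp P G f g ->
  {ae P, forall w, 0 <= f w} -> {ae P, forall w, 0 <= g w}.
Proof.
move=> sG intf fg f0; have [mg intg _] := fg.
apply: (adapted_ge0 sG mg intg) => h mh h01.
have hM : {ae P, forall w, `|h w| <= 1}.
  by apply: aeW => w; have /andP[? ?] := h01 w; rewrite ger0_norm.
rewrite -(cond_exp_pull sG intf fg mh hM).
have mh' := adapted_measurable sG mh; have mf := integrable_measurable intf.
have -> : \int[P]_w (h w * f w) = \int[P]_w `|h w * f w|.
  apply: expectation_ae_eq; first exact: measurable_funM.
    by apply: measurableT_comp => //; exact: measurable_funM.
  apply: filterS f0 => w f0; rewrite ger0_norm// mulr_ge0//.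
  by have /andP[] := h01 w.
exact: Rintegral_ge0.
Qed.

Lemma is_cond_exp_cstB G f g (c : R) : sub_sigma G -> integrable_rv f -> is_cond_exp P G f g ->
  is_cond_exp P G (fun w => c - f w) (fun w => c - g w).
Proof.
move=> sG intf [mg intg fg]; split.
- exact: measurable_funB.
- by apply: integrable_rvB => //; exact: integrable_rv_cst.
- move=> D GD; have mD := sG _ GD.
  under eq_integral do rewrite EFinB; under [RHS]eq_integral do rewrite EFinB.
  rewrite !integralB//; try (by apply: (integrableS _ _ _ intf)); try (by apply: (integrableS _ _ _ intg));
    try (by apply: (integrableS _ _ _ (integrable_rv_cst c))).
  by rewrite fg.
Qed.

Lemma cond_exp_le G f g (c : R) : sub_sigma G -> integrable_rv f -> is_cond_exp P G f g ->
  {ae P, forall w, f w <= c} -> {ae P, forall w, g w <= c}.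
Proof.
move=> sG intf fg fc.
have : {ae P, forall w, 0 <= c - g w}.
  apply: (cond_exp_ge0 sG _ (is_cond_exp_cstB c sG intf fg)).
    by apply: integrable_rvB => //; exact: integrable_rv_cst.
  by apply: filterS fc => w; rewrite subr_ge0.
by apply: filterS => w; rewrite subr_ge0.
Qed.

Lemma cond_exp_eq0 G f g : sub_sigma G -> integrable_rv f -> is_cond_exp P G f g ->
  (forall h, adapted G h -> (forall w, 0 <= h w <= 1) -> \int[P]_w (h w * f w) = 0) ->
  {ae P, forall w, g w = 0}.
Proof.
move=> sG intf fg f0; have [mg intg _] := fg.
have g0 h : adapted G h -> (forall w, 0 <= h w <= 1) -> \int[P]_w (h w * g w) = 0.
  move=> mh h01; rewrite -(cond_exp_pull sG intf fg mh (M := 1)) ?f0//.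
  by apply: aeW => w; have /andP[? ?] := h01 w; rewrite ger0_norm.
have gge : {ae P, forall w, 0 <= g w}.
  by apply: (adapted_ge0 sG mg intg) => h mh h01; rewrite g0.
have gle : {ae P, forall w, 0 <= - 1 * g w}.
  apply: (@adapted_ge0 G (fun w => -1 * g w)) => //.
  - exact: measurable_funM.
  - exact: integrable_rvZ.
  - move=> h mh h01.
    have -> : (fun w => h w * (- 1 * g w)) = (fun w => -1 * (h w * g w)).
      by apply/funext => w; rewrite mulrCA.
    rewrite RintegralZl// ?g0 ?mulr0//.
    apply: (@integrable_rvM _ _ 1) => //; first exact: adapted_measurable mh.
    by apply: aeW => w; have /andP[? ?] := h01 w; rewrite ger0_norm.
apply: filterS2 gge gle => w g1 g2; apply/eqP; rewrite eq_le g1 andbT.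
by move: g2; rewrite mulN1r oppr_ge0.
Qed.

Section Existence.
Variables (G : set (set Om)) (f : Om -> R).
Hypotheses (sG : sub_sigma G) (intf : integrable_rv f).

Let idG : Om -> g_sigma_algebraType G := idfun.

Let midG : measurable_fun setT idG.
Proof. by move=> _ B mB; rewrite setTI; exact: sG. Qed.

Let idG_mixin := isMeasurableFun.Build _ _ _ _ _ midG.
Let idG_mfun : {mfun Om >-> g_sigma_algebraType G} := HB.pack idG idG_mixin.

(** Radon-Nikodym on the smaller sigma-algebra. The identity [idG] into the coarser space pushes
    forward both [P] and the charge with density [f], and the derivative of one by the other is the
    conditional expectation. *)
Lemma cond_exp_exists : exists g, is_cond_exp P G f g.
Proof.
pose mu : probability (g_sigma_algebraType G) R := distribution P idG_mfun.
pose nu0 : {charge set (g_sigma_algebraType G) -> \bar R} := pushforward (induced_charge intf) idG.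
pose nu := nu0 midG.
have domf : nu `<< mu.
  apply: dominates_pushforward; first exact: midG.
  apply/null_content_dominatesP => A mA PA0.
  rewrite /induced_charge; apply: null_set_integral => //.
  by apply: measurable_funTS; exact/measurable_EFinP/integrable_measurable.
pose g : g_sigma_algebraType G -> \bar R := Radon_Nikodym nu mu.
have gfin x : g x \is a fin_num by exact: Radon_Nikodym_fin_num.
have intg : mu.-integrable setT g by exact: Radon_Nikodym_integrable.
have gE A : measurable A -> (nu A = \int[mu]_(x in A) g x)%E by exact: Radon_Nikodym_integral.
have mg : measurable_fun setT g by exact: measurable_int intg.
have fineg : EFin \o (fine \o g) = g by apply/funext => x /=; rewrite fineK.
have intPg : P.-integrable setT (g : Om -> \bar R).
  apply/integrableP; split; first by apply: measurableT_comp mg midG.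
  have /integrableP[_] := intg.
  have mag : measurable_fun [set: g_sigma_algebraType G] (fun x => `|g x|%E).
    exact: measurableT_comp.
  have := @ge0_integral_pushforward _ _ _ _ R idG midG P setT (fun x => `|g x|%E) measurableT mag.
  by rewrite preimage_setT => <-.
exists (fine \o g); split.
- by apply/measurable_EFinP; rewrite fineg.
- by have -> : EFin \o (fine \o g : Om -> R) = g by [].
- move=> D GD; have mD : measurable (D : set (g_sigma_algebraType G)) by [].
  rewrite -[RHS]/(nu D) gE//.
  have intgD : P.-integrable (idG @^-1` D) (g \o idG) by apply: integrableS intPg => //; exact: sG.
  rewrite [RHS](@integral_pushforward _ _ _ _ R idG midG P D g mg intgD mD).
  by apply: eq_integral => w _ /=; rewrite fineK.
Qed.

End Existence.

Lemma cond_expP G f : sub_sigma G -> integrable_rv f -> is_cond_exp P G f (cond_exp P G f).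
Proof. by move=> sG intf; apply: xgetPex; exact: cond_exp_exists. Qed.

Lemma expectation_cvg (F : nat -> Om -> R) f M :
  (forall n, measurable_fun setT (F n)) -> measurable_fun setT f ->
  {ae P, forall w, forall n, `|F n w| <= M} -> {ae P, forall w, F n w @[n --> \oo] --> f w} ->
  \int[P]_w F n w @[n --> \oo] --> \int[P]_w f w.
Proof.
move=> mF mf FM Ff.
have [|||||intf _ cv] := @dominated_convergence _ _ _ P setT measurableT
  (fun n => EFin \o F n) (EFin \o f) (fun=> M%:E).
- by move=> n; exact/measurable_EFinP.
- exact/measurable_EFinP.
- by apply: filterS Ff => w Ff _; apply/cvg_EFin => //; exact: nearW.
- exact: integrable_rv_cst.
- by apply: filterS FM => w FM n _; rewrite /= lee_fin.
- apply: fine_cvg; rewrite fineK; first exact: cv.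
  exact: integrable_fin_num.
Qed.

End CondExp.

(** * Hilbert-valued measurability and integration *)

Section Hilbert.
Context {R : realType} {H : hilbertType R}.
Implicit Types (x y z : H) (c : R).

Lemma inner0l y : inner (0 : H) y = 0.
Proof. by rewrite -(scale0r (0 : H)) innerZl mul0r. Qed.

Lemma innerDr x y z : inner x (y + z) = inner x y + inner x z.
Proof. by rewrite !(innerC x) innerDl. Qed.

Lemma innerZr c x y : inner x (c *: y) = c * inner x y.
Proof. by rewrite !(innerC x) innerZl. Qed.

Lemma inner0r x : inner x 0 = 0. Proof. by rewrite innerC inner0l. Qed.

Lemma innerNl x y : inner (- x) y = - inner x y.
Proof. by rewrite -scaleN1r innerZl mulN1r. Qed.

Lemma innerBl x y z : inner (x - y) z = inner x z - inner y z.
Proof. by rewrite innerDl innerNl. Qed.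

Lemma innerBr x y z : inner x (y - z) = inner x y - inner x z.
Proof. by rewrite !(innerC x) innerBl. Qed.

Lemma inner_suml I (s : seq I) (F : I -> H) y :
  inner (\sum_(i <- s) F i) y = \sum_(i <- s) inner (F i) y.
Proof. by elim/big_rec2: _ => [|i ? ? _ <-]; rewrite ?inner0l ?innerDl. Qed.

Lemma inner_sumr I (s : seq I) (F : I -> H) y :
  inner y (\sum_(i <- s) F i) = \sum_(i <- s) inner y (F i).
Proof. by rewrite innerC inner_suml; apply: eq_bigr => i _; rewrite innerC. Qed.

Lemma cauchy_schwarz x y : `|inner x y| <= `|x| * `|y|.
Proof.
have [->|y0] := eqVneq y 0; first by rewrite inner0r !normr0 mulr0.
have ny0 : 0 < `|y| by rewrite normr_gt0.
rewrite -(@ler_sqr _ `|inner x y|) ?nnegrE ?mulr_ge0// real_normK ?num_real// exprMn.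
pose z := (`|y| ^+ 2) *: x - (inner x y) *: y.
have : 0 <= inner z z by rewrite inner_norm sqr_ge0.
rewrite /z innerBl !innerBr !innerZl !innerZr !inner_norm (innerC y x).
set n := `|y| ^+ 2; set m := `|x| ^+ 2; set q := inner x y.
have n0 : 0 < n by rewrite exprn_gt0.
have -> : n * (n * m) - n * (q * q) - (q * (n * q) - q * (q * n)) = n * (m * n - q ^+ 2) by ring.
by rewrite pmulr_rge0// subr_ge0.
Qed.

Lemma inner_cvg (u v : nat -> H) x y : u @ \oo --> x -> v @ \oo --> y ->
  inner (u n) (v n) @[n --> \oo] --> inner x y.
Proof.
move=> ux vy.
have H1 : (`|u n - x| * (`|v n - y| + `|y|) + `|x| * `|v n - y|) @[n --> \oo] -->
   (0 * (0 + `|y|) + `|x| * 0 : R).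
  have nu : `|u n - x| @[n --> \oo] --> (0 : R).
    suff : `|u n - x| @[n --> \oo] --> `|x - x| by rewrite subrr normr0.
    by apply: cvg_norm; apply: cvgB => //; exact: cvg_cst.
  have nv : `|v n - y| @[n --> \oo] --> (0 : R).
    suff : `|v n - y| @[n --> \oo] --> `|y - y| by rewrite subrr normr0.
    by apply: cvg_norm; apply: cvgB => //; exact: cvg_cst.
  apply: cvgD; apply: cvgM => //; last exact: cvg_cst.
  by apply: cvgD => //; exact: cvg_cst.
rewrite mul0r mulr0 addr0 in H1.
apply/cvgrPdist_le => e e0; move/cvgrPdist_le : H1 => /(_ e e0).
apply: filterS => n; rewrite sub0r normrN ger0_norm; last by rewrite addr_ge0 ?mulr_ge0 ?addr_ge0.
apply: le_trans; rewrite distrC.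
have -> : inner (u n) (v n) - inner x y = inner (u n - x) (v n) + inner x (v n - y).
  by rewrite innerBl innerBr addrA subrK.
apply: (le_trans (ler_normD _ _)); apply: lerD; last exact: cauchy_schwarz.
apply: (le_trans (cauchy_schwarz _ _)); rewrite ler_wpM2l//.
by rewrite -[X in `|X| <= _](subrK y); exact: ler_normD.
Qed.

End Hilbert.

Section Elementary.
Context {R : realType} {H : hilbertType R} {d} {T : measurableType d}.
Implicit Types (f g : T -> H) (c : T -> R) (h : H).

(* Finite combinations with measurable coefficients: unlike simple functions, they
   are visibly closed under multiplication by measurable scalars. *)
Inductive elementary : (T -> H) -> Prop :=
| elementary0 : elementary (fun=> 0)
| elementaryD c h g : measurable_fun setT c -> elementary g -> elementary (fun x => c x *: h + g x).

Lemma elementary_add f g : elementary f -> elementary g -> elementary (fun x => f x + g x).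
Proof.
move=> ef eg; elim: ef => [|c h f' mc ef' IH].
  by under eq_fun do rewrite add0r.
by under eq_fun do rewrite -addrA; exact: elementaryD.
Qed.

Lemma elementary_scale c f : measurable_fun setT c -> elementary f ->
  elementary (fun x => c x *: f x).
Proof.
move=> mc; elim=> [|c' h f' mc' ef' IH].
  by under eq_fun do rewrite scaler0; exact: elementary0.
under eq_fun do rewrite scalerDr scalerA.
by apply: (@elementaryD (fun x => c x * c' x)) => //; exact: measurable_funM.
Qed.

Lemma elementary_sum I (s : seq I) (F : I -> T -> H) :
  (forall i, elementary (F i)) -> elementary (fun x => \sum_(i <- s) F i x).
Proof.
move=> eF; elim: s => [|i s IH].
  by under eq_fun do rewrite big_nil; exact: elementary0.
by under eq_fun do rewrite big_cons; exact: elementary_add.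
Qed.

Lemma elementary_indic (A : set T) h : measurable A -> elementary (fun x => \1_A x *: h).
Proof.
move=> mA; have mI : measurable_fun setT (\1_A : T -> R) by exact: measurable_indic.
have := @elementaryD \1_A h _ mI elementary0.
by under eq_fun do rewrite addr0.
Qed.

Lemma measurable_inner_elementary f g : elementary f -> elementary g ->
  measurable_fun setT (fun x => inner (f x) (g x)).
Proof.
move=> ef eg; elim: ef => [|c h f' mc ef' IH].
  by under eq_fun do rewrite inner0l; exact: measurable_cst.
under eq_fun do rewrite innerDl innerZl.
apply: measurable_funD => //; apply: measurable_funM => //.
elim: eg => [|c' h' g' mc' eg' IHg].
  by under eq_fun do rewrite inner0r; exact: measurable_cst.
under eq_fun do rewrite innerDr innerZr.
by apply: measurable_funD => //; exact: measurable_funM.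
Qed.

(** Pointwise limits of elementary functions. This gives measurable inner products and norms without
    placing a sigma-algebra on [H] or assuming it separable. *)
Definition vmeasurable f := exists2 g : nat -> T -> H,
  (forall n, elementary (g n)) & (forall x, g n x @[n --> \oo] --> f x).

Lemma vmeasurable_cst h : vmeasurable (fun=> h).
Proof.
exists (fun _ _ => h); last by move=> x; exact: cvg_cst.
move=> _; have := @elementaryD (fun=> 1) h _ (measurable_cst _) elementary0.
by under eq_fun do rewrite addr0 scale1r.
Qed.

Lemma vmeasurableD f g : vmeasurable f -> vmeasurable g -> vmeasurable (fun x => f x + g x).
Proof.
move=> [f_ ef ff] [g_ eg gg]; exists (fun n x => f_ n x + g_ n x).
  by move=> n; exact: elementary_add.
by move=> x; exact: cvgD.
Qed.

Lemma vmeasurableZ c f : measurable_fun setT c -> vmeasurable f -> vmeasurable (fun x => c x *: f x).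
Proof.
move=> mc [f_ ef ff]; exists (fun n x => c x *: f_ n x).
  by move=> n; exact: elementary_scale.
by move=> x; exact: cvgZl_tmp.
Qed.

Lemma vmeasurableB f g : vmeasurable f -> vmeasurable g -> vmeasurable (fun x => f x - g x).
Proof.
move=> mf mg; apply: vmeasurableD => //.
by under eq_fun do rewrite -scaleN1r; exact: vmeasurableZ.
Qed.

Lemma measurable_inner f g : vmeasurable f -> vmeasurable g ->
  measurable_fun setT (fun x => inner (f x) (g x)).
Proof.
move=> [f_ ef ff] [g_ eg gg].
apply: (@measurable_fun_cvg _ _ _ _ (fun n x => inner (f_ n x) (g_ n x))).
  by move=> n; exact: measurable_inner_elementary.
by move=> x _; exact: inner_cvg.
Qed.

Lemma measurable_vnorm f : vmeasurable f -> measurable_fun setT (fun x => `|f x|).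
Proof.
move=> mf; have -> : (fun x => `|f x|) = (fun x => Num.sqrt (inner (f x) (f x))).
  by apply/funext => x; rewrite inner_norm sqrtr_sqr normr_id.
exact: measurable_funsqrt (measurable_inner mf mf).
Qed.

End Elementary.

Lemma vmeasurable_comp {R : realType} {H : hilbertType R} d1 d2 (T1 : measurableType d1)
    (T2 : measurableType d2) (f : T2 -> H) (j : T1 -> T2) :
  measurable_fun setT j -> vmeasurable f -> vmeasurable (f \o j).
Proof.
move=> mj [f_ ef ff]; exists (fun n x => f_ n (j x)); last by move=> x; exact: ff.
move=> n; elim: (ef n) => [|c h g mc eg IH]; first exact: elementary0.
by apply: (@elementaryD _ _ _ _ (c \o j)) => //; exact: measurableT_comp.
Qed.

(** * Simple approximation and construction of the vector integral *)

Section StronglyMeasurable.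
Context {R : realType} {H : hilbertType R} {d} {T : measurableType d}.

Lemma simple_sum (g : T -> H) : finite_set (range g) ->
  exists s : seq H, forall x, g x = \sum_(h <- s) \1_(g @^-1` [set h]) x *: h.
Proof.
(* Duplicates are removed because a value listed twice would be counted twice in the sum. *)
move=> /finite_seqP[s rs]; exists (undup s) => x.
have gs : g x \in undup s.
  have : range g (g x) by exists x.
  by rewrite rs/= mem_undup.
rewrite (bigD1_seq (g x)) ?undup_uniq//= indicE mem_set// scale1r big1 ?addr0//.
move=> h /eqP hg; rewrite indicE memNset ?scale0r//=.
by move=> /esym.
Qed.

Lemma strongly_vmeasurable (f : T -> H) : strongly_measurable f -> vmeasurable f.
Proof.
move=> [g [gfin gf]]; exists g => // n; have [fin mg] := gfin n.
have [s gE] := simple_sum fin.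
have -> : g n = fun x => \sum_(h <- s) \1_(g n @^-1` [set h]) x *: h by apply/funext.
by apply: elementary_sum => h; exact: elementary_indic.
Qed.

(** Values of norm above [K + 1] are replaced by 0. The limit is unaffected: approximants are
    eventually within 1 of [f x], whose norm is at most [K]. Dominated convergence then becomes
    applicable. *)
Lemma bounded_simple_approx (f : T -> H) (K : R) : strongly_measurable f ->
  (forall x, `|f x| <= K) ->
  exists (g : nat -> T -> H) (s : nat -> seq H),
    [/\ forall n x, `|g n x| <= K + 1, forall n h, measurable (g n @^-1` [set h]),
        forall n x, g n x = \sum_(h <- s n) \1_(g n @^-1` [set h]) x *: h &
        forall x, g n x @[n --> \oo] --> f x].
Proof.
move=> [g [gfin gf]] fK.
pose B n := [set x | `|g n x| <= K + 1].
have mB n : measurable (B n).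
  have [fin mg] := gfin n; have [s gE] := simple_sum fin.
  have : vmeasurable (g n).
    have -> : g n = fun x => \sum_(h <- s) \1_(g n @^-1` [set h]) x *: h by apply/funext.
    by exists (fun=> fun x => \sum_(h <- s) \1_(g n @^-1` [set h]) x *: h);
      [move=> _; apply: elementary_sum => h; exact: elementary_indic|move=> x; exact: cvg_cst].
  move=> /measurable_vnorm mn.
  by have := mn measurableT _ (measurable_itv `]-oo, K + 1]); rewrite setTI set_itvE.
pose g' n x := if `|g n x| <= K + 1 then g n x else 0.
have fin n : finite_set (range (g' n)).
  apply: (@sub_finite_set _ _ (range (g n) `|` [set 0])).
    move=> _ [x _ <-]; rewrite /g'; case: ifP => _; last by right.
    by left; exists x.
  by rewrite finite_setU; split; [exact: (gfin n).1|exact: finite_set1].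
have /choice[s sE] : forall n, exists s : seq H, forall x,
    g' n x = \sum_(h <- s) \1_(g' n @^-1` [set h]) x *: h.
  by move=> n; exact: simple_sum.
exists g', s; split.
- move=> n x; rewrite /g'; case: ifP => // _; rewrite normr0.
  by apply: addr_ge0 => //; apply: le_trans (fK point).
- move=> n h.
  have -> : g' n @^-1` [set h] = (B n `&` (g n @^-1` [set h])) `|` (~` B n `&` [set _ | h = 0]).
    apply/seteqP; split => [x|x]; rewrite /g' /B/=.
      by case: ifPn => [|/negP]; [left|right].
    by move=> [[-> ->]//|[/negP/negbTE -> ->]].
  apply: measurableU; apply: measurableI => //; first exact: (gfin n).2.
    exact: measurableC.
  have [h0|h0] := pselect (h = 0).
    by rewrite [X in measurable X](_ : _ = setT)//; apply/seteqP; split.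
  by rewrite [X in measurable X](_ : _ = set0)//; apply/seteqP; split.
- exact: sE.
- move=> x; apply: cvg_trans (gf x); apply: near_eq_cvg.
  have /cvgrPdist_le/(_ _ ltr01) := gf x; apply: filterS => n h.
  rewrite /g' ifT// -[g n x](subrK (f x)); apply: (le_trans (ler_normD _ _)).
  by rewrite distrC addrC lerD.
Qed.

End StronglyMeasurable.

Section HIntegral.
Context {R : realType} {H : hilbertType R} {d} {Y : measurableType d}.
Variables (m : probability Y R) (f : Y -> H) (K : R).
Variables (g : nat -> Y -> H) (s : nat -> seq H).
Hypothesis mf : strongly_measurable f.
Hypothesis fK : forall y, `|f y| <= K.
Hypothesis gK : forall n y, `|g n y| <= K + 1.
Hypothesis mg : forall n h, measurable (g n @^-1` [set h]).
Hypothesis gE : forall n y, g n y = \sum_(h <- s n) \1_(g n @^-1` [set h]) y *: h.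
Hypothesis gf : forall y, g n y @[n --> \oo] --> f y.

Definition simple_hintegral n : H :=
  \sum_(h <- s n) fine (m (g n @^-1` [set h])) *: h.

Let vmf : vmeasurable f. Proof. exact: strongly_vmeasurable. Qed.

Let vmg n : vmeasurable (g n).
Proof.
have -> : g n = fun y => \sum_(h <- s n) \1_(g n @^-1` [set h]) y *: h by apply/funext => y.
by exists (fun=> fun y => \sum_(h <- s n) \1_(g n @^-1` [set h]) y *: h);
  [move=> _; apply: elementary_sum => h; exact: elementary_indic|move=> x; exact: cvg_cst].
Qed.

Let bounded_inner x (u : Y -> H) M : vmeasurable u -> (forall y, `|u y| <= M) ->
  bounded_rv (fun y => inner x (u y)).
Proof.
move=> mu uM; split; first by apply: measurable_inner => //; exact: vmeasurable_cst.
by exists (`|x| * M) => y; apply: (le_trans (cauchy_schwarz _ _)); rewrite ler_wpM2l.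
Qed.

Let bounded_vnorm (u : Y -> H) M : vmeasurable u -> (forall y, `|u y| <= M) ->
  bounded_rv (fun y => `|u y|).
Proof.
move=> mu uM; split; first exact: measurable_vnorm.
by exists M => y; rewrite normr_id.
Qed.

Let vE x n : inner x (simple_hintegral n) = \int[m]_y inner x (g n y).
Proof.
rewrite inner_sumr.
have -> : (fun y => inner x (g n y)) =
    (fun y => \sum_(h <- s n) inner x h * \1_(g n @^-1` [set h]) y).
  apply/funext => y; rewrite [in LHS]gE inner_sumr; apply: eq_bigr => h _.
  by rewrite innerZr mulrC.
have bI h : bounded_rv (\1_(g n @^-1` [set h]) : Y -> R) by exact: bounded_rv_indic.
rewrite expectation_sum => [|h]; last first.
  by apply: integrable_rvZ; exact: bounded_rv_integrable.
apply: eq_bigr => h _; rewrite innerZr expectationZl// expectation_indic//.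
by rewrite mulrC.
Qed.

Let gfM n y : `|g n y - f y| <= K + 1 + K.
Proof. by apply: (le_trans (ler_normB _ _)); exact: lerD. Qed.

Let del n := \int[m]_y `|g n y - f y|.

Let vmgf n : vmeasurable (fun y => g n y - f y). Proof. exact: vmeasurableB. Qed.

Let del_cvg : del n @[n --> \oo] --> (0 : R).
Proof.
rewrite -[X in _ --> X](expectation_cst m).
apply: (@expectation_cvg _ _ _ _ _ _ (K + 1 + K)) => //.
- by move=> n; exact: measurable_vnorm.
- by apply: aeW => y n; rewrite normr_id.
- apply: aeW => y; suff : `|g n y - f y| @[n --> \oo] --> `|f y - f y| by rewrite subrr normr0.
  by apply: cvg_norm; apply: cvgB => //; exact: cvg_cst.
Qed.

(** Testing the difference [z] against itself gives [|z|^2] as the mean of an inner product with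
    [g n - g p]; Cauchy-Schwarz then leaves one factor [|z|] to cancel. *)
Let v_cauchy n p : `|simple_hintegral n - simple_hintegral p| <= del n + del p.
Proof.
set z := simple_hintegral n - simple_hintegral p.
have [->|z0] := eqVneq z 0.
  by rewrite normr0 addr_ge0// Rintegral_ge0.
have nz0 : 0 < `|z| by rewrite normr_gt0.
have bz q : bounded_rv (fun y => inner z (g q y)) by exact: bounded_inner.
have bn q : bounded_rv (fun y => `|g q y - f y|) by exact: bounded_vnorm.
rewrite -(ler_pM2l nz0) -expr2 -inner_norm {2}/z innerBr !vE -expectationB//.
rewrite -expectationD// -expectationZl; last exact: bounded_rvD.
apply: expectation_le; first exact: bounded_rvB.
  by apply: bounded_rvM; [exact: bounded_rv_cst|exact: bounded_rvD].
move=> y; rewrite -innerBr; apply: (le_trans (ler_norm _)).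
apply: (le_trans (cauchy_schwarz _ _)); rewrite ler_wpM2l//.
have -> : g n y - g p y = (g n y - f y) - (g p y - f y) by rewrite opprB addrA subrK.
exact: ler_normB.
Qed.

Let v_cvg : cvgn simple_hintegral.
Proof.
apply/cauchy_cvgP/cauchy_exP => e e0.
have e2 : 0 < e / 3 by rewrite divr_gt0.
have /cvgrPdist_le/(_ _ e2)[p _ pP] := del_cvg.
have delp n : (p <= n)%N -> del n <= e / 3.
  by move=> /pP; rewrite /= sub0r normrN; apply: le_trans; exact: ler_norm.
exists (simple_hintegral p); exists p => // n /= pn.
rewrite -ball_normE/=; apply: (le_lt_trans (v_cauchy _ _)).
by have := delp n pn; have := delp p (leqnn p); lra.
Qed.

(** [hintegral] is a chosen solution of the weak characterisation, so existence must be supplied: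
    completeness of [H] gives a limit [l], and testing against the difference of two solutions gives
    uniqueness. The approximants are parameters so that the scores can be integrated along the same
    sequence. *)
Lemma simple_hintegral_cvg :
  is_hintegral m f (hintegral m f) /\ simple_hintegral n @[n --> \oo] --> hintegral m f.
Proof.
pose l := limn simple_hintegral; have vl : simple_hintegral @ \oo --> l := v_cvg.
have Hl : is_hintegral m f l.
  move=> x; have bf : bounded_rv (fun y => inner x (f y)) by exact: bounded_inner.
  split; first exact: bounded_rv_integrable.
  have c1 : inner x (simple_hintegral n) @[n --> \oo] --> inner x l.
    by apply: inner_cvg vl; exact: cvg_cst.
  have c2 : \int[m]_y inner x (g n y) @[n --> \oo] --> \int[m]_y inner x (f y).
    apply: (@expectation_cvg _ _ _ _ _ _ (`|x| * (K + 1))).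
    - by move=> n; have [] := bounded_inner x (vmg n) (gK n).
    - by case: bf.
    - by apply: aeW => y n; apply: (le_trans (cauchy_schwarz _ _)); rewrite ler_wpM2l.
    - apply: aeW => y; have cx : (fun=> x) @ \oo --> x by exact: cvg_cst.
      exact: inner_cvg cx (@gf y).
  have vEf : (fun n => \int[m]_y inner x (g n y)) = (fun n => inner x (simple_hintegral n)).
    by apply/funext => n; rewrite vE.
  rewrite vEf in c2.
  exact: (cvg_unique (@Rhausdorff R) c1 c2).
have Hx : is_hintegral m f (hintegral m f) by apply: xgetPex; exists l.
suff <- : l = hintegral m f by [].
apply/eqP; rewrite -subr_eq0 -normr_eq0; set z := l - _.
have : inner z z = 0.
  by rewrite {2}/z innerBr; have [_ ->] := Hl z; have [_ ->] := Hx z; rewrite subrr.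
by rewrite inner_norm => /eqP; rewrite expf_eq0.
Qed.

End HIntegral.

(** * Conditional moments of adaptively collected scores *)

Section Filtration.
Context {R : realType} {dO dX dA dY} {Om : measurableType dO}
  {X : measurableType dX} {A : measurableType dA} {Y : measurableType dY}
  {H : hilbertType R}.
Variables (P : probability Om R) (PX : probability X R) (Q : R.-pker (X * A)%type ~> Y)
  (Pi : set (A -> X -> R)) (D : experiment Om X A Y H).
Hypotheses (hA : discrete_actions A) (hdata : adaptive_data P PX Q Pi D).
Variable phi : Y -> H.
Hypothesis hphi : strongly_measurable phi.

Definition gmeasurable (G : set (set Om)) d (T : measurableType d) (f : Om -> T) :=
  measurable_fun [set: g_sigma_algebraType G] (f : g_sigma_algebraType G -> T).

Definition vadapted (G : set (set Om)) (f : Om -> H) :=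
  @vmeasurable R H _ (g_sigma_algebraType G) f.

Implicit Types (G : set (set Om)) (s t n : nat) (b : A).

Lemma sub_sigma_generated G : (forall B, G B -> measurable B) -> sub_sigma G.
Proof. by move=> mG; apply: smallest_sub => //; exact: sigma_algebra_measurable. Qed.

Lemma vadapted_mono G G' f : <<s G >> `<=` <<s G' >> -> vadapted G f -> vadapted G' f.
Proof.
move=> GG' mf; apply: (@vmeasurable_comp _ _ _ _ (g_sigma_algebraType G')
  (g_sigma_algebraType G) f idfun _ mf).
by move=> _ B mB; rewrite setTI; exact: GG'.
Qed.

Lemma gmeasurable_sigma_of G d (T : measurableType d) (f : Om -> T) :
  sigma_of f `<=` G -> gmeasurable G f.
Proof. by move=> fG _ B mB; apply: sub_sigma_algebra; apply: fG; exists B. Qed.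

Lemma sigma_of_measurable d (T : measurableType d) (f : {mfun Om >-> T}) B :
  sigma_of f B -> measurable B.
Proof. by move=> [C mC <-]; exact: measurable_funP. Qed.

Lemma sub_sigma_hist t : sub_sigma (hist D t).
Proof.
apply: sub_sigma_generated => B [s _].
by move=> [[|]|]; exact: sigma_of_measurable.
Qed.

Lemma sub_sigma_histX t : sub_sigma (histX D t).
Proof.
apply: sub_sigma_generated => B [HB|]; last exact: sigma_of_measurable.
by apply: (@sub_sigma_hist t.-1); exact: sub_sigma_algebra.
Qed.

Lemma sub_sigma_histXA t : sub_sigma (histXA D t).
Proof.
apply: sub_sigma_generated => B [HB|]; last exact: sigma_of_measurable.
by apply: (@sub_sigma_histX t); exact: sub_sigma_algebra.
Qed.

Lemma hist_mono s t : (s <= t)%N -> <<s hist D s >> `<=` <<s hist D t >>.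
Proof.
move=> st; apply: sub_sigma_algebra2 => B [i /andP[i1 is'] HB].
by exists i => //=; rewrite i1 (leq_trans is').
Qed.

Lemma hist_histX t : <<s hist D t.-1 >> `<=` <<s histX D t >>.
Proof. by apply: sub_sigma_algebra2 => B; left. Qed.

Lemma histX_histXA t : <<s histX D t >> `<=` <<s histXA D t >>.
Proof. by apply: sub_sigma_algebra2 => B; left. Qed.

Lemma hist_ctx s t : (1 <= s <= t)%N -> gmeasurable (hist D t) (ctx D s).
Proof. by move=> st; apply: gmeasurable_sigma_of => B HB; exists s => //; left; left. Qed.

Lemma hist_act s t : (1 <= s <= t)%N -> gmeasurable (hist D t) (act D s).
Proof. by move=> st; apply: gmeasurable_sigma_of => B HB; exists s => //; left; right. Qed.

Lemma hist_out s t : (1 <= s <= t)%N -> gmeasurable (hist D t) (out D s).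
Proof. by move=> st; apply: gmeasurable_sigma_of => B HB; exists s => //; right. Qed.

Lemma histX_ctx t : gmeasurable (histX D t) (ctx D t).
Proof. by apply: gmeasurable_sigma_of => B HB; right. Qed.

Lemma histXA_act t : gmeasurable (histXA D t) (act D t).
Proof. by apply: gmeasurable_sigma_of => B HB; right. Qed.

Let gpair G t (x : Om -> X) : <<s hist D t >> `<=` <<s G >> -> gmeasurable G x ->
  measurable_fun [set: g_sigma_algebraType G]
    (fun w => (w : g_sigma_algebraType (hist D t), x w)).
Proof.
move=> sub mx; apply: (measurable_fun_pair (T1 := g_sigma_algebraType (hist D t))) => //.
by move=> _ B mB; rewrite setTI; exact: sub.
Qed.

Lemma gmeasurable_pol G t b (x : Om -> X) : (1 <= t)%N ->
  <<s hist D t.-1 >> `<=` <<s G >> -> gmeasurable G x ->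
  adapted G (fun w => pol D t w b (x w)).
Proof.
move=> t1 sub mx; have mp := policy_predictable hdata b t1.
exact: (measurableT_comp mp (gpair sub mx)).
Qed.

Lemma vadapted_muhat G t b (x : Om -> X) : (1 <= t)%N ->
  <<s hist D t.-1 >> `<=` <<s G >> -> gmeasurable G x ->
  vadapted G (fun w => muhat1 D t.-1 w b (x w)) /\ vadapted G (fun w => muhat2 D t.-1 w b (x w)).
Proof.
move=> t1 sub mx; have [m1 m2] := nuisance_predictable hdata b t1.
by split; [have := vmeasurable_comp (gpair sub mx) (strongly_vmeasurable m1)|
           have := vmeasurable_comp (gpair sub mx) (strongly_vmeasurable m2)].
Qed.

Lemma vadapted_phi G (y : Om -> Y) : gmeasurable G y -> vadapted G (phi \o y).
Proof. by move=> my; apply: vmeasurable_comp my _; exact: strongly_vmeasurable. Qed.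

Lemma measurable_action (B : set A) : measurable B. Proof. by case: hA => _; exact. Qed.

Lemma act_indic (c : Om -> A) b : (fun w => (c w == b)%:R) = \1_(c @^-1` [set b]) :> (Om -> R).
Proof.
apply/funext => w; rewrite indicE; congr (_%:R); congr nat_of_bool.
by apply/idP/idP; rewrite inE/= => /eqP.
Qed.

Lemma adapted_act G (c : Om -> A) b : gmeasurable G c -> adapted G (fun w => (c w == b)%:R : R).
Proof.
move=> mc; rewrite act_indic; apply: measurable_indic.
by have := mc measurableT [set b] (measurable_action _); rewrite setTI.
Qed.

(** Measurability of the policy is given for each fixed action; countability of the action set
    allows splitting by the value of the random action. *)
Lemma adapted_pol_act G t (x : Om -> X) (c : Om -> A) : (1 <= t)%N ->
  <<s hist D t.-1 >> `<=` <<s G >> -> gmeasurable G x -> gmeasurable G c ->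
  adapted G (fun w => pol D t w (c w) (x w)).
Proof.
move=> t1 sub mx mc _ B mB; rewrite setTI.
have -> : (fun w => pol D t w (c w) (x w)) @^-1` B =
    \bigcup_b ((c @^-1` [set b]) `&` (fun w => pol D t w b (x w)) @^-1` B).
  apply/seteqP; split => w /=; first by exists (c w).
  by move=> [b _ []/= <-].
apply: (@countable_bigcupT_measurable _ (g_sigma_algebraType G)); first by case: hA.
move=> b; apply: measurableI.
  by have := mc measurableT [set b] (measurable_action _); rewrite setTI.
by have := @gmeasurable_pol G t b x t1 sub mx measurableT B mB; rewrite setTI.
Qed.

Lemma vadapted_score G b (p : Om -> A -> X -> R) (m : Om -> A -> X -> H)
    (x : Om -> X) (c : Om -> A) (y : Om -> Y) :
  adapted G (fun w => p w b (x w)) -> vadapted G (fun w => m w b (x w)) ->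
  gmeasurable G c -> gmeasurable G y ->
  vadapted G (fun w => score phi (p w) (m w) b (x w) (c w) (y w)).
Proof.
move=> mp mm mc my; apply: vmeasurableD => //.
apply: (@vmeasurableZ _ _ _ (g_sigma_algebraType G) (fun w => (c w == b)%:R / p w b (x w))).
  by apply: measurable_funM; [exact: adapted_act|exact: measurable_funV].
by apply: vmeasurableB => //; exact: vadapted_phi.
Qed.

Variables (a a' : A) (u0 : H) (eps : nat -> R).
Hypothesis hu0 : `|u0| = 1.

Lemma vadapted_phihat t : (1 <= t)%N ->
  vadapted (hist D t) (phihat phi D a a' (muhat1 D) t) /\
  vadapted (hist D t) (phihat phi D a a' (muhat2 D) t).
Proof.
move=> t1; have sub : <<s hist D t.-1 >> `<=` <<s hist D t >> by apply: hist_mono; exact: leq_pred.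
have tt : (1 <= t <= t)%N by rewrite t1 leqnn.
have mx := hist_ctx tt; have mc := hist_act tt; have my := hist_out tt.
have mp b := gmeasurable_pol b t1 sub mx.
have mm b := vadapted_muhat b t1 sub mx.
by split; apply: vmeasurableB; apply: vadapted_score => //; [have [] := mm a|have [] := mm a'|have [] := mm a|have [] := mm a'].
Qed.

Lemma vmeasurable_sum_in d (T : measurableType d) (I : eqType) (s : seq I) (F : I -> T -> H) :
  (forall i, i \in s -> vmeasurable (F i)) -> vmeasurable (fun x => \sum_(i <- s) F i x).
Proof.
elim: s => [|i s IH] mF.
  by under eq_fun do rewrite big_nil; exact: vmeasurable_cst.
under eq_fun do rewrite big_cons.
apply: vmeasurableD; first by apply: mF; rewrite mem_head.
by apply: IH => j js; apply: mF; rewrite inE js orbT.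
Qed.

Lemma measurable_sum_in d (T : measurableType d) (I : eqType) (s : seq I) (F : I -> T -> R) :
  (forall i, i \in s -> measurable_fun setT (F i)) ->
  measurable_fun setT (fun x => \sum_(i <- s) F i x).
Proof.
elim: s => [|i s IH] mF.
  by under eq_fun do rewrite big_nil; exact: measurable_cst.
under eq_fun do rewrite big_cons.
apply: measurable_funD; first by apply: mF; rewrite mem_head.
by apply: IH => j js; apply: mF; rewrite inE js orbT.
Qed.

Lemma vadapted_pilot_direction n : vadapted (hist D n) (pilot_direction phi D a a' u0 n).
Proof.
have mv : vadapted (hist D n) (pilot_witness phi D a a' n).
  apply: vmeasurableZ; first exact: measurable_cst.
  apply: vmeasurable_sum_in => t; rewrite mem_index_iota ltnS => /andP[t1 tn].
  by have [m1 _] := vadapted_phihat t1; apply: vadapted_mono m1; exact: hist_mono.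
have mn := measurable_vnorm mv.
(* The case distinction becomes a sum of measurable scalars times vectors: when the witness is 0 the
   second term vanishes and only [u0] remains. *)
have -> : pilot_direction phi D a a' u0 n = fun w =>
    (if `|pilot_witness phi D a a' n w| == 0 then 1 else 0 : R) *: u0 +
    `|pilot_witness phi D a a' n w|^-1 *: pilot_witness phi D a a' n w.
  apply/funext => w; rewrite /pilot_direction normr_eq0; case: eqP => [->|_].
    by rewrite scaler0 addr0 scale1r.
  by rewrite scale0r add0r.
apply: vmeasurableD; last by apply: vmeasurableZ => //; exact: measurable_funV.
apply: (@vmeasurableZ _ _ _ (g_sigma_algebraType (hist D n))
  (fun w => if `|pilot_witness phi D a a' n w| == 0 then 1 else 0)); last exact: vmeasurable_cst.
by apply: measurable_fun_ifT => //; exact: measurable_fun_eqr.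
Qed.

Lemma norm_pilot_direction n w : `|pilot_direction phi D a a' u0 n w| = 1.
Proof.
rewrite /pilot_direction; case: eqP => // /eqP v0.
by rewrite normrZ normfV normr_id mulVf// normr_eq0.
Qed.

Lemma adapted_xi n t : (1 <= t)%N -> (n <= t)%N -> adapted (hist D t) (xi phi D a a' u0 n t).
Proof.
move=> t1 nt; have [_ m2] := vadapted_phihat t1.
apply: measurable_inner m2.
by have := vadapted_mono (hist_mono nt) (vadapted_pilot_direction n).
Qed.

(** The estimator evaluates the predictable [pi_t] at contexts and actions of rounds before [t];
    with [n < t] the pilot direction is known as well. *)
Lemma adapted_sigmahat2 n t : (n < t)%N ->
  adapted (hist D t.-1) (sigmahat2 phi D a a' u0 n t).
Proof.
move=> nt; have t1 : (1 <= t)%N by exact: leq_ltn_trans nt.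
have mw : vadapted (hist D t.-1) (pilot_direction phi D a a' u0 n).
  by apply: vadapted_mono (vadapted_pilot_direction n); apply: hist_mono; rewrite -ltnS prednK.
have mM j : adapted (hist D t.-1) (Mhat phi D a a' u0 j n t).
  apply: measurable_funM; first exact: measurable_cst.
  apply: measurable_sum_in => s; rewrite mem_index_iota => /andP[ns st].
  have s1 : (1 <= s)%N by exact: leq_ltn_trans ns.
  have ss : (1 <= s <= t.-1)%N by rewrite s1 -ltnS prednK.
  have mx := hist_ctx ss; have mc := hist_act ss; have my := hist_out ss.
  have sub : <<s hist D s.-1 >> `<=` <<s hist D t.-1 >>.
    by apply: hist_mono; rewrite -!subn1 leq_sub2r// ltnW.
  apply: measurable_funM.
    apply: measurable_funM; first exact: adapted_pol_act.
    by apply: measurable_funV; exact: adapted_pol_act.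
  apply: measurable_funX; apply: measurable_inner mw _.
  apply: vmeasurableB; apply: vadapted_score => //.
  - exact: gmeasurable_pol.
  - by have [] := vadapted_muhat a s1 sub mx.
  - exact: gmeasurable_pol.
  - by have [] := vadapted_muhat a' s1 sub mx.
rewrite /sigmahat2 /Mhat1 /Mhat2.
case: (t == n.+1); first exact: measurable_cst.
apply: measurable_maxr; last exact: measurable_cst.
apply: measurable_funB; first exact: (mM 2).
have := @measurable_funX _ (g_sigma_algebraType (hist D t.-1)) R setT _ 2 (mM 1%N).
exact.
Qed.

End Filtration.

(** * Inverse-propensity identities along the filtration *)

Section CondMoments.
Context {R : realType} {dO dX dA dY} {Om : measurableType dO}
  {X : measurableType dX} {A : measurableType dA} {Y : measurableType dY}
  {H : hilbertType R}.
Variables (P : probability Om R) (PX : probability X R) (Q : R.-pker (X * A)%type ~> Y)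
  (Pi : set (A -> X -> R)) (D : experiment Om X A Y H).
Hypotheses (hA : discrete_actions A) (hdata : adaptive_data P PX Q Pi D).

Notation integrable_rv f := (P.-integrable setT (EFin \o f)).

Lemma sigma_of_generated d (T : measurableType d) (f : {mfun Om >-> T}) B :
  <<s sigma_of f >> B -> exists2 C, measurable C & B = f @^-1` C.
Proof.
rewrite sigma_algebra_id; last by apply: sigma_algebra_preimage; exact: sigma_algebra_measurable.
by move=> [C mC <-]; exists C => //; rewrite setTI.
Qed.

Lemma ctx_law t B : (1 <= t)%N -> measurable B -> P (ctx D t @^-1` B) = PX B.
Proof.
move=> t1 mB; have sT : <<s hist D t.-1 >> [set: Om].
  by have := @measurableT _ (g_sigma_algebraType (hist D t.-1)).
by have := context_law hdata t1 mB sT; rewrite setIT probability_setT mule1.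
Qed.

Lemma expectation_ctx t (g : X -> R) : (1 <= t)%N -> bounded_rv g ->
  \int[P]_w g (ctx D t w) = \int[PX]_x g x.
Proof.
move=> t1 bg; have mg := proj1 bg.
have bgc : bounded_rv (fun w => g (ctx D t w)).
  by case: bg => _ [M gM]; split; [exact: measurableT_comp|exists M => w].
congr fine.
rewrite [RHS](eq_measure_integral (distribution P (ctx D t))); last first.
  by move=> B mB _; exact: (esym (ctx_law t1 mB)).
rewrite integral_distribution//; first exact/measurable_EFinP.
exact: bounded_rv_integrable.
Qed.

(** Independence is given on rectangles. Fixing a history event [E], its conditional probability
    given the context is constant, which handles [g]; thus [g] of the context has constant
    conditional expectation given the history, which handles [h]. *)
Lemma expectation_ctx_indep t (h : Om -> R) (g : X -> R) M : (1 <= t)%N ->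
  adapted (hist D t.-1) h -> {ae P, forall w, `|h w| <= M} -> bounded_rv g ->
  \int[P]_w (h w * g (ctx D t w)) = \int[P]_w h w * \int[PX]_x g x.
Proof.
move=> t1 mh hM bg; have mg := proj1 bg.
have sG := @sub_sigma_hist _ _ _ _ _ _ _ _ _ _ D t.-1.
have sX : sub_sigma (sigma_of (ctx D t)).
  by apply: sub_sigma_generated => B; exact: sigma_of_measurable.
have bgc : bounded_rv (fun w => g (ctx D t w)).
  by case: bg => _ [N gN]; split; [exact: measurableT_comp|exists N => w].
have gadap : adapted (sigma_of (ctx D t)) (fun w => g (ctx D t w)).
  move=> _ B mB; rewrite setTI; apply: sub_sigma_algebra.
  exists (g @^-1` B); last by rewrite setTI.
  by have := mg measurableT B mB; rewrite setTI.
have indE E : <<s hist D t.-1 >> E ->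
    is_cond_exp P (sigma_of (ctx D t)) \1_E (fun=> fine (P E)).
  move=> GE; have mE := sG _ GE; split.
  - exact: measurable_cst.
  - exact: integrable_rv_cst.
  - move=> B /sigma_of_generated[C mC ->].
    have mctx : measurable (ctx D t @^-1` C).
      by rewrite -[X in measurable X]setTI; exact: measurable_funP.
    have e : P (E `&` ctx D t @^-1` C) = (PX C * P E)%E.
      by rewrite setIC; exact: (context_law hdata t1 mC GE).
    rewrite [LHS]integral_cst// [RHS]integral_indic//.
    transitivity (PX C * P E)%E; last exact: (esym e).
    by rewrite fineK ?fin_num_measure// muleC; congr (_ * _)%E; exact: ctx_law.
have condE : is_cond_exp P (hist D t.-1) (fun w => g (ctx D t w)) (fun=> \int[PX]_x g x).
  split; [exact: measurable_cst|exact: integrable_rv_cst|].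
  move=> E GE; have mE := sG _ GE.
  have [N gN] := proj2 bgc.
  have := cond_exp_pull sX (bounded_rv_integrable P (bounded_rv_indic mE)) (indE E GE) gadap (aeW _ gN).
  have -> : (fun w => g (ctx D t w) * \1_E w) = (fun w => \1_E w * g (ctx D t w)).
    by apply/funext => w; rewrite mulrC.
  rewrite -integral_indicM.
  have -> : (fun w => g (ctx D t w) * fine (P E)) = (fun w => fine (P E) * g (ctx D t w)).
    by apply/funext => w; rewrite mulrC.
  rewrite expectationZl// expectation_ctx// => e.
  rewrite -(@fineK _ (\int[P]_(w in E) (g (ctx D t w))%:E)%E); last first.
    by apply: integrable_fin_num => //; apply: integrableS (bounded_rv_integrable P bgc).
  rewrite -[X in (_ = X%:E)%E]/(\int[P]_(w in E) g (ctx D t w)) e.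
  rewrite [LHS]integral_cst// mulrC EFinM; congr (_ * _)%E.
  by rewrite fineK// fin_num_measure.
rewrite (cond_exp_pull sG (bounded_rv_integrable P bgc) condE mh hM).
rewrite RintegralZr//; apply: ae_bounded_integrable hM; exact: adapted_measurable mh.
Qed.

Lemma expectation_act t b (h : Om -> R) M : (1 <= t)%N ->
  adapted (histX D t) h -> {ae P, forall w, `|h w| <= M} ->
  \int[P]_w (h w * (act D t w == b)%:R) = \int[P]_w (h w * pol D t w b (ctx D t w)).
Proof.
move=> t1 mh hM; have sG := @sub_sigma_histX _ _ _ _ _ _ _ _ _ _ D t.
have mE : measurable (act D t @^-1` [set b]).
  by rewrite -[X in measurable X]setTI; apply: measurable_funP => //; exact: measurable_action.
have mh' := adapted_measurable sG mh.
have bE := bounded_rv_integrable P (bounded_rv_indic mE).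
have cE := cond_expP sG bE.
have -> : (fun w => h w * (act D t w == b)%:R) = (fun w => h w * \1_(act D t @^-1` [set b]) w).
  by apply/funext => w; rewrite -act_indic.
rewrite (cond_exp_pull sG bE cE mh hM).
have mc := adapted_measurable sG (let: And3 m _ _ := cE in m).
apply: expectation_ae_eq.
- exact: measurable_funM.
- apply: measurable_funM => //; apply: (adapted_measurable sG).
  by apply: (gmeasurable_pol hdata b t1) => //; [exact: hist_histX|exact: histX_ctx].
- by apply: filterS (action_law hdata b t1) => w; rewrite /cond_prob => ->.
Qed.

Let mQ C b : measurable C -> bounded_rv (fun x : X => fine (Q (x, b) C)).
Proof.
move=> mC; split.
  apply: measurableT_comp => //.
  exact: (measurableT_comp (measurable_kernel Q _ mC) (pair2_measurable b)).
exists 1 => x; rewrite ger0_norm ?fine_ge0//.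
have Q1 : (Q (x, b) C <= 1)%E.
  by rewrite -(@prob_kernel _ _ _ _ _ Q (x, b)) le_measure ?inE.
by rewrite -lee_fin fineK// ge0_fin_numE//; apply: le_lt_trans Q1 _; rewrite ltry.
Qed.

Lemma expectation_out t C (h : Om -> R) M : (1 <= t)%N -> measurable C ->
  adapted (histXA D t) h -> {ae P, forall w, `|h w| <= M} ->
  \int[P]_w (h w * \1_(out D t @^-1` C) w) = \int[P]_w (h w * fine (Q (ctx D t w, act D t w) C)).
Proof.
move=> t1 mC mh hM; have sG := @sub_sigma_histXA _ _ _ _ _ _ _ _ _ _ D t.
have mE : measurable (out D t @^-1` C).
  by rewrite -[X in measurable X]setTI; apply: measurable_funP.
have mh' := adapted_measurable sG mh.
have bE := bounded_rv_integrable P (bounded_rv_indic mE).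
have cE := cond_expP sG bE.
rewrite (cond_exp_pull sG bE cE mh hM).
have mc := adapted_measurable sG (let: And3 m _ _ := cE in m).
apply: expectation_ae_eq.
- exact: measurable_funM.
- apply: measurable_funM => //; apply: measurableT_comp => //.
  apply: (measurableT_comp (measurable_kernel Q _ mC)).
  by apply: measurable_fun_pair; exact: measurable_funP.
- by apply: filterS (outcome_cond_law hdata t1 mC) => w <-.
Qed.

(* The floor holds [PX]-almost everywhere for almost every history; the context of
   round [t] is independent of the history, so Fubini applies. *)
Lemma pol_ctx_ge t b (c : R) : (1 <= t)%N ->
  {ae P, forall w, {ae PX, forall x, c <= pol D t w b x}} ->
  {ae P, forall w, c <= pol D t w b (ctx D t w)}.
Proof.
move=> t1 hc.
pose G := hist D t.-1.
pose idG : Om -> g_sigma_algebraType G := idfun.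
have sG : sub_sigma G := @sub_sigma_hist _ _ _ _ _ _ _ _ _ _ D t.-1.
have midG : measurable_fun setT idG by move=> _ B mB; rewrite setTI; exact: sG.
pose idG_mfun : {mfun Om >-> g_sigma_algebraType G} :=
  HB.pack idG (isMeasurableFun.Build _ _ _ _ idG midG).
pose mu : probability (g_sigma_algebraType G) R := distribution P idG_mfun.
pose j w : g_sigma_algebraType G * X := (idG w, ctx D t w).
have mj : measurable_fun setT j by exact: measurable_fun_pair.
pose j_mfun : {mfun Om >-> (g_sigma_algebraType G * X)%type} :=
  HB.pack j (isMeasurableFun.Build _ _ _ _ j mj).
pose nu : probability (g_sigma_algebraType G * X)%type R := distribution P j_mfun.
pose B : set (g_sigma_algebraType G * X) := [set z | pol D t z.1 b z.2 < c].
have mB : measurable B.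
  have mp := policy_predictable hdata b t1.
  by have := mp measurableT _ (measurable_itv `]-oo, c[); rewrite setTI set_itvE.
(* [context_law] identifies the joint law of history and context with the product measure on
   rectangles, hence on every measurable set. *)
have jB : (mu \x PX)%E B = nu B.
  apply: product_measure_unique => // E F mE mF.
  transitivity (P (ctx D t @^-1` F `&` E)); first by rewrite setIC.
  by rewrite muleC; exact: (context_law hdata t1 mF mE).
have nuB : nu B = 0%E.
  rewrite -jB /product_measure1.
  have mx : measurable_fun setT (PX \o xsection B) by exact: measurable_fun_xsection.
  rewrite (@ge0_integral_pushforward _ _ _ _ R idG midG P setT (PX \o xsection B) measurableT mx)//.
  rewrite preimage_setT (ae_eq_integral (fun=> 0%E))//.
  - by rewrite integral0.
  - exact: (measurableT_comp mx midG).
  - apply: filterS hc => w hw _ /=.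
    have mxB : measurable (xsection B w) by exact: measurable_xsection.
    apply: measure_negligible => //; case: hw => N [mN N0 cN].
    exists N; split => // x; rewrite /xsection/= inE/= => Bx; apply: cN => /= cx.
    by move: Bx; rewrite /B/= ltNge cx.
exists (j @^-1` B); split.
- by rewrite -[X in measurable X]setTI; exact: (mj measurableT B mB).
- exact: nuB.
- by move=> w /= /negP; rewrite -ltNge.
Qed.

(** Given history and context, the action indicator averages to the propensity and cancels the
    denominator; the floor [c] makes the quotient an admissible bounded test function. *)
Lemma expectation_ipw t b (h : Om -> R) M (c : R) : (1 <= t)%N -> 0 < c ->
  {ae P, forall w, c <= pol D t w b (ctx D t w)} ->
  adapted (histX D t) h -> {ae P, forall w, `|h w| <= M} ->
  \int[P]_w (h w / pol D t w b (ctx D t w) * (act D t w == b)%:R) = \int[P]_w h w.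
Proof.
move=> t1 c0 hc mh hM; have sG := @sub_sigma_histX _ _ _ _ _ _ _ _ _ _ D t.
pose p w := pol D t w b (ctx D t w).
have mp : adapted (histX D t) p.
  by apply: (gmeasurable_pol hdata b t1) => //; [exact: hist_histX|exact: histX_ctx].
have mhp : adapted (histX D t) (fun w => h w / p w).
  by apply: measurable_funM => //; exact: measurable_funV.
have hpM : {ae P, forall w, `|h w / p w| <= M / c}.
  apply: filterS2 hM hc => w hM cp; have p0 : 0 < p w := lt_le_trans c0 cp.
  by rewrite normrM normfV (gtr0_norm p0) ler_pM ?invr_ge0 ?(ltW p0)// lef_pV2 ?posrE.
rewrite (expectation_act b t1 mhp hpM); apply: expectation_ae_eq.
- by apply: (adapted_measurable sG); exact: measurable_funM.
- exact: adapted_measurable mh.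
- apply: filterS hc => w cp; rewrite divfK// gt_eqF//.
  exact: lt_le_trans cp.
Qed.

(** The three sources of randomness are integrated out in reverse order: the outcome, then the
    action, then the context. *)
Lemma expectation_ipw_out t b (V : Om -> R) M (c : R) C : (1 <= t)%N -> 0 < c ->
  {ae P, forall w, c <= pol D t w b (ctx D t w)} ->
  adapted (hist D t.-1) V -> {ae P, forall w, `|V w| <= M} -> measurable C ->
  \int[P]_w (V w / pol D t w b (ctx D t w) * (act D t w == b)%:R * \1_(out D t @^-1` C) w) =
  \int[P]_w V w * fine (outcome_law PX Q b C).
Proof.
move=> t1 c0 hc mV VM mC.
have sX := @sub_sigma_histX _ _ _ _ _ _ _ _ _ _ D t.
pose p w := pol D t w b (ctx D t w).
have mVX : adapted (histX D t) V := adapted_mono (@hist_histX _ _ _ _ _ _ _ _ _ _ D t) mV.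
have mp : adapted (histX D t) p.
  by apply: (gmeasurable_pol hdata b t1) => //; [exact: hist_histX|exact: histX_ctx].
have mVp : adapted (histX D t) (fun w => V w / p w).
  by apply: measurable_funM => //; exact: measurable_funV.
have M0 : 0 <= `|M| by [].
have VpM : {ae P, forall w, `|V w / p w| <= M / c}.
  apply: filterS2 VM hc => w hM cp; have p0 : 0 < p w := lt_le_trans c0 cp.
  by rewrite normrM normfV (gtr0_norm p0) ler_pM ?invr_ge0 ?(ltW p0)// lef_pV2 ?posrE.
pose h w := V w / p w * (act D t w == b)%:R.
have mh : adapted (histXA D t) h.
  apply: measurable_funM; first exact: adapted_mono (@histX_histXA _ _ _ _ _ _ _ _ _ _ D t) mVp.
  by apply: adapted_act => //; exact: histXA_act.
have hM : {ae P, forall w, `|h w| <= M / c}.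
  apply: filterS VpM => w; apply: le_trans; rewrite normrM ler_piMr// ger0_norm//.
  by rewrite lern1 leq_b1.
rewrite (expectation_out t1 mC mh hM).
have [mq [q1 qM]] := mQ b mC.
pose q w := fine (Q (ctx D t w, b) C).
have mqX : adapted (histX D t) q by exact: (measurableT_comp mq (@histX_ctx _ _ _ _ _ _ _ _ _ _ D t)).
(* The indicator of [act D t w == b] allows the observed action in the kernel to be replaced by [b],
   which makes the remaining factor known before the action is drawn. *)
have -> : (fun w => h w * fine (Q (ctx D t w, act D t w) C)) =
    (fun w => V w * q w / pol D t w b (ctx D t w) * (act D t w == b)%:R).
  apply/funext => w; rewrite /h /q /p; case: eqP => [->|_]; last by rewrite !mulr0 mul0r.
  by rewrite !mulr1 mulrAC.
have VqM : {ae P, forall w, `|V w * q w| <= M * q1}.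
  by apply: filterS VM => w VM; rewrite normrM ler_pM//; exact: qM.
have mVq : adapted (histX D t) (fun w => V w * q w) by exact: measurable_funM.
rewrite (expectation_ipw t1 c0 hc mVq VqM).
rewrite (expectation_ctx_indep t1 mV VM (mQ b mC)); congr (_ * fine _).
apply: eq_integral => x _; rewrite fineK// ge0_fin_numE//.
apply: (@le_lt_trans _ _ (Q (x, b) setT)); first by rewrite le_measure ?inE.
by rewrite prob_kernel ltry.
Qed.

Variables (phi : Y -> H) (K : R).
Hypotheses (hphi : strongly_measurable phi) (phiK : forall y, `|phi y| <= K).

Let outcome_lawT b : outcome_law PX Q b setT = 1%E.
Proof.
rewrite /outcome_law; under eq_integral do rewrite prob_kernel.
by rewrite [LHS]integral_cst// mul1e; exact: (probability_setT PX).
Qed.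

Definition outcome_prob b : probability Y R :=
  HB.pack (outcome_law PX Q b) (Measure_isProbability.Build _ _ _ (outcome_law PX Q b) (outcome_lawT b)).

(** For a simple function in place of [phi], each value [h] contributes an instance of
    [expectation_ipw_out] with test variable [V * inner W h]. Both sides then pass to the limit, the
    left by domination and the right because [simple_hintegral] converges to [eta]. *)
Lemma expectation_ipw_phi t b (V : Om -> R) (W : Om -> H) M (c : R) : (1 <= t)%N -> 0 < c ->
  {ae P, forall w, c <= pol D t w b (ctx D t w)} ->
  adapted (hist D t.-1) V -> (forall w, `|V w| <= M) ->
  vadapted (hist D t.-1) W -> (forall w, `|W w| = 1) ->
  \int[P]_w (V w / pol D t w b (ctx D t w) * (act D t w == b)%:R * inner (W w) (phi (out D t w))) =
  \int[P]_w (V w * inner (W w) (eta PX Q phi b)).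
Proof.
move=> t1 c0 hc mV VM mW W1.
have sG := @sub_sigma_hist _ _ _ _ _ _ _ _ _ _ D t.-1.
have [g [s [gK mg gE gf]]] := bounded_simple_approx hphi phiK.
have [_ vcvg] := simple_hintegral_cvg (outcome_prob b) hphi phiK gK mg gE gf.
pose v n := simple_hintegral (outcome_prob b) g s n.
have K0 : 0 <= K by apply: le_trans (phiK point).
have M0 : 0 <= M by apply: le_trans (VM point).
pose p w := pol D t w b (ctx D t w).
have mp : measurable_fun setT p.
  apply: (adapted_measurable (@sub_sigma_histX _ _ _ _ _ _ _ _ _ _ D t)).
  by apply: (gmeasurable_pol hdata b t1) => //; [exact: hist_histX|exact: histX_ctx].
have mI : measurable_fun setT (fun w => (act D t w == b)%:R : R).
  rewrite act_indic; apply: measurable_indic.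
  by rewrite -[X in measurable X]setTI; apply: measurable_funP => //; exact: measurable_action.
have mV' := adapted_measurable sG mV.
have mW' : vmeasurable W.
  apply: (@vmeasurable_comp _ _ _ _ Om (g_sigma_algebraType (hist D t.-1)) W idfun _ mW).
  by move=> _ B mB; rewrite setTI; exact: sG.
pose I w := V w / p w * (act D t w == b)%:R.
have mIw : measurable_fun setT I.
  by apply: measurable_funM => //; apply: measurable_funM => //; exact: measurable_funV.
have IM : {ae P, forall w, `|I w| <= M / c}.
  apply: filterS hc => w cp; have p0 : 0 < p w := lt_le_trans c0 cp.
  rewrite /I normrM; apply: (@le_trans _ _ (`|V w / p w|)).
    by rewrite ler_piMr// ger0_norm// lern1 leq_b1.
  by rewrite normrM normfV (gtr0_norm p0) ler_pM ?invr_ge0 ?(ltW p0)// lef_pV2 ?posrE.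
have mgout n : vmeasurable (fun w => g n (out D t w)).
  have -> : (fun w => g n (out D t w)) =
      (fun y => \sum_(h <- s n) \1_(g n @^-1` [set h]) y *: h) \o out D t.
    by apply/funext => w; rewrite /= [in LHS]gE.
  apply: vmeasurable_comp; first exact: measurable_funP.
  by exists (fun=> fun y => \sum_(h <- s n) \1_(g n @^-1` [set h]) y *: h);
    [move=> _; apply: elementary_sum => h; exact: elementary_indic|move=> x; exact: cvg_cst].
have mphiout : vmeasurable (phi \o out D t).
  by apply: vmeasurable_comp; [exact: measurable_funP|exact: strongly_vmeasurable].
have cL : \int[P]_w (I w * inner (W w) (g n (out D t w))) @[n --> \oo] -->
    \int[P]_w (I w * inner (W w) (phi (out D t w))).
  apply: (@expectation_cvg _ _ _ _ _ _ (M / c * (K + 1))).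
  - by move=> n; apply: measurable_funM => //; exact: measurable_inner.
  - by apply: measurable_funM => //; apply: measurable_inner => //.
  - apply: filterS IM => w IM n; rewrite normrM ler_pM//.
    by apply: (le_trans (cauchy_schwarz _ _)); rewrite W1 mul1r.
  - apply: aeW => w; apply: cvgM; first exact: cvg_cst.
    have cW : (fun=> W w) @ \oo --> W w by exact: cvg_cst.
    exact: inner_cvg cW (@gf (out D t w)).
have bVW h : bounded_rv (fun w => V w * inner (W w) h).
  split.
    by apply: measurable_funM => //; apply: measurable_inner => //; exact: vmeasurable_cst.
  exists (M * `|h|) => w; rewrite normrM ler_pM//.
  by apply: (le_trans (cauchy_schwarz _ _)); rewrite W1 mul1r.
have cR : \int[P]_w (V w * inner (W w) (v n)) @[n --> \oo] -->
    \int[P]_w (V w * inner (W w) (eta PX Q phi b)).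
  apply/cvgrPdist_le => e e0.
  (* The denominator is [M + 1] because [M] may be 0. *)
  have e1 : 0 < e / (M + 1) by rewrite divr_gt0// ltr_pwDr.
  have /cvgrPdist_le/(_ _ e1) := vcvg; apply: filterS => n hn.
  rewrite -expectationB//; apply: le_trans (_ : M * (e / (M + 1)) <= _); last first.
    by rewrite mulrCA ler_piMr ?(ltW e0)// ler_pdivrMr ?ltr_pwDr// mul1r lerDl.
  rewrite -[leRHS](expectation_cst P); apply: expectation_abs_le.
  - exact: bounded_rvB.
  - exact: bounded_rv_cst.
  - move=> w; rewrite -mulrBr -innerBr normrM ler_pM//.
    by apply: (le_trans (cauchy_schwarz _ _)); rewrite W1 mul1r.
have eqn n : \int[P]_w (I w * inner (W w) (g n (out D t w))) = \int[P]_w (V w * inner (W w) (v n)).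
  have mC h : measurable (g n @^-1` [set h]) by exact: mg.
  have mVWh h : adapted (hist D t.-1) (fun w => V w * inner (W w) h).
    by apply: measurable_funM => //; apply: measurable_inner => //; exact: vmeasurable_cst.
  have bVWh h : {ae P, forall w, `|V w * inner (W w) h| <= M * `|h|}.
    apply: aeW => w; rewrite normrM ler_pM//.
    by apply: (le_trans (cauchy_schwarz _ _)); rewrite W1 mul1r.
  have E h := expectation_ipw_out t1 c0 hc (mVWh h) (bVWh h) (mC h).
  have -> : (fun w => I w * inner (W w) (g n (out D t w))) = (fun w => \sum_(h <- s n)
      (V w * inner (W w) h / pol D t w b (ctx D t w) * (act D t w == b)%:R *
       \1_(out D t @^-1` (g n @^-1` [set h])) w)).
    apply/funext => w; rewrite gE inner_sumr mulr_sumr; apply: eq_bigr => h _.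
    rewrite innerZr /I /p.
    have -> : \1_(out D t @^-1` (g n @^-1` [set h])) w = \1_(g n @^-1` [set h]) (out D t w) :> R by [].
    by ring.
  rewrite expectation_sum => [|h].
    have -> : (fun w => V w * inner (W w) (v n)) = (fun w => \sum_(h <- s n)
        (fine (outcome_law PX Q b (g n @^-1` [set h])) * (V w * inner (W w) h))).
      apply/funext => w; rewrite inner_sumr mulr_sumr; apply: eq_bigr => h _.
      by rewrite innerZr mulrCA.
    rewrite expectation_sum => [|h]; last by apply: integrable_rvZ; exact: bounded_rv_integrable.
    by apply: eq_bigr => h _; rewrite E expectationZl// mulrC.
  have -> : (fun w => V w * inner (W w) h / pol D t w b (ctx D t w) * (act D t w == b)%:R *
       \1_(out D t @^-1` (g n @^-1` [set h])) w) =
       (fun w => (inner (W w) h * \1_(out D t @^-1` (g n @^-1` [set h])) w) * I w).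
    by apply/funext => w; rewrite /I /p; ring.
  have mout : measurable (out D t @^-1` (g n @^-1` [set h])).
    by rewrite -[X in measurable X]setTI; exact: measurable_funP.
  apply: (@integrable_rvM _ _ _ _ _ _ `|h|).
  - apply: measurable_funM; last exact: measurable_indic.
    by apply: measurable_inner => //; exact: vmeasurable_cst.
  - exact: ae_bounded_integrable IM.
  - apply: aeW => w; rewrite normrM; apply: (@le_trans _ _ (`|inner (W w) h|)).
      by rewrite ler_piMr// ger0_norm indicE// lern1 leq_b1.
    by apply: (le_trans (cauchy_schwarz _ _)); rewrite W1 mul1r.
have eqf : (fun n => \int[P]_w (I w * inner (W w) (g n (out D t w)))) =
   (fun n => \int[P]_w (V w * inner (W w) (v n))) by apply/funext.
rewrite eqf in cL.
exact: (cvg_unique (@Rhausdorff R) cL cR).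
Qed.

End CondMoments.

(** * Conditional mean and variance of the projected score *)

Section ScoreMoments.
Context {R : realType} {dO dX dA dY} {Om : measurableType dO}
  {X : measurableType dX} {A : measurableType dA} {Y : measurableType dY}
  {H : hilbertType R}.
Variables (P : probability Om R) (PX : probability X R) (Q : R.-pker (X * A)%type ~> Y)
  (Pi : set (A -> X -> R)) (D : experiment Om X A Y H).
Hypotheses (hA : discrete_actions A) (hdata : adaptive_data P PX Q Pi D).
Variables (phi : Y -> H) (K B : R).
Hypotheses (hphi : strongly_measurable phi) (phiK : forall y, `|phi y| <= K).
Hypothesis muB : {ae P, forall w, forall t b x, (1 <= t)%N -> `|muhat2 D t.-1 w b x| <= B}.

Notation integrable_rv f := (P.-integrable setT (EFin \o f)).

Let sc t b w := score phi (pol D t w) (muhat2 D t.-1 w) b (ctx D t w) (act D t w) (out D t w).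

Let vadapted_sc t b : (1 <= t)%N -> vadapted (hist D t) (sc t b).
Proof.
move=> t1; have sub : <<s hist D t.-1 >> `<=` <<s hist D t >>.
  by apply: hist_mono; exact: leq_pred.
have tt : (1 <= t <= t)%N by rewrite t1 leqnn.
have mx : gmeasurable (hist D t) (ctx D t) by exact: hist_ctx.
have mc : gmeasurable (hist D t) (act D t) by exact: hist_act.
have my : gmeasurable (hist D t) (out D t) by exact: hist_out.
apply: vadapted_score => //; first exact: (gmeasurable_pol hdata b t1 sub mx).
by have [] := vadapted_muhat hdata b t1 sub mx.
Qed.

Lemma score_norm_le t b (c : R) : (1 <= t)%N -> 0 < c ->
  {ae P, forall w, c <= pol D t w b (ctx D t w)} ->
  {ae P, forall w, `|sc t b w| <= (K + B) / c + B}.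
Proof.
move=> t1 c0 hc; apply: filterS2 hc muB => w hc /(_ t b (ctx D t w) t1) mB.
have p0 : 0 < pol D t w b (ctx D t w) := lt_le_trans c0 hc.
apply: (le_trans (ler_normD _ _)); apply: lerD => //.
rewrite normrZ mulrC ler_pM//.
  by apply: (le_trans (ler_normB _ _)); exact: lerD.
rewrite normrM normfV (gtr0_norm p0); apply: (@le_trans _ _ (pol D t w b (ctx D t w))^-1).
  by rewrite ler_piMl ?invr_ge0 ?(ltW p0)// ger0_norm// lern1 leq_b1.
by rewrite lef_pV2 ?posrE.
Qed.

(** The nuisance value [m] depends on the history and context only, so by [expectation_ipw] its
    inverse-propensity-weighted copy has the same mean as [m] itself. The two cancel, and the
    outcome term yields [eta]. *)
Lemma score_mean t b (V : Om -> R) (W : Om -> H) M (c : R) : (1 <= t)%N -> 0 < c ->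
  {ae P, forall w, c <= pol D t w b (ctx D t w)} ->
  adapted (hist D t.-1) V -> (forall w, `|V w| <= M) ->
  vadapted (hist D t.-1) W -> (forall w, `|W w| = 1) ->
  \int[P]_w (V w * inner (W w) (sc t b w)) = \int[P]_w (V w * inner (W w) (eta PX Q phi b)).
Proof.
move=> t1 c0 hc mV VM mW W1.
have M0 : 0 <= M by apply: le_trans (VM point).
have sX := @sub_sigma_histX _ _ _ _ _ _ _ _ _ _ D t.
have sH := @sub_sigma_hist _ _ _ _ _ _ _ _ _ _ D t.
pose p w := pol D t w b (ctx D t w).
pose I w : R := (act D t w == b)%:R.
pose m w := muhat2 D t.-1 w b (ctx D t w).
have mpX : adapted (histX D t) p.
  by apply: (gmeasurable_pol hdata b t1) => //; [exact: hist_histX|exact: histX_ctx].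
have mp := adapted_measurable sX mpX.
have mI : measurable_fun setT I.
  rewrite /I act_indic; apply: measurable_indic.
  by rewrite -[X in measurable X]setTI; apply: measurable_funP => //; exact: measurable_action.
have mmX : vadapted (histX D t) m.
  by have [] := vadapted_muhat hdata b t1 (@hist_histX _ _ _ _ _ _ _ _ _ _ D t)
    (@histX_ctx _ _ _ _ _ _ _ _ _ _ D t).
have mWX := vadapted_mono (@hist_histX _ _ _ _ _ _ _ _ _ _ D t) mW.
have mVX := adapted_mono (@hist_histX _ _ _ _ _ _ _ _ _ _ D t) mV.
have mq : adapted (histX D t) (fun w => V w * inner (W w) (m w)).
  by apply: measurable_funM => //; exact: measurable_inner.
have qM : {ae P, forall w, `|V w * inner (W w) (m w)| <= M * B}.
  apply: filterS muB => w /(_ t b (ctx D t w) t1) mB; rewrite normrM ler_pM//.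
  by apply: (le_trans (cauchy_schwarz _ _)); rewrite W1 mul1r.
have mq' := adapted_measurable sX mq.
have intq : integrable_rv (fun w => V w * inner (W w) (m w)) by exact: ae_bounded_integrable qM.
have IpM : {ae P, forall w, `|I w / p w| <= c^-1}.
  apply: filterS hc => w cp; have p0 : 0 < p w := lt_le_trans c0 cp.
  rewrite normrM normfV (gtr0_norm p0); apply: (@le_trans _ _ (p w)^-1).
    by rewrite ler_piMl ?invr_ge0 ?(ltW p0)// ger0_norm// lern1 leq_b1.
  by rewrite lef_pV2 ?posrE.
have mIp : measurable_fun setT (fun w => I w / p w).
  by apply: measurable_funM => //; exact: measurable_funV.
have intIq : integrable_rv (fun w => (V w * inner (W w) (m w)) / p w * I w).
  have -> : (fun w => (V w * inner (W w) (m w)) / p w * I w) =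
      (fun w => (I w / p w) * (V w * inner (W w) (m w))) by apply/funext => w; ring.
  exact: integrable_rvM intq IpM.
have mout : vmeasurable (phi \o out D t).
  by apply: vmeasurable_comp; [exact: measurable_funP|exact: strongly_vmeasurable].
have mW' : vmeasurable W.
  apply: (@vmeasurable_comp _ _ _ _ Om (g_sigma_algebraType (histX D t)) W idfun _ mWX).
  by move=> _ C mC; rewrite setTI; exact: sX.
have mV' := adapted_measurable sX mVX.
have intphi : integrable_rv (fun w => V w / p w * I w * inner (W w) (phi (out D t w))).
  have -> : (fun w => V w / p w * I w * inner (W w) (phi (out D t w))) =
      (fun w => (I w / p w) * (V w * inner (W w) (phi (out D t w)))).
    by apply/funext => w; ring.
  apply: (integrable_rvM mIp _ IpM); apply: (@ae_bounded_integrable _ _ _ _ _ (M * K)).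
    by apply: measurable_funM => //; exact: measurable_inner.
  apply: aeW => w; rewrite normrM ler_pM//.
  by apply: (le_trans (cauchy_schwarz _ _)); rewrite W1 mul1r.
have -> : (fun w => V w * inner (W w) (sc t b w)) =
    (fun w => V w / p w * I w * inner (W w) (phi (out D t w)) -
       (V w * inner (W w) (m w)) / p w * I w + V w * inner (W w) (m w)).
  by apply/funext => w; rewrite /sc /score innerDr innerZr innerBr -/(p w) -/(m w) -/(I w); ring.
rewrite RintegralD//; last exact: integrable_rvB.
rewrite RintegralB// (expectation_ipw hA hdata t1 c0 hc mq qM) subrK.
exact: (expectation_ipw_phi hA hdata hphi phiK t1 c0 hc mV VM mW W1).
Qed.

Variables (a a' : A) (u0 : H).
Hypothesis hu0 : `|u0| = 1.
Hypothesis eta_eq : eta PX Q phi a = eta PX Q phi a'.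

Variables (n t : nat) (c : R).
Hypotheses (nt : (n < t)%N) (c0 : 0 < c).
Hypothesis hc : forall b, {ae P, forall w, c <= pol D t w b (ctx D t w)}.

Let t1 : (1 <= t)%N. Proof. exact: leq_ltn_trans nt. Qed.
Let ntp : (n <= t.-1)%N. Proof. by rewrite -ltnS prednK. Qed.

Let xit := xi phi D a a' u0 n t.
Let Bxi := 2 * ((K + B) / c + B).

Let xitE w : xit w = inner (pilot_direction phi D a a' u0 n w) (sc t a w) -
                     inner (pilot_direction phi D a a' u0 n w) (sc t a' w).
Proof. by rewrite /xit /xi /phihat /contrast innerBr. Qed.

Lemma xi_bound : {ae P, forall w, `|xit w| <= Bxi}.
Proof.
apply: filterS2 (score_norm_le t1 c0 (hc a)) (score_norm_le t1 c0 (hc a')) => w s1 s2.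
have dirE : `|pilot_direction phi D a a' u0 n w| = 1 by exact: norm_pilot_direction hu0 _ _.
rewrite xitE; apply: (le_trans (ler_normB _ _)).
rewrite /Bxi mulrDl mul1r; apply: lerD; apply: (le_trans (cauchy_schwarz _ _)).
  by rewrite dirE mul1r; exact: s1.
by rewrite dirE mul1r; exact: s2.
Qed.

Lemma measurable_xi : measurable_fun setT xit.
Proof.
apply: (adapted_measurable (@sub_sigma_hist _ _ _ _ _ _ _ _ _ _ D t)).
exact: (adapted_xi hA hdata hphi a a' u0 t1 (ltnW nt)).
Qed.

Lemma xi_mean0 (V : Om -> R) M : adapted (hist D t.-1) V -> (forall w, `|V w| <= M) ->
  \int[P]_w (V w * xit w) = 0.
Proof.
move=> mV VM; pose W := pilot_direction phi D a a' u0 n.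
have mW : vadapted (hist D t.-1) W.
  apply: (vadapted_mono (hist_mono ntp)); exact: (vadapted_pilot_direction hA hdata hphi).
have W1 w : `|W w| = 1 by exact: norm_pilot_direction.
have sH := @sub_sigma_hist _ _ _ _ _ _ _ _ _ _ D t.
have subt : <<s hist D t.-1 >> `<=` <<s hist D t >> by apply: hist_mono; exact: leq_pred.
have M0 : 0 <= M by apply: le_trans (VM point).
have int b : integrable_rv (fun w => V w * inner (W w) (sc t b w)).
  apply: (@ae_bounded_integrable _ _ _ _ _ (M * ((K + B) / c + B))).
    apply: (adapted_measurable sH); apply: measurable_funM.
      exact: adapted_mono mV.
    apply: measurable_inner; first exact: vadapted_mono mW.
    exact: vadapted_sc.
  apply: filterS (score_norm_le t1 c0 (hc b)) => w sw; rewrite normrM.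
  apply: (ler_pM (normr_ge0 _) (normr_ge0 _) (VM w)).
  by apply: (le_trans (cauchy_schwarz _ _)); rewrite W1 mul1r; exact: sw.
have -> : (fun w => V w * xit w) =
    (fun w => V w * inner (W w) (sc t a w) - V w * inner (W w) (sc t a' w)).
  by apply/funext => w; rewrite xitE mulrBr.
rewrite (RintegralB measurableT (int a) (int a')).
rewrite (score_mean t1 c0 (hc a) mV VM mW W1) (score_mean t1 c0 (hc a') mV VM mW W1).
by rewrite eta_eq subrr.
Qed.

(** [cond_var] centres by the chosen version of the conditional expectation; that this version
    vanishes almost surely makes [sigma0 ^+ 2] a conditional second moment. *)
Lemma xi_cond_exp0 : {ae P, forall w, cond_exp P (hist D t.-1) xit w = 0}.
Proof.
have sG := @sub_sigma_hist _ _ _ _ _ _ _ _ _ _ D t.-1.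
have intx : integrable_rv xit by exact: ae_bounded_integrable measurable_xi xi_bound.
apply: (cond_exp_eq0 sG intx (cond_expP sG intx)) => h mh h01.
apply: (xi_mean0 mh (M := 1)) => w.
by have /andP[? ?] := h01 w; rewrite ger0_norm.
Qed.

Let rsq w := (xit w - cond_exp P (hist D t.-1) xit w) ^+ 2.

Let intx : integrable_rv xit.
Proof. exact: ae_bounded_integrable measurable_xi xi_bound. Qed.

Let sG : sub_sigma (hist D t.-1). Proof. exact: sub_sigma_hist. Qed.

Let mce : measurable_fun setT (cond_exp P (hist D t.-1) xit).
Proof. by have [m _ _] := cond_expP sG intx; exact: adapted_measurable m. Qed.

Let mrsq : measurable_fun setT rsq.
Proof.
by apply: (@measurable_funX _ _ _ setT _ 2); exact: (measurable_funB measurable_xi mce).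
Qed.

Let rsqM : {ae P, forall w, `|rsq w| <= Bxi ^+ 2}.
Proof.
apply: filterS2 xi_bound xi_cond_exp0 => w xB x0.
rewrite /rsq x0 subr0 normrX.
exact: (lerXn2r 2 (normr_ge0 _) (le_trans (normr_ge0 _) xB) xB).
Qed.

Let intrsq : integrable_rv rsq. Proof. exact: ae_bounded_integrable mrsq rsqM. Qed.

Let cv := cond_var P (hist D t.-1) xit.

Let cvP : is_cond_exp P (hist D t.-1) rsq cv. Proof. exact: cond_expP. Qed.

Lemma adapted_sigma0 : adapted (hist D t.-1) (sigma0 P phi D a a' u0 n t).
Proof. by have [m _ _] := cvP; exact: measurable_funsqrt. Qed.

(** The chosen conditional variance is nonnegative only almost surely, so squaring the square root
    recovers it only there. *)
Lemma sigma0_sqr : {ae P, forall w,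
  sigma0 P phi D a a' u0 n t w ^+ 2 = cv w /\ 0 <= cv w <= Bxi ^+ 2}.
Proof.
have c1 : {ae P, forall w, 0 <= cv w}.
  by apply: (cond_exp_ge0 sG intrsq cvP); apply: aeW => w; exact: sqr_ge0.
have c2 : {ae P, forall w, cv w <= Bxi ^+ 2}.
  apply: (cond_exp_le sG intrsq cvP); apply: filterS rsqM => w.
  by apply: le_trans; exact: ler_norm.
apply: filterS2 c1 c2 => w h1 h2; split; first exact: sqr_sqrtr h1.
by apply/andP; split; [exact: h1|exact: h2].
Qed.

Lemma xi_sqr_mean (V : Om -> R) M : adapted (hist D t.-1) V -> (forall w, `|V w| <= M) ->
  \int[P]_w (V w * xit w ^+ 2) = \int[P]_w (V w * sigma0 P phi D a a' u0 n t w ^+ 2).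
Proof.
move=> mV VM; have mV' := adapted_measurable sG mV.
have [mc _ _] := cvP; have mc' := adapted_measurable sG mc.
transitivity (\int[P]_w (V w * rsq w)).
  apply: expectation_ae_eq.
  - exact: measurable_funM mV' (@measurable_funX _ _ _ setT _ 2 measurable_xi).
  - exact: measurable_funM.
  - by apply: filterS xi_cond_exp0 => w x0; rewrite /rsq x0 subr0.
rewrite (cond_exp_pull sG intrsq cvP mV (aeW _ VM)).
apply: expectation_ae_eq.
- exact: measurable_funM.
- apply: (measurable_funM mV' (@measurable_funX _ _ _ setT _ 2 _)).
  exact: adapted_measurable adapted_sigma0.
- by apply: filterS sigma0_sqr => w [-> _].
Qed.

End ScoreMoments.

(** * The studentized statistic *)

Section Rates.
Context {R : realType}.

Lemma powR_natN_cvg0 (g : R) : 0 < g -> n%:R `^ (- g) @[n --> \oo] --> (0 : R).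
Proof.
move=> g0; apply/cvgrPdist_le => e e0.
near=> n; rewrite sub0r normrN ger0_norm ?powR_ge0// powRN.
have n0 : (0 : R) < n%:R by rewrite ltr0n; near: n; exact: nbhs_infty_gt.
have : e^-1 <= n%:R `^ g.
  have -> : e^-1 = (e^-1 `^ g^-1) `^ g.
    by rewrite -powRrM mulVf ?gt_eqF// powRr1// invr_ge0 ltW.
  apply: ge0_ler_powR; rewrite ?nnegrE ?powR_ge0 ?ltW//.
  by near: n; exact: nbhs_infty_gtr.
by move=> h; rewrite -[e]invrK lef_pV2// posrE ?powR_gt0// invr_gt0.
Unshelve. all: by end_near. Qed.

(** Unclipped, the denominator is [v >= e ^+ 2]. Clipped with [s > 2 * e], one has
    [v < e ^+ 2 <= s ^+ 2], so replacing [v] by [e ^+ 2] only moves it towards [s ^+ 2]. Clipped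
    with [s <= 2 * e], the ratio lies in [[0, 4]], hence the constant 4. *)
Lemma ratio_clip (s v e : R) : 0 < e -> 0 <= s -> 0 <= v ->
  `|s ^+ 2 / (Num.max (Num.sqrt v) e) ^+ 2 - 1| <=
  e ^- 2 * `|v - s ^+ 2| + 4 * (s <= 2 * e)%R%:R.
Proof.
move=> e0 s0 v0; have e20 : 0 < e ^+ 2 by exact: exprn_gt0.
have b0 : 0 <= 4 * (s <= 2 * e)%R%:R :> R by rewrite mulr_ge0// ler0n.
have h (x : R) : 0 < x -> e ^+ 2 <= x -> `|s ^+ 2 - x| <= `|v - s ^+ 2| ->
    `|s ^+ 2 / x - 1| <= e ^- 2 * `|v - s ^+ 2| + 4 * (s <= 2 * e)%R%:R.
  move=> x0 ex sx; apply: ler_wpDr b0 _.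
  have -> : s ^+ 2 / x - 1 = x^-1 * (s ^+ 2 - x) by field; rewrite gt_eqF.
  rewrite normrM ler_pM// gtr0_norm ?invr_gt0//.
  by rewrite lef_pV2 ?posrE.
have [es|se] := leP e (Num.sqrt v).
  have ev : e ^+ 2 <= v.
    by rewrite -(sqr_sqrtr v0) ler_pXn2r// nnegrE ?(ltW e0) ?sqrtr_ge0.
  by rewrite sqr_sqrtr//; apply: h => //; [exact: lt_le_trans ev|rewrite distrC].
have ve : v < e ^+ 2.
  by rewrite -(sqr_sqrtr v0) ltr_pXn2r// nnegrE ?(ltW e0) ?sqrtr_ge0.
have [s2|s2] := leP s (2 * e); last first.
  have := h _ e20 (lexx _); rewrite (leNgt s) s2/=; apply.
  have : e ^+ 2 <= s ^+ 2 by rewrite ler_pXn2r ?nnegrE ?ltW//; lra.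
  move=> es; rewrite ger0_norm ?subr_ge0// distrC ger0_norm; lra.
rewrite mulr1; apply: (@le_trans _ _ 4); last by rewrite lerDr mulr_ge0// invr_ge0 ltW.
have : 0 <= s ^+ 2 / e ^+ 2 <= 4.
  rewrite divr_ge0 ?sqr_ge0//= ler_pdivrMr//.
  have -> : 4 * e ^+ 2 = (2 * e) ^+ 2 by ring.
  by rewrite ler_pXn2r ?nnegrE// mulr_ge0// ltW.
by move=> /andP[r0 r4]; rewrite ler_norml; apply/andP; split; lra.
Qed.

End Rates.

(** * Convergence in probability *)

Section ConvergenceInProbability.
Context {R : realType} {d} {Om : measurableType d} (P : probability Om R).
Implicit Types Z : nat -> Om -> R.

Lemma bigO_as_bounded Z r : bigO_as P (fun n w => (Z n w)%:E) r ->
  {ae P, forall w, exists M, \forall n \near \oo, `|Z n w| * (r n)^-1 <= M}.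
Proof.
apply: filterS => w; rewrite /limn_esup /limf_esup => /ereal_inf_lt[_ [V Vo <-] supV].
have [M VM] : exists M : R, forall n, V n -> `|Z n w| * (r n)^-1 <= M.
  have ub n : V n -> ((`|Z n w| * (r n)^-1)%:E <= 
     ereal_sup [set (`|(Z n w)%:E| * (r n)^-1%:E)%E | n in V])%E.
    by move=> Vn; apply: ereal_sup_ubound; exists n.
  move: supV ub; case: (ereal_sup _) => // [x|] _ ub.
    by exists x => n Vn; have := ub n Vn; rewrite lee_fin.
  by exists 0 => n /ub; rewrite leeNy_eq.
by exists M; apply: filterS Vo => n; exact: VM.
Qed.

(** Dominated convergence for the indicators of the deviation events. *)
Lemma cvg_as_in_probability0 Z : (forall n, measurable_fun setT (Z n)) ->
  {ae P, forall w, Z n w @[n --> \oo] --> (0 : R)} -> cvg_in_probability0 P Z.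
Proof.
move=> mZ Z0 e e0; pose S n := [set w | e < `|Z n w|].
have mS n : measurable (S n).
  rewrite -[S n]setTI; have -> : S n = (fun w => `|Z n w|) @^-1` `]e, +oo[.
    by apply/seteqP; split => w /=; rewrite in_itv/= andbT.
  apply: measurableT_comp (mZ n) _ _ _ => //.
have h : \int[P]_w \1_(S n) w @[n --> \oo] --> \int[P]_w (cst (0 : R)) w.
  apply: (@expectation_cvg _ _ _ _ _ _ 1) => //.
  - by move=> n; exact: measurable_indic.
  - by apply: aeW => w n; rewrite indicE ger0_norm ?ler0n// lern1 leq_b1.
  - apply: filterS Z0 => w /cvgrPdist_le/(_ e e0) Zw; apply: cvg_near_cst.
    apply: filterS Zw => n; rewrite sub0r normrN => Ze; rewrite indicE memNset// /S/=.
    by apply/negP; rewrite -leNgt.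
rewrite expectation_cst in h.
have -> : (fun n => P (S n)) = (fun n => (\int[P]_w \1_(S n) w)%:E).
  by apply/funext => n; rewrite expectation_indic// fineK// fin_num_measure.
by apply/cvg_EFin => //; exact: nearW.
Qed.

Lemma cvg_in_probability0_le Z Z1 Z2 :
  (forall n, [/\ measurable_fun setT (Z n), measurable_fun setT (Z1 n) &
                 measurable_fun setT (Z2 n)]) ->
  (\forall n \near \oo, {ae P, forall w, `|Z n w| <= `|Z1 n w| + `|Z2 n w|}) ->
  cvg_in_probability0 P Z1 -> cvg_in_probability0 P Z2 -> cvg_in_probability0 P Z.
Proof.
move=> mZ leZ c1 c2 e e0; have e2 : 0 < e / 2 by rewrite divr_gt0.
have mS (f : Om -> R) (x : R) : measurable_fun setT f -> measurable [set w | x < `|f w|].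
  move=> mf; rewrite -[X in measurable X]setTI.
  have -> : [set w | x < `|f w|] = (fun w => `|f w|) @^-1` `]x, +oo[.
    by apply/seteqP; split => w /=; rewrite in_itv/= andbT.
  apply: measurableT_comp mf _ _ _ => //.
have c12 : (P [set w | (e / 2 < `|Z1 n w|)%R] + P [set w | (e / 2 < `|Z2 n w|)%R])%E
    @[n --> \oo] --> 0%E.
  by rewrite -[X in _ --> X]adde0; apply: cvgeD; [|exact: c1|exact: c2].
apply: (squeeze_cvge _ (cvg_cst 0%E) c12).
apply: filterS leZ => n [N [mN N0 subN]]; rewrite measure_ge0/=.
have [mZn m1 m2] := mZ n.
apply: (@le_trans _ _ (P (N `|` ([set w | e / 2 < `|Z1 n w|] `|` [set w | e / 2 < `|Z2 n w|])))).
  apply: le_measure; rewrite ?inE; [exact: mS| by do 2?apply: measurableU => //; exact: mS|].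
  move=> w /= eZ; have [Nw|Nw] := pselect (N w); [by left|right].
  have : `|Z n w| <= `|Z1 n w| + `|Z2 n w|.
    by apply: contrapT => h; apply: Nw; exact: subN.
  move=> h; have [h1|h1] := ltP (e / 2) `|Z1 n w|; [by left|right => /=].
  lra.
apply: (le_trans (measureU2 _ _ _)) => //; first by apply: measurableU; exact: mS.
rewrite -[leRHS]add0e; apply: leeD; last by apply: measureU2; exact: mS.
by have := lexx (0 : \bar R)%E; rewrite -{1}N0.
Qed.

End ConvergenceInProbability.

Section WeightedDifference.
Context {R : realType} {d} {Om : measurableType d} (P : probability Om R).
Variables (G G' : set (set Om)) (x v q : Om -> R) (B L : R).
Hypotheses (sG' : sub_sigma G') (GG' : <<s G >> `<=` <<s G' >>).
Hypotheses (mx : adapted G' x) (mv : adapted G v) (mq : adapted G q).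
Hypotheses (B0 : 0 <= B) (xB : {ae P, forall w, `|x w| <= B}).
Hypotheses (v0 : forall w, 0 <= v w) (vB : {ae P, forall w, v w <= B ^+ 2}).
Hypothesis qL : forall w, 0 <= q w <= L.
Hypothesis mean0 : forall V M, adapted G V -> (forall w, `|V w| <= M) ->
  \int[P]_w (V w * x w) = 0.
Hypothesis var : forall V M, adapted G V -> (forall w, `|V w| <= M) ->
  \int[P]_w (V w * x w ^+ 2) = \int[P]_w (V w * v w).

(* Truncation at the almost sure bounds turns them into everywhere bounds. *)
Lemma weighted_mart_diff : mart_diff P G G' (L * B) (fun w => clamp (L * B) (q w * x w))
  (fun w => Num.min (q w ^+ 2 * v w) ((L * B) ^+ 2)).
Proof.
have sG : sub_sigma G by move=> C /GG'; exact: sG'.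
have q0 w : 0 <= q w by have /andP[] := qL w.
have qle w : q w <= L by have /andP[] := qL w.
have L0 : 0 <= L := le_trans (q0 point) (qle point).
have LB0 : 0 <= L * B by exact: mulr_ge0.
have qxM : {ae P, forall w, `|q w * x w| <= L * B}.
  by apply: filterS xB => w wB; rewrite normrM ler_pM// ger0_norm.
have mx' := adapted_measurable sG' mx.
have mq' := adapted_measurable sG mq.
have mv' := adapted_measurable sG mv.
have mqx : measurable_fun setT (fun w => q w * x w) by exact: measurable_funM.
have mcl := measurable_clamp (L * B) mqx.
have mq2 : adapted G (fun w => q w ^+ 2) by exact: (@measurable_funX _ _ _ setT _ 2).
have mx2 : measurable_fun setT (fun w => x w ^+ 2) by exact: (@measurable_funX _ _ _ setT _ 2).
have mcl2 : measurable_fun setT (fun w => clamp (L * B) (q w * x w) ^+ 2).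
  exact: (@measurable_funX _ _ _ setT _ 2).
have mqv : adapted G (fun w => Num.min (q w ^+ 2 * v w) ((L * B) ^+ 2)).
  by apply: measurable_minr => //; exact: measurable_funM.
split => //.
- by apply: measurable_clamp; apply: measurable_funM => //; exact: adapted_mono mq.
- by move=> w; exact: clamp_bound.
- by move=> w; rewrite le_min ge_min lexx orbT mulr_ge0 ?sqr_ge0.
- move=> h mh [M hM]; have mh' := adapted_measurable sG mh.
  (* Almost surely the clamp is inactive; the predictable weight [q] then joins the test
     function. *)
  transitivity (\int[P]_w ((h w * q w) * x w)).
    apply: expectation_ae_eq.
    + exact: measurable_funM.
    + by apply: measurable_funM => //; exact: measurable_funM.
    + by apply: filterS qxM => w qB; rewrite clamp_id// mulrA.
  apply: (@mean0 _ (M * L)); first exact: measurable_funM.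
  by move=> w; rewrite normrM ler_pM// ger0_norm.
- move=> h mh [M hM]; have mh' := adapted_measurable sG mh.
  have mhq : adapted G (fun w => h w * q w ^+ 2) by exact: measurable_funM.
  have mhq' := adapted_measurable sG mhq.
  transitivity (\int[P]_w ((h w * q w ^+ 2) * x w ^+ 2)).
    apply: expectation_ae_eq.
    + exact: measurable_funM.
    + exact: measurable_funM.
    + by apply: filterS qxM => w qB; rewrite clamp_id// exprMn mulrA.
  rewrite (@var _ (M * L ^+ 2) mhq); last first.
    by move=> w; rewrite normrM ler_pM// normrX ger0_norm// ler_pXn2r// nnegrE.
  apply: expectation_ae_eq.
  + exact: measurable_funM.
  + by apply: measurable_funM => //; exact: adapted_measurable mqv.
  + apply: filterS vB => w wB; rewrite min_l ?mulrA//.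
    by rewrite exprMn ler_pM// ?sqr_ge0// ler_pXn2r// nnegrE.
Qed.

End WeightedDifference.

(** * Limit theorem for an abstract studentized array *)

Section StudentizedCLT.
Context {R : realType} {d} {Om : measurableType d} (P : probability Om R).

Lemma prob_le_ae_eq (f g : Om -> R) y : measurable_fun setT f -> measurable_fun setT g ->
  {ae P, forall w, f w = g w} -> P [set w | f w <= y] = P [set w | g w <= y].
Proof.
move=> mf mg fg.
have ms (h : Om -> R) : measurable_fun setT h -> measurable [set w | h w <= y].
  move=> mh; rewrite -[X in measurable X]setTI.
  have -> : [set w | h w <= y] = h @^-1` `]-oo, y].
    by apply/seteqP; split => w /=; rewrite in_itv.
  exact: mh.
have fin C : measurable C -> (fine (P C))%:E = P C by move=> mC; rewrite fineK// fin_num_measure.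
rewrite -fin; last exact: ms.
rewrite -[RHS]fin; last exact: ms.
rewrite -!expectation_indic; [|exact: ms..].
congr (_%:E); apply: expectation_ae_eq.
- by apply: measurable_indic; exact: ms.
- by apply: measurable_indic; exact: ms.
- apply: filterS fg => w fgw; rewrite !indicE; congr (_%:R); congr nat_of_bool.
  by apply/idP/idP; rewrite !inE/= fgw.
Qed.

Lemma sum_second_half n (f : nat -> R) :
  \sum_(n.+1 <= t < n.*2.+1) f t = \sum_(i < n) f (n + i).+1.
Proof.
rewrite -{1}[n.+1]add0n big_addn subSS -addnn addnK big_mkord.
by apply: eq_bigr => i _; rewrite addnS addnC.
Qed.

Variables (F : nat -> set (set Om)) (x s v : nat -> nat -> Om -> R) (eps B : nat -> R).
Hypotheses (sF : forall t, sub_sigma (F t))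
  (monoF : forall t, <<s F t.-1 >> `<=` <<s F t >>).
Hypothesis mx : forall n t, (n < t)%N -> adapted (F t) (x n t).
Hypothesis ms : forall n t, (n < t <= n.*2)%N -> adapted (F t.-1) (s n t).
Hypothesis mv : forall n t, (n < t)%N -> adapted (F t.-1) (v n t).
Hypotheses (s0 : forall n t w, 0 <= s n t w) (v0 : forall n t w, 0 <= v n t w).
Hypotheses (B0 : forall n, 0 <= B n) (eps0 : forall n, (0 < n)%N -> 0 < eps n).
Hypothesis xB : forall n t, (n < t <= n.*2)%N -> {ae P, forall w, `|x n t w| <= B n}.
Hypothesis sB : forall n t, (n < t <= n.*2)%N -> {ae P, forall w, s n t w ^+ 2 <= B n ^+ 2}.
Hypothesis mean0 : forall n t V M, (n < t <= n.*2)%N -> adapted (F t.-1) V ->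
  (forall w, `|V w| <= M) -> \int[P]_w (V w * x n t w) = 0.
Hypothesis var : forall n t V M, (n < t <= n.*2)%N -> adapted (F t.-1) V ->
  (forall w, `|V w| <= M) -> \int[P]_w (V w * x n t w ^+ 2) = \int[P]_w (V w * s n t w ^+ 2).
Hypothesis bound_cvg0 : (Num.sqrt n%:R)^-1 / eps n * B n @[n --> \oo] --> (0 : R).
Hypothesis var_cvg0 : {ae P, forall w,
  eps n ^- 2 * avg2 n (fun t => `|v n t w - s n t w ^+ 2|) @[n --> \oo] --> (0 : R)}.
Hypothesis clip_cvg0 : cvg_in_probability0 P (fun n w =>
  avg2 n (fun t => (s n t w <= 2 * eps n)%R%:R)).

Let st n t w : R := Num.max (Num.sqrt (v n t w)) (eps n).

Let bnd n : R := (Num.sqrt n%:R)^-1 / eps n * B n.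
Let q n t w : R := (Num.sqrt n%:R)^-1 / st n t w.
Let Z n i w : R := clamp (bnd n) (q n (n + i).+1 w * x n (n + i).+1 w).
Let V n i w : R := Num.min (q n (n + i).+1 w ^+ 2 * s n (n + i).+1 w ^+ 2) (bnd n ^+ 2).

Let idx n i : (i < n)%N -> (n < (n + i).+1 <= n.*2)%N.
Proof. by move=> i_n; rewrite ltnS leq_addr/= -addnn -addnS leq_add2l. Qed.

Let idx' n i : (n < (n + i).+1)%N.
Proof. by rewrite ltnS leq_addr. Qed.

Let st_eps n t w : (0 < n)%N -> 0 < st n t w.
Proof. by move=> n0; rewrite /st lt_max eps0// orbT. Qed.

Let q_bound n t w : (0 < n)%N -> 0 <= q n t w <= (Num.sqrt n%:R)^-1 / eps n.
Proof.
move=> n0; rewrite /q mulr_ge0//= ?invr_ge0 ?(ltW (st_eps _ _ n0))//.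
rewrite ler_wpM2l// lef_pV2 ?posrE ?eps0 ?st_eps//.
by rewrite /st le_max lexx orbT.
Qed.

Let mst n t : (n < t)%N -> adapted (F t.-1) (st n t).
Proof.
by move=> nt; apply: measurable_maxr => //; apply: measurable_funsqrt; exact: mv.
Qed.

Let mq n t : (n < t)%N -> adapted (F t.-1) (q n t).
Proof.
move=> nt; apply: measurable_funM; first exact: measurable_cst.
by apply: measurable_funV; exact: mst.
Qed.

(** The increment [i] belongs to round [(n + i).+1], whose past is [F (n + i)]. *)
Let Z_mart_diff n i : (i < n)%N ->
  mart_diff P (F (n + i)) (F (n + i.+1)) (bnd n) (Z n i) (V n i).
Proof.
move=> i_n; have n0 : (0 < n)%N by exact: leq_ltn_trans i_n.
have nt := idx i_n; have nt' := idx' n i.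
rewrite addnS; apply: weighted_mart_diff => //.
- exact: (@monoF (n + i).+1).
- exact: mx.
- by apply: (@measurable_funX _ _ _ setT _ 2); exact: (ms nt).
- exact: (mq nt').
- exact: xB.
- by move=> w; exact: sqr_ge0.
- exact: sB.
- by move=> w; exact: q_bound.
- by move=> W M mW WM; exact: (mean0 nt mW WM).
- by move=> W M mW WM; exact: (var nt mW WM).
Qed.

Let bnd_ge0 n : (0 < n)%N -> 0 <= bnd n.
Proof. by move=> n0; rewrite /bnd mulr_ge0// divr_ge0// ltW// eps0. Qed.

(** [Z1] carries the variance estimation error and [Z2] the proportion of low-variance rounds;
    [ratio_clip], applied round by round, bounds the deviation from 1 by their sum. *)
Let V_cvg : cvg_in_probability0 P (fun n w => \sum_(i < n) V n i w - 1).
Proof.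
pose Z1 n w : R := eps n ^- 2 * avg2 n (fun t => `|v n t w - s n t w ^+ 2|).
pose Z2 n w : R := 4 * avg2 n (fun t => (s n t w <= 2 * eps n)%R%:R).
have msT n t : (n < t <= n.*2)%N -> measurable_fun setT (s n t).
  by move=> nt; apply: adapted_measurable (ms nt); exact: sF.
have mvT n t : (n < t)%N -> measurable_fun setT (v n t).
  by move=> nt; apply: adapted_measurable (mv nt); exact: sF.
have tE n t : t \in index_iota n.+1 n.*2.+1 -> (n < t <= n.*2)%N.
  by rewrite mem_index_iota ltnS.
have mZ1 n : measurable_fun setT (Z1 n).
  apply: measurable_funM => //; apply: measurable_funM => //.
  apply: measurable_sum_in => t /tE nt; have /andP[nt1 _] := nt.
  apply: measurableT_comp => //; apply: measurable_funB; first exact: mvT.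
  by apply: (@measurable_funX _ _ _ setT _ 2); exact: msT.
have mZ2 n : measurable_fun setT (Z2 n).
  apply: measurable_funM => //; apply: measurable_funM => //.
  apply: measurable_sum_in => t /tE nt.
  have -> : (fun w => (s n t w <= 2 * eps n)%R%:R) = \1_[set w | s n t w <= 2 * eps n] :> (Om -> R).
    apply/funext => w; rewrite indicE; congr (_%:R); congr nat_of_bool.
    by apply/idP/idP; rewrite inE.
  apply: measurable_indic; rewrite -[X in measurable X]setTI.
  have -> : [set w | s n t w <= 2 * eps n] = s n t @^-1` `]-oo, 2 * eps n].
    by apply/seteqP; split => w /=; rewrite in_itv.
  by apply: msT.
apply: (@cvg_in_probability0_le _ _ _ _ _ Z1 Z2).
- move=> n; split => //; apply: measurable_funB => //.
  apply: measurable_sum_in => i _; have nt := idx (ltn_ord i).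
  apply: measurable_minr => //; apply: measurable_funM.
    apply: (@measurable_funX _ _ _ setT _ 2).
    by apply: adapted_measurable (mq (idx' n i)); exact: sF.
  by apply: (@measurable_funX _ _ _ setT _ 2); exact: msT.
- near=> n; have n0 : (0 < n)%N by near: n; exact: nbhs_infty_gt.
  have nR0 : (0 : R) < n%:R by rewrite ltr0n.
  (* A single null set serves all rounds of the second half; on its complement the truncation inside
     [V] is inactive. *)
  have : {ae P, forall w, forall i, (i < n)%N -> s n (n + i).+1 w ^+ 2 <= B n ^+ 2}.
    apply/ae_foralln => i; have [i_n|i_n] := ltnP i n; last by apply: aeW.
    by apply: filterS (sB (idx i_n)).
  apply: filterS => w sw.
  have VE (i : 'I_n) : V n i w = n%:R^-1 * (s n (n + i).+1 w ^+ 2 / st n (n + i).+1 w ^+ 2).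
    rewrite /V min_l.
      rewrite /q exprMn exprVn sqr_sqrtr ?ler0n// exprVn -mulrA; congr (_ * _).
      exact: mulrC.
    have /andP[q0 qB] := q_bound (n + i).+1 w n0.
    rewrite [leRHS]exprMn; apply: ler_pM; rewrite ?sqr_ge0 ?sw// ler_pXn2r// nnegrE//.
    exact: le_trans qB.
  under eq_bigr do rewrite VE.
  have -> : \sum_(i < n) n%:R^-1 * (s n (n + i).+1 w ^+ 2 / st n (n + i).+1 w ^+ 2) - 1 =
      n%:R^-1 * \sum_(i < n) (s n (n + i).+1 w ^+ 2 / st n (n + i).+1 w ^+ 2 - 1).
    rewrite sumrB mulrBr mulr_sumr sumr_const card_ord mulVf// gt_eqF//.
  have Z10 : 0 <= Z1 n w.
    by rewrite mulr_ge0 ?invr_ge0 ?sqr_ge0// mulr_ge0 ?invr_ge0 ?ler0n// sumr_ge0.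
  have Z20 : 0 <= Z2 n w.
    rewrite mulr_ge0// mulr_ge0 ?invr_ge0 ?ler0n// sumr_ge0// => t _; exact: ler0n.
  rewrite (ger0_norm Z10) (ger0_norm Z20) /Z1 /Z2 /avg2 !sum_second_half.
  rewrite mulrCA (mulrCA 4) -mulrDr normrM ger0_norm ?invr_ge0 ?ler0n//.
  rewrite ler_wpM2l ?invr_ge0 ?ler0n//.
  apply: (le_trans (ler_norm_sum _ _ _)); rewrite !mulr_sumr -big_split/=.
  by apply: ler_sum => i _; apply: ratio_clip => //; exact: eps0.
- exact: cvg_as_in_probability0.
- move=> e e0; have e4 : 0 < e / 4 by rewrite divr_gt0.
  have := @clip_cvg0 _ e4; apply: cvg_trans; apply: near_eq_cvg; apply: nearW => n.
  congr (P _); apply/funext => w /=.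
  rewrite /Z2 [in RHS]normrM (ger0_norm (ler0n R 4)).
  by rewrite ltr_pdivrMr// (mulrC 4).
Unshelve. all: by end_near. Qed.

(** The limit theorem is applied to the truncated increments [Z], whose sum agrees almost surely
    with the statistic and so has the same distribution function. *)
Lemma studentized_clt y :
  P [set w | (Num.sqrt n%:R)^-1 * \sum_(n.+1 <= t < n.*2.+1) (st n t w)^-1 * x n t w <= y]
    @[n --> \oo] --> (gcdf y)%:E.
Proof.
have := @martingale_clt _ _ _ P id (fun n i => F (n + i)) bnd Z V _ bound_cvg0 V_cvg y.
case/(_ _)/wrap.
  near=> n; have n0 : (0 < n)%N by near: n; exact: nbhs_infty_gt.
  by split; [exact: sF|exact: bnd_ge0|exact: Z_mart_diff].
apply: cvg_trans; apply: near_eq_cvg; near=> n.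
have n0 : (0 < n)%N by near: n; exact: nbhs_infty_gt.
have mxT t : (n < t)%N -> measurable_fun setT (x n t).
  by move=> nt; apply: adapted_measurable (mx nt); exact: sF.
have mqT t : (n < t)%N -> measurable_fun setT (q n t).
  by move=> nt; apply: adapted_measurable (mq nt); exact: sF.
have mstT t : (n < t)%N -> measurable_fun setT (st n t).
  by move=> nt; apply: adapted_measurable (mst nt); exact: sF.
apply: prob_le_ae_eq.
- apply: measurable_sum_in => i _; apply: measurable_clamp.
  by apply: measurable_funM; [exact: mqT|exact: mxT].
- apply: measurable_funM => //; apply: measurable_sum_in => t.
  rewrite mem_index_iota => /andP[nt _]; apply: measurable_funM; last exact: mxT.
  by apply: measurable_funV; exact: mstT.
have : {ae P, forall w, forall i, (i < n)%N -> `|x n (n + i).+1 w| <= B n}.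
  apply/ae_foralln => i; have [i_n|i_n] := ltnP i n; last by apply: aeW.
  by apply: filterS (xB (idx i_n)).
apply: filterS => w xw; rewrite sum_second_half mulr_sumr.
apply: eq_bigr => i _; rewrite /Z clamp_id ?mulrA//.
have /andP[q0 qB] := q_bound (n + i).+1 w n0.
by rewrite normrM ler_pM ?xw// ger0_norm.
Unshelve. all: by end_near. Qed.

End StudentizedCLT.

(** * Power rates *)

Section PowerRates.
Context {R : realType}.

Lemma powR_natN_gt0 n (r : R) : (0 < n)%N -> 0 < n%:R `^ (- r) :> R.
Proof. by move=> n0; rewrite powR_gt0// ltr0n. Qed.

Lemma le_powR_natN m n (r : R) : 0 <= r -> (0 < m <= n)%N ->
  n%:R `^ (- r) <= m%:R `^ (- r) :> R.
Proof.
move=> r0 /andP[m0 mn]; have n0 : (0 < n)%N := leq_trans m0 mn.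
rewrite !powRN lef_pV2 ?posrE ?powR_gt0 ?ltr0n//.
by apply: ge0_ler_powR; rewrite ?nnegrE ?ler0n ?ler_nat.
Qed.

(** The leading term is of order [n ^ (alpha + rho - 1/2)]; the floor is taken at the last round
    [n.*2], which costs the factor [2 ^ alpha]. *)
Lemma weighted_bound_cvg0 (alpha rho c a b : R) : alpha + rho < 2^-1 -> 0 <= alpha ->
  (Num.sqrt n%:R)^-1 / n%:R `^ (- rho) * (2 * (a / (c * n.*2%:R `^ (- alpha)) + b))
    @[n --> \oo] --> (0 : R).
Proof.
move=> ar a0.
have c1 : n%:R `^ (- (2^-1 - (alpha + rho))) @[n --> \oo] --> (0 : R).
  by apply: powR_natN_cvg0; rewrite subr_gt0.
have c2 : n%:R `^ (- (2^-1 - rho)) @[n --> \oo] --> (0 : R).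
  by apply: powR_natN_cvg0; lra.
have c3 : (2 * a / c * 2 `^ alpha) * n%:R `^ (- (2^-1 - (alpha + rho))) +
    (2 * b) * n%:R `^ (- (2^-1 - rho)) @[n --> \oo] --> (0 : R).
  have -> : 0 = (2 * a / c * 2 `^ alpha) * 0 + (2 * b) * 0 :> R by rewrite !mulr0 addr0.
  by apply: cvgD; exact: cvgMl_tmp.
apply: cvg_trans c3; apply: near_eq_cvg; near=> n.
have n0 : (0 < n)%N by near: n; exact: nbhs_infty_gt.
have nN0 : n%:R != 0 :> R by rewrite pnatr_eq0 -lt0n.
rewrite -(powR12_sqrt (ler0n _ n)) -muln2 natrM powRM ?ler0n//.
rewrite !opprB !powRD ?nN0 ?implybT// !powRN !invfM !invrK.
ring.
Unshelve. all: by end_near. Qed.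

Lemma bigO_powR_cvg0 (Z : nat -> R) (rho nu M : R) : 2 * rho < nu ->
  (\forall n \near \oo, `|Z n| * (n%:R `^ (- nu))^-1 <= M) ->
  (n%:R `^ (- rho)) ^- 2 * Z n @[n --> \oo] --> (0 : R).
Proof.
move=> rn ZM; apply/norm_cvg0P.
have c1 : n%:R `^ (- (nu - 2 * rho)) * M @[n --> \oo] --> (0 : R).
  rewrite -[X in _ --> X](mul0r M); apply: cvgMr_tmp.
  by apply: powR_natN_cvg0; rewrite subr_gt0.
apply: (squeeze_cvgr _ (cvg_cst 0) c1); near=> n.
have n0 : (0 < n)%N by near: n; exact: nbhs_infty_gt.
have nN0 : n%:R != 0 :> R by rewrite pnatr_eq0 -lt0n.
have p0 : 0 < n%:R `^ (- nu) :> R by exact: powR_natN_gt0.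
have q0 : 0 < n%:R `^ (- rho) :> R by exact: powR_natN_gt0.
rewrite normr_ge0/= normrM ger0_norm ?invr_ge0 ?sqr_ge0//.
have -> : n%:R `^ (- (nu - 2 * rho)) = (n%:R `^ (- rho)) ^- 2 * n%:R `^ (- nu) :> R.
  rewrite opprB powRD ?nN0 ?implybT//; congr (_ * _).
  by rewrite powRN exprVn invrK -powR_mulrn ?powR_ge0// -powRrM mulrC.
rewrite -mulrA ler_wpM2l ?invr_ge0 ?sqr_ge0// mulrC -ler_pdivrMr//.
by near: n.
Unshelve. all: by end_near. Qed.

End PowerRates.

(** By the reproducing property the squared norm of [phi y] is [k y y]. *)
Lemma rkhs_norm_le (R : realType) (H : hilbertType R) (Y : Type) (k : Y -> Y -> R)
    (ev : H -> Y -> R) (phi : Y -> H) (kappa : R) :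
  is_rkhs k ev phi -> (forall y, k y y <= kappa) -> forall y, `|phi y| <= Num.sqrt kappa.
Proof.
move=> rk kk y; rewrite -[leLHS]normr_id -sqrtr_sqr ler_wsqrtr//.
by rewrite -inner_norm -(rkhs_reproducing rk) (rkhs_feature rk).
Qed.

Theorem theorem4p4
  (R : realType) (dO dX dA dY : measure_display)
  (Om : measurableType dO) (X : measurableType dX)
  (A : measurableType dA) (Y : measurableType dY)
  (P : probability Om R) (PX : probability X R)
  (Q : R.-pker (X * A)%type ~> Y) (Pi : set (A -> X -> R))
  (H : hilbertType R) (k : Y -> Y -> R) (ev : H -> Y -> R) (phi : Y -> H)
  (D : experiment Om X A Y H) (a a' : A) (u0 : H)
  (nu : R -> R -> R -> R) (alpha beta p rho : R)
  (hA : discrete_actions A)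
  (hrkhs : is_rkhs k ev phi) (hphi : strongly_measurable phi)
  (hdata : adaptive_data P PX Q Pi D)
  (hu0 : `|u0| = 1)
  (h1 : ignorability_positivity P D a a')
  (h2 : kernel_assumption phi k)
  (h3 : nuisance_envelope P D)
  (h4 : nuisance_stabilization P PX D beta)
  (h5 : policy_class PX Pi p)
  (h6 : exploration_floor P PX D alpha beta p)
  (h7 : negligible_clipping P phi D a a' u0 (fun n => n%:R `^ (- rho)))
  (hnu0 : 0 < nu alpha beta p)
  (hnu : ignorability_positivity P D a a' -> kernel_assumption phi k ->
         nuisance_envelope P D -> nuisance_stabilization P PX D beta ->
         policy_class PX Pi p -> exploration_floor P PX D alpha beta p ->
         moment_rates P phi D a a' u0 (nu alpha beta p))
  (hrho : 0 < rho < Num.min ((1 - 3 * alpha) / 4) (nu alpha beta p / 2)) :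
  eta PX Q phi a = eta PX Q phi a' ->
  cvg_in_distribution P
    (Tstat phi D a a' u0 (fun n => n%:R `^ (- rho)))
    (normal_prob 0 1).
Proof.
move=> eta_eq y _.
have [kappa kk] : exists kappa, forall y0, k y0 y0 <= kappa by case: h2.
have phiK := rkhs_norm_le hrkhs kk; set K := Num.sqrt kappa in phiK.
have K0 : 0 <= K by exact: sqrtr_ge0.
have [Bmu hB] := h3; pose B := `|Bmu|.
have muB : {ae P, forall w, forall t b x, (1 <= t)%N -> `|muhat2 D t.-1 w b x| <= B}.
  apply: filterS hB => w hB t b x t1; have [_ le2] := hB t b x t1.
  exact: le_trans le2 (ler_norm _).
have [/andP[alpha0 _]] := h6; rewrite !lt_min => /andP[alphap _] [c0 c00 hc0].
have [p0 _] := h5.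
have alpha3 : alpha < 1 / 3.
  apply: (lt_le_trans alphap); rewrite div1r lef_pV2 ?posrE; lra.
move: hrho; rewrite lt_min => /andP[rho0 /andP[rho1 rho2]].
pose eps (n : nat) : R := n%:R `^ (- rho).
(* The exploration floor decreases in time, so its value at round [n.*2] is valid throughout the
   second half. *)
pose c (n : nat) : R := c0 * n.*2%:R `^ (- alpha).
have c_gt0 n : (0 < n)%N -> 0 < c n.
  by move=> n0; apply: mulr_gt0 c00 _; apply: powR_natN_gt0; rewrite double_gt0.
have hc n t : (n < t <= n.*2)%N -> forall b, {ae P, forall w, c n <= pol D t w b (ctx D t w)}.
  move=> /andP[nt tn] b; have t1 : (1 <= t)%N by exact: leq_ltn_trans nt.
  apply: (pol_ctx_ge hdata); first exact: t1.
  apply: filterS hc0 => w /(_ t b t1).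
  apply: filterS => x; apply: le_trans; apply: ler_wpM2l; first exact: ltW.
  by apply: le_powR_natN; [exact: alpha0|rewrite t1].
have n_gt0 n t : (n < t <= n.*2)%N -> (0 < n)%N.
  by move=> /andP[nt tn]; rewrite -double_gt0; exact: leq_ltn_trans (leq0n n) (leq_trans nt tn).
have nt1 n t : (n < t <= n.*2)%N -> (n < t)%N by case/andP.
pose Bx n := 2 * ((K + B) / c n + B).
have -> : normal_prob 0 1 [set z : R | z <= y] = (gcdf y)%:E.
  by rewrite -normal_prob_ray set_itvE.
apply: (@studentized_clt _ _ _ P (hist D) (xi phi D a a' u0) (sigma0 P phi D a a' u0)
  (sigmahat2 phi D a a' u0) eps Bx).
- by move=> t; exact: sub_sigma_hist.
- by move=> t; apply: hist_mono; exact: leq_pred.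
- move=> n t nt; apply: (adapted_xi hA hdata hphi); last exact: ltnW.
  exact: leq_ltn_trans nt.
- move=> n t nt.
  exact: (adapted_sigma0 hA hdata hphi phiK muB hu0 eta_eq (nt1 _ _ nt)
    (c_gt0 _ (n_gt0 _ _ nt)) (hc _ _ nt)).
- by move=> n t nt; exact: (adapted_sigmahat2 hA hdata hphi).
- by move=> n t w; exact: sqrtr_ge0.
- move=> n t w; rewrite /sigmahat2; case: ifP => _; first exact: ler01.
  by rewrite le_max lexx orbT.
- move=> n; apply: mulr_ge0; first exact: ler0n.
  apply: addr_ge0; last exact: normr_ge0.
  apply: divr_ge0; first exact: addr_ge0 K0 (normr_ge0 _).
  exact: mulr_ge0 (ltW c00) (powR_ge0 _ _).
- by move=> n; exact: powR_natN_gt0.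
- move=> n t nt.
  exact: (xi_bound phiK muB a a' hu0 (nt1 _ _ nt) (c_gt0 _ (n_gt0 _ _ nt)) (hc _ _ nt)).
- move=> n t nt.
  apply: filterS (sigma0_sqr hA hdata hphi phiK muB hu0 eta_eq (nt1 _ _ nt)
    (c_gt0 _ (n_gt0 _ _ nt)) (hc _ _ nt)) => w [-> /andP[_]].
  exact.
- move=> n t V M nt mV VM.
  exact: (xi_mean0 hA hdata hphi phiK muB hu0 eta_eq (nt1 _ _ nt)
    (c_gt0 _ (n_gt0 _ _ nt)) (hc _ _ nt) mV VM).
- move=> n t V M nt mV VM.
  exact: (xi_sqr_mean hA hdata hphi phiK muB hu0 eta_eq (nt1 _ _ nt)
    (c_gt0 _ (n_gt0 _ _ nt)) (hc _ _ nt) mV VM).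
(* From [rho < (1 - 3 * alpha) / 4] one gets [alpha + rho < (1 + alpha) / 4], which is below [1 / 3]
   since [alpha < 1 / 3]. *)
- apply: weighted_bound_cvg0 alpha0; lra.
(* The third moment rate, multiplied by [n ^ (2 * rho)], tends to 0 because [2 * rho] is below the
   rate exponent. *)
- have [_ _ /bigO_as_bounded] := hnu h1 h2 h3 h4 h5 h6.
  apply: filterS => w [M ZM]; apply: bigO_powR_cvg0 ZM; lra.
- exact: h7.
Qed.
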